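(* Let $\mathbb G$ be a Carnot group of step 2 and rank $m$, and let $\mathbb W$ and $\mathbb L$ be two complementary subgroups of $\mathbb G$, with $\mathbb L$ horizontal and one-dimensional. Let $U\subseteq\mathbb W$ be an open set and let $\varphi\colon U\to\mathbb L$ be a continuous function. Fix coordinates on $\mathbb G$ adapted to the splitting $(\mathbb W,\mathbb L)$ as described in the context. Assume that there exists $\omega=(\omega_2,\dots,\omega_m)\in C(U;\mathbb R^{m-1})$ such that $D^{\varphi}\varphi=\omega$ holds in the distributional sense on $U$. Then $D^{\varphi}\varphi=\omega$ holds in the broad* sense on $U$.
   Context: **Carnot groups of step 2.** A Carnot group $\mathbb G$ of step 2 is a connected, simply connected Lie group whose Lie algebra is $\mathfrak g=V_1\oplus V_2$ with $V_1,V_2\neq\{0\}$, $[V_1,V_1]=V_2$, $[V_1,V_2]=\{0\}$. Its rank is $m=\dim V_1$; put $h=\dim V_2$. The dilations $\delta_\lambda$ ($\lambda>0$) are the linear maps of $\mathfrak g$ with $\delta_\lambda X=\lambda^jX$ for $X\in V_j$, transported to $\mathbb G$ by the diffeomorphism $\exp$. A subgroup is homogeneous if it is closed under all $\delta_\lambda$. Homogeneous subgroups $\mathbb W,\mathbb L$ are complementary if $\mathbb G=\mathbb W\cdot\mathbb L$ and $\mathbb W\cap\mathbb L=\{e\}$. $\mathbb L$ is horizontal and one-dimensional if $\mathbb L=\exp(\mathrm{span}\{X\})$ for some $0\ne X\in V_1$. Fix a homogeneous norm $\|\cdot\|$ on $\mathbb G$ (i.e. $\|\delta_\lambda x\|=\lambda\|x\|$,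 $\|xy\|\le\|x\|+\|y\|$, $\|x^{-1}\|=\|x\|$, $\|x\|=0$ iff $x=e$); $B(a,r)=\{x\in\mathbb G:\|a^{-1}x\|<r\}$. **Coordinates.** Choose a basis $(X_1,\dots,X_m,Y_1,\dots,Y_h)$ of $\mathfrak g$ such that $X_1,\dots,X_m$ is a basis of $V_1$, $Y_1,\dots,Y_h$ is a basis of $V_2$ chosen among the commutators of the $X_j$'s, $\mathbb L=\exp(\mathrm{span}\{X_1\})$ and $\mathbb W=\exp(\mathrm{span}\{X_2,\dots,X_m,Y_1,\dots,Y_h\})$. Let $[X_j,X_\ell]=\sum_{i=1}^h b^{(i)}_{j\ell}Y_i$. Identify $\mathbb G$ with $\mathbb R^{m+h}$ via $(x,y)\leftrightarrow\exp(\sum_j x_jX_j+\sum_i y_iY_i)$; the product is $(x,y)\cdot(x',y')=(x+x',\,(y_i+y_i'-\tfrac12\sum_{j,\ell}b^{(i)}_{j\ell}x_\ell x'_j)_{i})$. Then $\mathbb L=\{(x_1,0,\dots,0)\}\equiv\mathbb R$ and $\mathbb W=\{x_1=0\}\equiv\mathbb R^{m+h-1}$ with coordinates $(x_2,\dots,x_m,y_1,\dots,y_h)$. Functions with values in $\mathbb L$ are regarded as real-valued. **Projected vector fields.** For continuous $\varphi\colon U\subseteq\mathbb W\to\mathbb L$ with $U$ open and $j=2,\dots,m$, on $U$ set $$D^\varphi_j=\partial_{x_j}-\sum_{i=1}^h\Big(b^{(i)}_{j1}\varphi+\tfrac12\sum_{k=2}^m x_kb^{(i)}_{jk}\Big)\partial_{y_i},\qquad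 D^\varphi=(D^\varphi_2,\dots,D^\varphi_m).$$ **Distributional sense.** $D^\varphi\varphi=\omega$ holds in the distributional sense on $U$ if for all $j=2,\dots,m$ and all $\xi\in C^\infty_c(U)$ $$\int_U\Big(-\varphi\,\partial_{x_j}\xi+\tfrac12\sum_{i=1}^hb^{(i)}_{j1}\varphi^2\,\partial_{y_i}\xi+\tfrac12\sum_{i=1}^h\sum_{k=2}^mx_kb^{(i)}_{jk}\varphi\,\partial_{y_i}\xi\Big)\,dx\,dy=\int_U\omega_j\,\xi\,dx\,dy.$$ **Broad\* sense.** $D^\varphi\varphi=\omega$ holds in the broad* sense on $U$ if for every $a_0\in U$ there exist $0<\delta_2<\delta_1$ with $\overline{B(a_0,\delta_1)}\cap\mathbb W\subseteq U$ and maps $E_j\colon(\overline{B(a_0,\delta_2)}\cap\mathbb W)\times[-\delta_2,\delta_2]\to\overline{B(a_0,\delta_1)}\cap\mathbb W$, $j=2,\dots,m$, such that for all $a\in\overline{B(a_0,\delta_2)}\cap\mathbb W$ and all $j$: (i) $t\mapsto E_j(a,t)$ is $C^1$ and solves $\dot\gamma=D^\varphi_j\circ\gamma$, $\gamma(0)=a$ on $[-\delta_2,\delta_2]$; (ii) $\varphi(E_j(a,t))-\varphi(a)=\int_0^t\omega_j(E_j(a,s))\,ds$ for all $t\in[-\delta_2,\delta_2]$. *)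

(* Defs.v *)
From HB Require Import structures.
From mathcomp Require Import all_boot all_order all_algebra.
From mathcomp Require Import all_classical all_reals all_analysis.
Set Implicit Arguments.
Unset Strict Implicit.
Unset Printing Implicit Defensive.
Import Order.TTheory GRing.Theory Num.Theory.
Import numFieldNormedType.Exports.
Local Open Scope classical_set_scope.
Local Open Scope ring_scope.

Section LieAlgebra.
Context {R : realType} {g : vectType R}.
Implicit Types (br : g -> g -> g) (U V : {vspace g}).

Definition is_lie_bracket br :=
  [/\ forall u, linear (br u),
      forall v, linear (br^~ v),
      forall u, br u u = 0 &
      forall u v w, br u (br v w) + br v (br w u) + br w (br u v) = 0].

(* [U, V] is the span of all brackets of elements of U and V; by bilinearity
   bases suffice (the library defines [prodv] in the same way). *)
Definition brv br U V : {vspace g} :=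
  <<[seq br u v | u <- vbasis U, v <- vbasis V]>>%VS.

Definition step2_stratification br (V1 V2 : {vspace g}) :=
  [/\ (V1 + V2 = fullv)%VS /\ (V1 :&: V2 = 0)%VS,
      V1 <> 0%VS /\ V2 <> 0%VS,
      brv br V1 V1 = V2 &
      brv br V1 V2 = 0%VS].

(* The linear map acting as [lambda ^+ j] on V_j. *)
Definition dil (V1 V2 : {vspace g}) (lambda : R) (u : g) : g :=
  lambda *: daddv_pi V1 V2 u + lambda ^+ 2 *: daddv_pi V2 V1 u.

End LieAlgebra.

(* G is a group with an exponential map [Exp] from its Lie algebra [g].
   For a connected, simply connected nilpotent group of step 2, exp is a
   diffeomorphism and the product is given by the Baker-Campbell-Hausdorff
   formula exp u exp v = exp (u + v + [u, v] / 2).  Conversely these data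
   determine the Lie group up to isomorphism; the topology of G is the one
   transported by exp. *)
Record is_carnot2 (R : realType) (g : vectType R) (br : g -> g -> g)
    (V1 V2 : {vspace g}) (G : groupType) (Exp : g -> G) : Prop := IsCarnot2 {
  carnot2_lie : is_lie_bracket br;
  carnot2_strat : step2_stratification br V1 V2;
  carnot2_exp_bij : bijective Exp;
  carnot2_BCH : forall u v,
    (Exp u * Exp v)%g = Exp (u + v + 2^-1 *: br u v) }.

Section Subgroups.
Context {R : realType} {g : vectType R} {G : groupType}.
Variables (V1 V2 : {vspace g}) (Exp : g -> G).
Implicit Types W L : set G.

Definition is_subgroup W :=
  [/\ W 1%g, forall p q, W p -> W q -> W (p * q)%g
    & forall p, W p -> W (p^-1)%g].

Definition homogeneous_subgroup W :=
  is_subgroup W /\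
  forall (lambda : R) u, 0 < lambda ->
    W (Exp u) -> W (Exp (dil V1 V2 lambda u)).

Definition complementary W L :=
  [/\ homogeneous_subgroup W, homogeneous_subgroup L,
      (forall p, exists w l, [/\ W w, L l & p = (w * l)%g]) &
      W `&` L = [set 1%g]].

Definition horizontal_one_dim L :=
  exists u, [/\ u \in V1, u <> 0 & L = Exp @` [set` <[u]>%VS]].

Record homogeneous_norm (N : G -> R) : Prop := HomogeneousNorm {
  hnorm_dil : forall (lambda : R) u, 0 < lambda ->
    N (Exp (dil V1 V2 lambda u)) = lambda * N (Exp u);
  hnormM : forall p q, N (p * q)%g <= N p + N q;
  hnormV : forall p, N (p^-1)%g = N p;
  hnorm_eq0 : forall p, N p = 0 <-> p = 1%g }.

End Subgroups.

(* The rank is [n.+1]: X_1, ..., X_m are [tnth X i] for [i : 'I_n.+1], the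
   index 1 being [ord0], and the indices j = 2, ..., m are [lift ord0 j] for
   [j : 'I_n]. *)
Record adapted_basis (R : realType) (g : vectType R) (br : g -> g -> g)
    (V1 V2 : {vspace g}) (G : groupType) (Exp : g -> G) (W L : set G)
    (n h : nat) (X : n.+1.-tuple g) (Y : h.-tuple g) : Prop := AdaptedBasis {
  adapted_X : basis_of V1 X;
  adapted_Y : basis_of V2 Y;
  adapted_comm : forall i, exists j l,
    tnth Y i = br (tnth X j) (tnth X l);
  adapted_L : L = Exp @` [set` <[thead X]>%VS];
  adapted_W : W = Exp @` [set` <<behead X ++ Y>>%VS] }.

Section Coordinates.
Context {R : realType} {g : vectType R} {G : groupType}.
Variables (br : g -> g -> g) (Exp : g -> G).
Variables (n h : nat) (X : n.+1.-tuple g) (Y : h.-tuple g).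

(* [structc i j l] is b^(i)_{jl}. *)
Definition structc (i : 'I_h) (j l : 'I_n.+1) : R :=
  coord Y i (br (tnth X j) (tnth X l)).

(* (x, y) <-> exp (sum_j x_j X_j + sum_i y_i Y_i) *)
Definition gpoint (p : 'rV[R]_n.+1 * 'rV[R]_h) : G :=
  Exp (\sum_(j < n.+1) p.1 0 j *: tnth X j + \sum_(i < h) p.2 0 i *: tnth Y i).

Definition gball (N : G -> R) (a : 'rV[R]_n.+1 * 'rV[R]_h) (r : R) :
    set ('rV[R]_n.+1 * 'rV[R]_h) :=
  [set p | N ((gpoint a)^-1 * gpoint p)%g < r].

(* (x_2, ..., x_m, y) |-> (0, x_2, ..., x_m, y) *)
Definition Winj (a : 'rV[R]_n * 'rV[R]_h) : 'rV[R]_n.+1 * 'rV[R]_h :=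
  (row_mx (0 : 'rV[R]_1) a.1, a.2).

(* The closure of B(a, r), taken in G, intersected with W and read in the
   coordinates of W. *)
Definition Wcball (N : G -> R) (a : 'rV[R]_n * 'rV[R]_h) (r : R) :
    set ('rV[R]_n * 'rV[R]_h) :=
  Winj @^-1` closure (gball N (Winj a) r).

End Coordinates.

Lemma sigma_finite_product (R : realType) (d1 d2 : measure_display)
    (T1 : measurableType d1) (T2 : measurableType d2)
    (m1 : {sigma_finite_measure set T1 -> \bar R})
    (m2 : {sigma_finite_measure set T2 -> \bar R}) :
  sigma_finite setT (m1 \x m2)%E.
Proof.
have /sigma_finiteP[F [TF ndF Foo]] := sigma_finiteT m1.
have /sigma_finiteP[H [TH ndH Hoo]] := sigma_finiteT m2.
exists (fun k => F k `*` H k).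
  rewrite -setXTT TF TH predeqE => -[x y]; split.
    move=> [/= [i _ Fx] [k _ Hy]]; exists (maxn i k) => //; split.
    - by move: x Fx; exact/subsetPset/ndF/leq_maxl.
    - by move: y Hy; exact/subsetPset/ndH/leq_maxr.
  by move=> [i _ []/= ? ?]; split; exists i.
move=> k; have [? ?] := Foo k; have [? ?] := Hoo k.
split; first exact: measurableX.
by rewrite product_measure1E// lte_mul_pinfty// ge0_fin_numE.
Qed.

Section LebesgueRn.
Context {R : realType}.
Local Notation mR := (measurableTypeR R).

Section Step.
Context {n : nat} (mu : {sigma_finite_measure set (n.-tuple mR) -> \bar R}).

Definition tcons (p : mR * n.-tuple mR) : n.+1.-tuple mR :=
  [tuple of p.1 :: p.2].

Definition tuncons (t : n.+1.-tuple mR) : mR * n.-tuple mR :=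
  (thead t, [tuple of behead t]).

Lemma measurable_tcons : measurable_fun setT tcons.
Proof. exact: measurable_cons. Qed.

Lemma measurable_tuncons : measurable_fun setT tuncons.
Proof.
apply/measurable_fun_pairP; split.
  exact: (measurable_tnth ord0).
exact: measurable_behead.
Qed.

Lemma tconsK : cancel tcons tuncons.
Proof. by case=> x t; congr pair; exact/val_inj. Qed.

Definition lebesgue_tupleS : set (n.+1.-tuple mR) -> \bar R :=
  pushforward (lebesgue_measure \x mu)%E tcons.

HB.instance Definition _ := Measure.copy lebesgue_tupleS
  (measure_function_pushforward__canonical__measure_function_Measure
     (lebesgue_measure \x mu)%E measurable_tcons).

Lemma lebesgue_tupleS_sigma_finite : sigma_finite setT lebesgue_tupleS.
Proof.
have [F FT mF] := sigma_finite_product lebesgue_measure mu.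
exists (fun k => tuncons @^-1` F k).
  by rewrite -preimage_bigcup -FT preimage_setT.
move=> k; have [mFk Fk] := mF k; split.
  by rewrite -[X in measurable X]setTI; exact: measurable_tuncons.
rewrite /lebesgue_tupleS /pushforward -comp_preimage.
by rewrite (_ : tuncons \o tcons = id) //; apply/funext => p; exact: tconsK.
Qed.

HB.instance Definition _ := @Measure_isSigmaFinite.Build _ _ _
  lebesgue_tupleS lebesgue_tupleS_sigma_finite.

End Step.

(* Lebesgue measure on R^n, as the n-fold product of the Lebesgue measure on
   the line. *)
Fixpoint lebesgue_tuple (n : nat) :
    {sigma_finite_measure set (n.-tuple mR) -> \bar R} :=
  match n with
  | 0%N => \d_([tuple] : 0.-tuple mR)
  | n'.+1 => lebesgue_tupleS (lebesgue_tuple n')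
  end.

Definition tuple_rV n (t : n.-tuple mR) : 'rV[R]_n := \row_j tnth t j.

(* Integral over [A] with respect to Lebesgue measure on R^n x R^h; the
   measurable structure is carried by tuples, the topology by row vectors. *)
Definition integralW n h (A : set ('rV[R]_n * 'rV[R]_h))
    (F : 'rV[R]_n * 'rV[R]_h -> R) : R :=
  let pt (t : n.-tuple mR * h.-tuple mR) := (tuple_rV t.1, tuple_rV t.2) in
  \int[(lebesgue_tuple n \x lebesgue_tuple h)%E]_(t in pt @^-1` A) F (pt t).

(* The oriented integral from [s] to [t]. *)
Definition ointegral (f : R -> R) (s t : R) : R :=
  if s <= t then \int[lebesgue_measure]_(x in `[s, t]) f x
  else - \int[lebesgue_measure]_(x in `[t, s]) f x.

End LebesgueRn.

Section TestFunctions.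
Context {R : realType} {V : normedModType R}.

(* Functions of class C^k; [V] is finite-dimensional where this is used. *)
Fixpoint Ck (k : nat) (f : V -> R) : Prop :=
  match k with
  | 0%N => continuous f
  | k'.+1 => (forall x, differentiable f x) /\ forall v, Ck k' ('D_v f)
  end.

Definition test_function (U : set V) (xi : V -> R) :=
  [/\ forall k, Ck k xi,
      compact (closure [set x | xi x != 0]) &
      closure [set x | xi x != 0] `<=` U].

End TestFunctions.

Section Curves.
Context {R : realType} {V : normedModType R}.

(* Derivative at [t] relative to [A] (one-sided at the end points of a
   segment). *)
Definition derive_within (A : set R) (gamma : R -> V) (t : R) (v : V) :=
  (s - t)^-1 *: (gamma s - gamma t) @[s --> within (A `\ t) (nbhs t)] --> v.

Definition C1_integral_curve (F : V -> V) (a : V) (d : R) (gamma : R -> V) :=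
  [/\ gamma 0 = a,
      forall t, t \in `[- d, d] -> derive_within `[- d, d] gamma t (F (gamma t)) &
      {within `[- d, d], continuous (F \o gamma)}].

End Curves.

Section ProjectedFields.
Context {R : realType} {n h : nat}.
Local Notation Wc := ('rV[R]_n * 'rV[R]_h)%type.
(* [b i j l] is b^(i)_{jl}. *)
Variable b : 'I_h -> 'I_n.+1 -> 'I_n.+1 -> R.
Variables (U : set Wc) (phi : Wc -> R) (omega : Wc -> 'rV[R]_n).

Definition dirx (j : 'I_n) : Wc := (delta_mx 0 j, 0).
Definition diry (i : 'I_h) : Wc := (0, delta_mx 0 i).

(* D^phi_j, as a map from U to R^(n + h). *)
Definition Dphi (j : 'I_n) (p : Wc) : Wc :=
  dirx j - \sum_(i < h)
    (b i (lift ord0 j) ord0 * phi p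
     + 2^-1 * \sum_(k < n) p.1 0 k * b i (lift ord0 j) (lift ord0 k)) *: diry i.

Definition distributional_solution :=
  forall (j : 'I_n) (xi : Wc -> R), test_function U xi ->
  integralW U (fun p =>
      - phi p * 'D_(dirx j) xi p
      + 2^-1 * \sum_(i < h)
          b i (lift ord0 j) ord0 * phi p ^+ 2 * 'D_(diry i) xi p
      + 2^-1 * \sum_(i < h) \sum_(k < n)
          p.1 0 k * b i (lift ord0 j) (lift ord0 k) * phi p * 'D_(diry i) xi p)
  = integralW U (fun p => omega p 0 j * xi p).

(* [cball a r] stands for the trace on W of the closed ball of centre [a] and
   radius [r]; the values of [E] outside the domain of E_j are irrelevant. *)
Definition broad_star_solution (cball : Wc -> R -> set Wc) :=
  forall a0, U a0 ->
  exists d1 d2 : R, [/\ 0 < d2, d2 < d1, cball a0 d1 `<=` U &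
  exists E : 'I_n -> Wc -> R -> Wc,
  forall a j, cball a0 d2 a ->
  [/\ forall t, t \in `[- d2, d2] -> cball a0 d1 (E j a t),
      C1_integral_curve (Dphi j) a d2 (E j a) &
      forall t, t \in `[- d2, d2] ->
        phi (E j a t) - phi a
        = ointegral (fun s => omega (E j a s) 0 j) 0 t]].

End ProjectedFields.

(* Main.v *)
(* Along the j-th field, the characteristic issued from [a] is
   gamma(r) = (a_x + r e_j, a_y - r a_x Lm - z(r) b) with z' = phi(gamma), and
   such a z exists by Peano's theorem.  That (phi o gamma)' = omega_j(gamma)
   follows as in Dafermos' argument for continuous solutions of Burgers' equation.
   Test the equation with psi(S_r (p - gamma(r))), where S_r is the shear that
   makes the bump follow the linear part of the field; this leaves the error
   term -1/2 int (phi - z')^2 D_b psi.  If psi is the indicator of a thin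
   neighbourhood of gamma(r) cut along the face transversal to b through
   gamma(r), then D_b psi is positive only on that face, where phi - z' is
   arbitrarily small, so the error has a sign up to a small quantity; the weight
   of the face is controlled by the mass of psi, independently of its thickness.
   This gives one inequality between phi(gamma(t)) - phi(gamma(s)) and the
   bounds of omega_j; the other one follows from the symmetry
   (phi, b, omega) -> (-phi, -b, -omega).  Finally, homogeneous balls and Euclidean
   balls are comparable near a point, which yields uniform existence times. *)
From HB Require Import structures.
Require Import Defs.
From mathcomp Require Import all_boot all_order all_algebra.
From mathcomp Require Import all_classical all_reals all_analysis.
From mathcomp Require Import measurable_realfun ring lra.
Set SsrOldRewriteGoalsOrder.
Set Implicit Arguments.
Unset Strict Implicit.
Unset Printing Implicit Defensive.
Import Order.TTheory GRing.Theory Num.Theory.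
Import numFieldNormedType.Exports.
Local Open Scope classical_set_scope.
Local Open Scope ring_scope.

(** * Functions of class C^k and a smooth step *)

(** As [phi] is merely continuous, it cannot be differentiated along a characteristic directly: the
    equation is only known after pairing with smooth functions. The quantity followed is therefore
    the integral of [phi] against the bump carried by the curve. Its derivative contains an error
    that is quadratic in [phi - z'] but multiplied by [D_b psi], which grows like the inverse of the
    width of [psi]; without a modulus of continuity for [phi], the square does not compensate this
    factor for a symmetric bump. Hence the order of choices in [slab_bump]: the height [kappa] of
    the slab is fixed from the required accuracy, and only then the thickness of the face near [0]
    is made small in terms of [kappa]. That the weight of this face is at most the mass divided by
    [kappa] comes from comparing [psi] with a derivative along [b], whose integral is [0]. To have
    curves for all times and integrals over the whole space, [phi] and [omega] are composed with the
    radial retraction onto a closed ball inside [U]; test functions supported in the open ball do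
    not see the change. *)

Section CkTheory.
Context {R : realType}.
Implicit Types V W : normedModType R.

Lemma CkW V k (f : V -> R) : Ck k.+1 f -> Ck k f.
Proof.
elim: k f => [|k IH] f [df Df].
  by move=> x; exact: differentiable_continuous.
by split=> // v; apply: IH; exact: Df.
Qed.

Lemma Ck_cst V k (c : R) : Ck k (cst c : V -> R).
Proof.
elim: k c => [|k IH] c; first by move=> x; exact: cvg_cst.
split=> [x|v]; first exact: differentiable_cst.
by rewrite (_ : 'D_v _ = cst 0) //; apply/funext => x; exact: derive_cst.
Qed.

Lemma CkD V k (f g : V -> R) : Ck k f -> Ck k g -> Ck k (f + g).
Proof.
elim: k f g => [|k IH] f g.
  by move=> cf cg x; exact: (cvgD (cf x) (cg x)).
move=> [df Df] [dg Dg]; split=> [x|v]; first exact: differentiableD.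
rewrite (_ : 'D_v _ = 'D_v f + 'D_v g); first exact: IH (Df v) (Dg v).
by apply/funext => x; rewrite deriveD //; exact: diff_derivable.
Qed.

Lemma CkM V k (f g : V -> R) : Ck k f -> Ck k g -> Ck k (f * g).
Proof.
elim: k f g => [|k IH] f g.
  by move=> cf cg x; exact: (cvgM (cf x) (cg x)).
move=> Cf Cg; have [df Df] := Cf; have [dg Dg] := Cg.
split=> [x|v]; first exact: differentiableM.
rewrite (_ : 'D_v _ = f * 'D_v g + g * 'D_v f).
  by apply: CkD; [exact: IH (CkW Cf) (Dg v)|exact: IH (CkW Cg) (Df v)].
by apply/funext => x; rewrite deriveM //; exact: diff_derivable.
Qed.

Lemma Ck_sum V k n (f : 'I_n -> V -> R) :
  (forall i, Ck k (f i)) -> Ck k (\sum_(i < n) f i).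
Proof.
move=> Cf; elim/big_ind : _ => //; [exact: Ck_cst|exact: CkD].
Qed.

Lemma Ck_linear V k (f : {linear V -> R}) : continuous f -> Ck k f.
Proof.
move=> cf; case: k => [//|k]; split=> [x|v].
  exact: linear_differentiable.
rewrite (_ : 'D_v _ = cst (f v)); first exact: (Ck_cst _ k).
by apply/funext => x; rewrite deriveE ?diff_lin //; exact: linear_differentiable.
Qed.

Lemma derive_compR V (g : R -> R) (f : V -> R) x v :
  differentiable f x -> differentiable g (f x) ->
  'D_v (g \o f) x = 'D_1 g (f x) * 'D_v f x.
Proof.
move=> df dg; rewrite deriveE; last exact: differentiable_comp.
rewrite diff_comp //= deriveE // deriveE //.
by rewrite -[in LHS](mulr1 ('d f x v)) [LHS]linearZ /= mulrC.
Qed.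

Lemma Ck_comp V k (g : R -> R) (f : V -> R) :
  Ck k g -> Ck k f -> Ck k (g \o f).
Proof.
elim: k g f => [|k IH] g f.
  by move=> cg cf x; apply: continuous_comp; [exact: cf|exact: cg].
move=> Cg Cf; have [dg Dg] := Cg; have [df Df] := Cf.
split=> [x|v]; first exact: differentiable_comp.
rewrite (_ : 'D_v _ = ('D_1 g \o f) * 'D_v f).
  by apply: CkM (Df v); exact: IH (Dg 1) (CkW Cf).
by apply/funext => x; rewrite derive_compR.
Qed.

Lemma derive_comp_affine V W (f : W -> R) (T : {linear V -> W}) (c : W) x v :
  continuous T -> differentiable f (T x + c) ->
  differentiable (fun x => f (T x + c)) x /\
  'D_v (fun x => f (T x + c)) x = 'D_(T v) f (T x + c).
Proof.
move=> cT df.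
have dT : differentiable (fun x => T x + c) x.
  by apply: differentiableD => //; exact: linear_differentiable.
have dfT : differentiable (fun x => f (T x + c)) x.
  exact: (@differentiable_comp _ _ _ _ (fun x => T x + c) f).
split=> //; rewrite deriveE // (@diff_comp _ _ _ _ (fun x => T x + c) f) //=.
rewrite deriveE // diffD //; last exact: linear_differentiable.
by rewrite /= diff_cst diff_lin //; congr (_ _); exact: addr0.
Qed.

Lemma Ck_comp_affine V W k (f : W -> R) (T : {linear V -> W}) (c : W) :
  continuous T -> Ck k f -> Ck k (fun x => f (T x + c)).
Proof.
move=> cT; elim: k f => [|k IH] f.
  move=> cf x; apply: (@continuous_comp _ _ _ (fun x => T x + c) f).
    by apply: cvgD; [exact: cT|exact: cvg_cst].
  exact: cf.
move=> [df Df]; split=> [x|v]; first by have [] := derive_comp_affine 0 cT (df (T x + c)).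
rewrite (_ : 'D_v _ = fun x => 'D_(T v) f (T x + c)); first exact: IH (Df (T v)).
by apply/funext => x; have [_ ->] := derive_comp_affine v cT (df (T x + c)).
Qed.

End CkTheory.

Section SmoothStep.
Context {R : realType}.

(* Derivatives of flat functions are combinations of flat functions. *)
Definition flat n (x : R) : R := if 0 < x then x ^- n * expR (- x^-1) else 0.

Lemma flat_ge0 n x : 0 <= flat n x.
Proof.
rewrite /flat; case: ifPn => // x0.
by rewrite mulr_ge0 ?expR_ge0 // invr_ge0 exprn_ge0 // ltW.
Qed.

Lemma flat_le0 n x : x <= 0 -> flat n x = 0.
Proof. by move=> x0; rewrite /flat ltNge x0. Qed.

Lemma flat_gt0 n x : 0 < x -> 0 < flat n x.
Proof.
by move=> x0; rewrite /flat x0 mulr_gt0 ?expR_gt0 // invr_gt0 exprn_gt0.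
Qed.

(** A single term of the series of [expR x^-1] suffices. The order 2 in [x] is what makes the
    difference quotient at [0] tend to [0] in [is_derive_flat]. *)
Lemma flat_le_sqr n x : flat n x <= (n.+2)`!%:R * x ^+ 2.
Proof.
have [x0|x0] := ltP 0 x; last by rewrite flat_le0 // mulr_ge0 // sqr_ge0.
rewrite /flat x0 expRN.
have F0 : 0 < (n.+2)`!%:R :> R by rewrite ltr0n fact_gt0.
have h : x^-1 ^+ n.+2 / (n.+2)`!%:R <= expR x^-1.
  have xV0 : 0 <= x^-1 by rewrite invr_ge0 ltW.
  by apply: le_trans (expR_ge1Dxn n.+1 xV0); rewrite lerDr.
have p0 : 0 < x^-1 ^+ n.+2 / (n.+2)`!%:R.
  by rewrite divr_gt0 // exprn_gt0 // invr_gt0.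
apply: (@le_trans _ _ (x ^- n * (x^-1 ^+ n.+2 / (n.+2)`!%:R)^-1)).
  rewrite ler_wpM2l ?invr_ge0 ?exprn_ge0 ?(ltW x0) //.
  by rewrite lef_pV2 // posrE // expR_gt0.
rewrite invfM invrK exprVn invrK mulrA -[n.+2]addn2 exprD mulrA mulVf.
  by rewrite mul1r mulrC addn2.
by rewrite expf_neq0 // gt_eqF.
Qed.

Lemma is_derive_flat (n : nat) (x : R) :
  is_derive x 1 (flat n) (flat n.+2 x - n%:R * flat n.+1 x).
Proof.
have [x0|x0|x0] := ltgtP 0 x.
- have xn0 : x != 0 by rewrite gt_eqF.
  have e : \near x, ((fun y : R => y ^- n) * (fun y => expR (- y^-1))) x
      = flat n x.
    near=> y; rewrite /flat (_ : 0 < y) //; near: y.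
    exact: lt_nbhsr.
  apply: near_eq_is_derive e _.
  have xn : x ^+ n != 0 by rewrite expf_neq0.
  have dV := @is_deriveV R id x 1 1 xn0 (is_derive_id _ _).
  have dE := @is_derive1_comp R expR (fun y => - y^-1) x _ _ (is_derive_expR _) (is_deriveN dV).
  have dX : is_derive x 1 (fun y => y ^+ n) (n%:R * x ^+ n.-1).
    apply: DeriveDef; first exact: exprn_derivable.
    by rewrite exp_derive /GRing.scale /= mulr1.
  have dXn := @is_deriveV R (fun y => y ^+ n) x _ _ xn dX.
  have dM := is_deriveM dXn dE.
  apply: is_derive_eq dM _.
  rewrite /flat x0 /GRing.scale /=.
  case: n xn {dXn dX} => [|n] xn.
    by rewrite !mul0r; field.
  by rewrite [n.+1.-1]/= !(@exprS _ x); field; rewrite xn0 expf_neq0.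
- have e : \near x, cst 0 x = flat n x.
    near=> y; rewrite flat_le0 // ltW //; near: y.
    exact: lt_nbhsl.
  apply: near_eq_is_derive e _.
  rewrite !flat_le0 ?(ltW x0) // mulr0 subr0; exact: is_derive_cst.
- rewrite -x0 !flat_le0 // mulr0 subr0.
  have cv : h^-1 *: (flat n (h *: (1 : R) + 0) - flat n 0) @[h --> 0^'] --> (0 : R).
    apply/cvgr0Pnorm_le => e e0; near=> h.
    have h0 : h != 0 by near: h; exact: nbhs_dnbhs_neq.
    have F0 : 0 < (n.+2)`!%:R :> R by rewrite ltr0n fact_gt0.
    rewrite (flat_le0 _ (lexx 0)) subr0 addr0 /GRing.scale /= mulr1 normrM normfV.
    rewrite ler_pdivrMl ?normr_gt0 // (ger0_norm (flat_ge0 _ _)).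
    apply: le_trans (flat_le_sqr _ _) _.
    rewrite -real_normK ?num_real // expr2 mulrCA ler_pM2l ?normr_gt0 //.
    rewrite -ler_pdivlMl //; near: h; apply: dnbhs0_le.
    by rewrite mulr_gt0 // invr_gt0.
  by apply: DeriveDef; [apply/cvg_ex; exists 0|exact/cvg_lim].
Unshelve. all: by end_near. Qed.

Lemma Ck_flat k n : Ck k (flat n).
Proof.
have df m x : differentiable (flat m) x.
  by apply/derivable1_diffP; case: (is_derive_flat m x).
elim: k n => [|k IH] n.
  by move=> x; exact: differentiable_continuous.
split=> // v.
rewrite (_ : 'D_v _ = cst v * (flat n.+2 + cst (- n%:R) * flat n.+1)).
  by apply: CkM; [exact: Ck_cst|apply: CkD => //; apply: CkM => //; exact: Ck_cst].
apply/funext => x; rewrite deriveE // -[v]mulr1 [LHS]linearZ /=.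
rewrite -deriveE //; have [_ ->] := is_derive_flat n x.
by rewrite /GRing.scale /= mulr1 /GRing.mul /= /cst /GRing.add /= mulNr.
Qed.

(* 0 on ]-oo, 0] and constant on [1, +oo[; its value there is not 1. *)
Definition sstep (x : R) : R := flat 0 (flat 0 1 - flat 0 (1 - x)).

Lemma flat_nondecr x y : x <= y -> flat 0 x <= flat 0 y.
Proof.
move=> xy; have [x0|x0] := leP x 0; first by rewrite (flat_le0 _ x0) flat_ge0.
rewrite /flat x0 (lt_le_trans x0 xy) !expr0 invr1 !mul1r ler_expR lerN2.
by rewrite lef_pV2 // posrE // (lt_le_trans x0).
Qed.

Lemma sstep_ge0 x : 0 <= sstep x. Proof. exact: flat_ge0. Qed.

Lemma sstep_le0 x : x <= 0 -> sstep x = 0.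
Proof.
by move=> x0; apply: flat_le0; rewrite subr_le0 flat_nondecr // lerDl oppr_ge0.
Qed.

Lemma sstep_gt0 x : 0 < x -> 0 < sstep x.
Proof.
move=> x0; apply: flat_gt0; rewrite subr_gt0.
have [x1|x1] := leP 1 x; first by rewrite flat_le0 ?flat_gt0 // subr_le0.
have y0 : 0 < 1 - x by rewrite subr_gt0.
rewrite /flat ltr01 y0 !expr0 invr1 !mul1r ltr_expR ltrN2.
by rewrite invf_gt1 // gtrDl oppr_lt0.
Qed.

Lemma Ck_sstep k : Ck k sstep.
Proof.
rewrite (_ : sstep = flat 0 \o (cst (flat 0 1) +
  cst (-1) * (flat 0 \o (cst 1 + cst (-1) * id)))).
  apply: Ck_comp; first exact: Ck_flat.
  apply: CkD; first exact: Ck_cst.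
  apply: CkM; first exact: Ck_cst.
  apply: Ck_comp; first exact: Ck_flat.
  apply: CkD; first exact: Ck_cst.
  apply: CkM; first exact: Ck_cst.
  by apply: (@Ck_linear _ _ _ (idfun : {linear R -> R})) => x; exact: cvg_id.
apply/funext => x; rewrite /sstep /= /GRing.add /= /GRing.mul /= /cst.
by rewrite !mulN1r.
Qed.

(** The chain rule for [sstep]: the derivative of [flat 0] is [flat 2], because the other term in
    [is_derive_flat] carries the factor [0]. *)
Definition sstep' (x : R) : R :=
  flat 2 (flat 0 1 - flat 0 (1 - x)) * flat 2 (1 - x).

Lemma is_derive_sstep (x : R) : is_derive x 1 sstep (sstep' x).
Proof.
have d1 : is_derive x 1 (fun y : R => (1 : R) - y) (0 - 1 : R).
  rewrite (_ : (fun y : R => 1 - y) = cst 1 - id); first exact: is_deriveB.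
  by apply/funext.
have d2 := @is_derive1_comp R (flat 0) (fun y : R => 1 - y) x _ _
  (is_derive_flat _ _) d1.
have d3 := @is_deriveB _ _ _ (cst (flat 0 1)) _ x 1 _ _ (is_derive_cst _ _ _) d2.
have d4 := @is_derive1_comp R (flat 0)
  (fun y => flat 0 1 - flat 0 (1 - y)) x _ _ (is_derive_flat _ _) d3.
by apply: is_derive_eq d4 _; rewrite /sstep' !mul0r; ring.
Qed.

Lemma continuous_sstep' : continuous sstep'.
Proof.
have [_ /(_ 1)] := Ck_sstep 1.
rewrite (_ : 'D_1 sstep = sstep') //.
by apply/funext => x; have [] := is_derive_sstep x.
Qed.

Lemma sstep'_ge0 x : 0 <= sstep' x.
Proof. by rewrite mulr_ge0 // flat_ge0. Qed.

Lemma sstep'_le0 x : x <= 0 -> sstep' x = 0.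
Proof.
move=> x0; rewrite /sstep' flat_le0 ?mul0r // subr_le0 flat_nondecr //.
by rewrite lerDl oppr_ge0.
Qed.

Lemma sstep'_ge1 x : 1 <= x -> sstep' x = 0.
Proof. by move=> x1; rewrite /sstep' (@flat_le0 2 (1 - x)) ?mulr0 // subr_le0. Qed.

End SmoothStep.

(** * Lebesgue integral of compactly supported functions *)

Section MeasurePreserving.
Context {R : realType}.
Local Notation mR := (measurableTypeR R).

Definition preserves d (T : measurableType d) (m : set T -> \bar R) (f : T -> T) :=
  measurable_fun setT f /\ forall A, measurable A -> m (f @^-1` A) = m A.

(** The image of the product measure agrees with it on measurable rectangles, and a product measure
    is determined by its values there. *)
Lemma preserves_prod d1 d2 (T1 : measurableType d1) (T2 : measurableType d2)
    (m1 : {sigma_finite_measure set T1 -> \bar R})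
    (m2 : {sigma_finite_measure set T2 -> \bar R}) f1 f2 :
  preserves m1 f1 -> preserves m2 f2 ->
  preserves (m1 \x m2)%E (fun p => (f1 p.1, f2 p.2)).
Proof.
move=> [mf1 p1] [mf2 p2].
have mf : measurable_fun setT (fun p : T1 * T2 => (f1 p.1, f2 p.2)).
  apply/measurable_fun_pairP; split.
    exact: (measurableT_comp mf1 measurable_fst).
  exact: (measurableT_comp mf2 measurable_snd).
split=> // A mA.
rewrite -[LHS]/(pushforward (m1 \x m2)%E (fun p => (f1 p.1, f2 p.2)) A).
pose mu := measure_function_pushforward__canonical__measure_function_Measure
  (m1 \x m2)%E mf.
apply/esym; apply: (@product_measure_unique _ _ _ _ R m1 m2 mu) => // B C mB mC.
rewrite /mu /= /pushforward.
rewrite (_ : _ @^-1` _ = (f1 @^-1` B) `*` (f2 @^-1` C)) //.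
have mpre d (T : measurableType d) (g : T -> T) (D : set T) :
    measurable_fun setT g -> measurable D -> measurable (g @^-1` D).
  by move=> mg mD; rewrite -[X in measurable X]setTI; exact: mg.
rewrite product_measure1E; [|exact: mpre..].
by congr (_ * _)%E; [exact: p1|exact: p2].
Qed.

Lemma preserves_lebesgue_shift (v : R) :
  preserves (@lebesgue_measure R) (fun x : mR => x + v : mR).
Proof.
have mf : measurable_fun setT (fun x : mR => x + v : mR).
  exact: measurable_funD.
split=> // A mA.
rewrite -[LHS]/(pushforward (@lebesgue_measure R) (fun x : mR => x + v : mR) A).
pose mu := measure_function_pushforward__canonical__measure_function_Measure
  (@lebesgue_measure R) mf.
apply/esym; apply: (@lebesgue_measure_unique R mu) => // _ [[a b]] _ <-.
rewrite /mu /= /pushforward.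
rewrite (_ : _ @^-1` _ = `]a - v, b - v]%classic); last first.
  apply/seteqP; split => x /=; rewrite !in_itv /=; lra.
by rewrite !lebesgue_measure_itv /= !lte_fin ltrD2r !EFinN !EFinB; case: ifP => // _;
  rewrite -!EFinB; congr EFin; ring.
Qed.

Definition tshift n (v : 'I_n -> R) (t : n.-tuple mR) : n.-tuple mR :=
  [tuple tnth t i + v i | i < n].

(** By induction along the recursive construction of the measure: a translation of [n.+1]
    coordinates is conjugate through [tcons] to the product of a translation of the line and one of
    [n] coordinates. *)
Lemma preserves_tshift n (v : 'I_n -> R) :
  preserves (lebesgue_tuple n) (tshift v).
Proof.
elim: n v => [|n IH] v.
  have -> : tshift v = id by apply/funext => t; rewrite !tuple0; exact/esym/tuple0.
  by split.
have ms : measurable_fun setT (tshift v).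
  apply/measurable_fun_tnthP => i.
  rewrite (_ : _ \o _ = fun t => tnth t i + v i); last first.
    by apply/funext => t /=; rewrite tnth_mktuple.
  apply: measurable_funD => //; exact: measurable_tnth.
split=> // A mA.
rewrite /= /lebesgue_tupleS /pushforward.
pose v' := fun i => v (lift ord0 i).
have [_ /(_ (tcons @^-1` A)) <-] :=
    preserves_prod (preserves_lebesgue_shift (v ord0)) (IH v'); last first.
  by rewrite -[X in measurable X]setTI; exact: measurable_tcons.
have E : tshift v \o tcons =
    tcons \o (fun p : mR * n.-tuple mR => (p.1 + v ord0 : mR, tshift v' p.2)).
  apply/funext => -[x t]; apply: eq_from_tnth => i /=.
  rewrite tnth_mktuple.
  case: (unliftP ord0 i) => [j ->|->]; last by rewrite !tnth0.
  by rewrite !tnthS tnth_mktuple.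
by rewrite -[LHS]/((lebesgue_measure \x lebesgue_tuple n)%E
    ((tshift v \o tcons) @^-1` A)) E.
Qed.

Definition tbox n (c : 'I_n -> R) (r : R) : set (n.-tuple mR) :=
  [set t | forall i, `|tnth t i - c i| < r].

Lemma lebesgue_tbox n (c : 'I_n -> R) (r : R) : 0 < r ->
  measurable (tbox c r) /\ lebesgue_tuple n (tbox c r) = ((2 * r) ^+ n)%:E.
Proof.
move=> r0; elim: n c => [|n IH] c.
  have -> : tbox c r = setT by apply/seteqP; split => // t _ [].
  by split => //=; rewrite diracT expr0.
have [m1 e1] := IH (fun i => c (lift ord0 i)).
have E : tbox c r = tuncons @^-1`
   (`]c ord0 - r, c ord0 + r[%classic `*` tbox (fun i => c (lift ord0 i)) r).
  apply/seteqP; split => t /= H.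
    split; first by rewrite in_itv /= -ltr_distl; exact: H.
    by move=> i /=; have := H (lift ord0 i); rewrite [in tnth t _](tuple_eta t) tnthS.
  case: H; rewrite in_itv /= -ltr_distl => H1 H2 i.
  case: (unliftP ord0 i) => [j ->|-> //].
  by rewrite [in tnth t _](tuple_eta t) tnthS; exact: H2.
have m2 : measurable (tbox c r).
  rewrite E -[X in measurable X]setTI.
  apply: measurable_tuncons => //; exact: measurableX.
split => //.
rewrite /= /lebesgue_tupleS /pushforward E -comp_preimage.
rewrite (_ : tuncons \o tcons = id); last by apply/funext => p; exact: tconsK.
transitivity (lebesgue_measure (`](c ord0 - r)%R, (c ord0 + r)%R[%classic : set mR) *
    lebesgue_tuple n (tbox (fun i => c (lift ord0 i)) r))%E.
  exact: product_measure1E.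
rewrite e1 lebesgue_measure_itv /= lte_fin ifT; last by lra.
by rewrite -EFinB -EFinM exprS; congr (_ * _)%:E; ring.
Qed.

End MeasurePreserving.

Lemma is_derive_line {R : realType} {V : normedModType R} (f : V -> R) (p v : V) (s : R) :
  derivable f (p + s *: v) v ->
  is_derive s 1 (fun s => f (p + s *: v)) ('D_v f (p + s *: v)).
Proof.
have E : (fun h : R => h^-1 *: (((fun s => f (p + s *: v)) \o shift s) (h *: 1)
      - f (p + s *: v)))
    = (fun h : R => h^-1 *: ((f \o shift (p + s *: v)) (h *: v) - f (p + s *: v))).
  apply/funext => h; rewrite /= /shift /= (_ : h *: (1 : R) = h).
    by rewrite scalerDl addrCA.
  exact: mulr1.
by move=> df; apply: DeriveDef; rewrite /derivable /derive E.
Qed.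

(** * Integration of continuous functions with bounded support *)

Section Integral.
Context {R : realType} {n h : nat}.
Local Notation mR := (measurableTypeR R).
Local Notation Wc := ('rV[R]_n * 'rV[R]_h)%type.
Local Notation T := (n.-tuple mR * h.-tuple mR)%type.
Local Notation mu := (@lebesgue_tuple R n \x @lebesgue_tuple R h)%E.

Implicit Types (f g : Wc -> R) (k : R).

Definition tpt (t : T) : Wc := (tuple_rV t.1, tuple_rV t.2).

Lemma tpt_ball (c : Wc) (r : R) : 0 < r ->
  tpt @^-1` ball c r = tbox (fun i => c.1 0 i) r `*` tbox (fun i => c.2 0 i) r.
Proof.
move=> r0; apply/seteqP; split=> -[t s] /=.
  move=> [[_ H1] [_ H2]]; split=> i /=.
    by have := H1 0 i; rewrite /ball /= mxE distrC.
  by have := H2 0 i; rewrite /ball /= mxE distrC.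
move=> [H1 H2]; split; split=> // i j; rewrite ord1 /ball /= mxE distrC.
  exact: H1.
exact: H2.
Qed.

Lemma measurable_tpt_ball (c : Wc) (r : R) : 0 < r -> measurable (tpt @^-1` ball c r).
Proof.
move=> r0; rewrite tpt_ball //; apply: measurableX.
  by have [] := lebesgue_tbox (fun i => c.1 0 i) r0.
by have [] := lebesgue_tbox (fun i => c.2 0 i) r0.
Qed.

Lemma lebesgue_tpt_ball (c : Wc) (r : R) : 0 < r ->
  mu (tpt @^-1` ball c r) = ((2 * r) ^+ n * (2 * r) ^+ h)%:E.
Proof.
move=> r0; rewrite tpt_ball //.
have [m1 e1] := lebesgue_tbox (fun i => c.1 0 i) r0.
have [m2 e2] := lebesgue_tbox (fun i => c.2 0 i) r0.
by rewrite EFinM -e1 -e2; exact: product_measure1E.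
Qed.

(** Measurability lives on tuples and the topology on row vectors, so the two are reconciled here:
    an open set is the countable union of the balls with rational centre and radius [k.+1%:R^-1]
    that it contains. *)
Lemma measurable_tpt_open (O : set Wc) : open O -> measurable (tpt @^-1` O).
Proof.
move=> oO.
pose c (q : 'rV[rat]_n * 'rV[rat]_h) : Wc := (map_mx ratr q.1, map_mx ratr q.2).
pose F (q : 'rV[rat]_n * 'rV[rat]_h * nat) : set Wc :=
  if `[< ball (c q.1) q.2.+1%:R^-1 `<=` O >] then ball (c q.1) q.2.+1%:R^-1
  else set0.
have -> : tpt @^-1` O = \bigcup_q (tpt @^-1` F q).
  rewrite -preimage_bigcup; congr (_ @^-1` _).
  apply/seteqP; split => [p Op|p [q _]]; last first.
    by rewrite /F; case: asboolP => // H Hp; exact: H.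
  have /nbhs_ballP[e /= e0 peO] : nbhs p O by exact: open_nbhs_nbhs.
  have [k] := ltr_add_invr (divr_gt0 e0 (ltr0n R 2)).
  rewrite add0r => ke.
  have k0 : 0 < k.+1%:R^-1 :> R by rewrite invr_gt0.
  have qx (x : R) : exists q : rat, `|ratr q - x| < k.+1%:R^-1.
    have /rat_in_itvoo[q] : x - k.+1%:R^-1 < x + k.+1%:R^-1.
      by rewrite ltrD2l (lt_trans _ k0) // oppr_lt0.
    by rewrite in_itv /= -ltr_distl => ?; exists q.
  have [f fP] := choice qx.
  pose q := (map_mx f p.1, map_mx f p.2).
  have pq : ball (c q) k.+1%:R^-1 p.
    by split; split=> // i j; rewrite /ball /= !mxE; exact: fP.
  exists (q, k) => //; rewrite /F /=; case: asboolP => // -[].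
  apply: subset_trans peO => z qz.
  apply: (@le_ball _ _ _ (k.+1%:R^-1 + k.+1%:R^-1)).
    by rewrite [leRHS]splitr lerD // ltW.
  by apply: ball_triangle qz; exact: ball_sym.
apply: countable_bigcupT_measurable => // -[q k].
rewrite /F /=; case: asboolP => _; last by rewrite preimage_set0.
by apply: measurable_tpt_ball; rewrite invr_gt0.
Qed.

Lemma measurable_tpt_continuous (f : Wc -> R) : continuous f ->
  measurable_fun setT (f \o tpt).
Proof.
move=> /continuousP cf.
apply: (measurability _ (RGenOpens.measurableE R)).
move=> _ [_ [a [b ->] <-]]; rewrite setTI comp_preimage.
by apply: measurable_tpt_open; apply: cf; exact: interval_open.
Qed.

(** The support is asked to be bounded; in finite dimension this is the usual space of continuous
    functions with compact support. *)
Definition Cc (f : Wc -> R) :=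
  continuous f /\ exists r : R, forall p, r < `|p| -> f p = 0.

Definition IW (f : Wc -> R) : R := integralW setT f.

Lemma IWE f : IW f = \int[mu]_t f (tpt t).
Proof. by rewrite /IW /integralW preimage_setT. Qed.

Lemma compact_le_norm (r : R) : compact [set p : Wc | `|p| <= r].
Proof.
have cl m : compact [set x : 'rV[R]_m | `|x| <= r].
  apply: bounded_closed_compact.
    by exists r; split; [exact: num_real|move=> x rx y /= /le_trans; apply; exact: ltW].
  apply: (@closed_comp _ _ (fun x : 'rV[R]_m => `|x|) [set x | x <= r]).
    by move=> x _; exact: norm_continuous.
  exact: closed_le.
rewrite (_ : mkset _ = [set x : 'rV[R]_n | `|x| <= r] `*` [set x : 'rV[R]_h | `|x| <= r]).
  exact: compact_setX.
apply/seteqP; split => -[x y] /=; rewrite prod_normE ge_max.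
  by move/andP.
by move=> ?; exact/andP.
Qed.

Lemma Cc_bounded f : Cc f -> exists C : R, 0 <= C /\ forall p, `|f p| <= C.
Proof.
move=> [cf [r fr]].
have /ex_strict_bound_gt0[C C0 /= HC] : bounded_set (f @` [set p : Wc | `|p| <= r]).
  apply/compact_bounded/continuous_compact; last exact: compact_le_norm.
  exact: continuous_subspaceT.
exists C; split; [exact: ltW|move=> p].
have [pr|pr] := leP `|p| r; last by rewrite fr // normr0 ltW.
by apply/ltW/HC; exists p.
Qed.

Lemma Cc_integrable f : Cc f -> mu.-integrable setT (EFin \o (f \o tpt)).
Proof.
move=> Cf; have [C [C0 fC]] := Cc_bounded Cf; have [cf [r fr]] := Cf.
(* [r] may be negative, hence the absolute value; adding 1 makes the open ball contain the
   support. *)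
pose s : R := `|r| + 1; have s0 : 0 < s by rewrite ltr_wpDl.
pose B := tpt @^-1` ball (0 : Wc) s.
have mB : measurable B by exact: measurable_tpt_ball.
have -> : EFin \o (f \o tpt) = (EFin \o (f \o tpt)) \_ B.
  apply/funext => t; rewrite patchE; case: ifPn => // /negP tB /=.
  rewrite fr // ltNge; apply/negP => tr; apply: tB; rewrite inE.
  rewrite /B /= -ball_normE /= sub0r normrN (le_lt_trans tr) //.
  by rewrite (le_lt_trans (ler_norm r)) // ltrDl.
apply: (integrable_mkcond _ mB).1.
apply: (@measurable_bounded_integrable _ _ _ mu (f \o tpt) _ mB).
- by rewrite [X in (X < _)%E]lebesgue_tpt_ball // ltry.
- by apply: measurable_funS (measurable_tpt_continuous cf).
- exists C; split; first exact: num_real.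
  by move=> x Cx t _; exact: le_trans (fC _) (ltW Cx).
Qed.

Lemma CcD f g : Cc f -> Cc g -> Cc (fun p => f p + g p).
Proof.
move=> [cf [r fr]] [cg [s gs]]; split.
  by move=> x; exact: (cvgD (cf x) (cg x)).
exists (Num.max r s) => p; rewrite gt_max => /andP[rp sp].
by rewrite fr // gs // addr0.
Qed.

Lemma CcMl f g : continuous f -> Cc g -> Cc (fun p => f p * g p).
Proof.
move=> cf [cg [s gs]]; split; first by move=> x; exact: (cvgM (cf x) (cg x)).
by exists s => p sp; rewrite gs // mulr0.
Qed.

Lemma CcZ k f : Cc f -> Cc (fun p => k * f p).
Proof. by apply: CcMl => x; exact: cvg_cst. Qed.

Lemma IWD f g : Cc f -> Cc g -> IW (fun p => f p + g p) = IW f + IW g.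
Proof. by move=> Cf Cg; rewrite !IWE RintegralD //; exact: Cc_integrable. Qed.

Lemma IWZ k f : Cc f -> IW (fun p => k * f p) = k * IW f.
Proof. by move=> Cf; rewrite !IWE RintegralZl //; exact: Cc_integrable. Qed.

Lemma IW_lin3 k1 k2 k3 (f1 f2 f3 : Wc -> R) i1 i2 i3 :
  Cc f1 -> Cc f2 -> Cc f3 -> IW f1 = i1 -> IW f2 = i2 -> IW f3 = i3 ->
  IW (fun p => k1 * f1 p + (k2 * f2 p + k3 * f3 p)) = k1 * i1 + (k2 * i2 + k3 * i3).
Proof.
move=> C1 C2 C3 <- <- <-.
have Z1 := CcZ k1 C1; have Z2 := CcZ k2 C2; have Z3 := CcZ k3 C3.
by rewrite (IWD Z1 (CcD Z2 Z3)) (IWD Z2 Z3) !IWZ.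
Qed.

Lemma Cc0 : Cc (fun=> 0).
Proof. by split=> [x|]; [exact: cvg_cst|exists 0]. Qed.

Lemma Cc_sum m (f : 'I_m -> Wc -> R) :
  (forall i, Cc (f i)) -> Cc (fun p => \sum_(i < m) f i p).
Proof.
elim: m f => [|m IH] f Cf.
  by rewrite (_ : (fun p => _) = fun=> 0); [exact: Cc0|apply/funext => p; rewrite big_ord0].
rewrite (_ : (fun p => _) = fun p => \sum_(i < m) f (widen_ord (leqnSn m) i) p + f ord_max p).
  by apply: CcD => //; exact: (IH (fun i => f (widen_ord (leqnSn m) i))).
by apply/funext => p; rewrite big_ord_recr.
Qed.

Lemma IW_sum m (f : 'I_m -> Wc -> R) : (forall i, Cc (f i)) ->
  IW (fun p => \sum_(i < m) f i p) = \sum_(i < m) IW (f i).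
Proof.
elim: m f => [|m IH] f Cf.
  rewrite big_ord0 (_ : (fun p => _) = fun=> 0); first by rewrite IWE Rintegral_cst // mul0r.
  by apply/funext => p; rewrite big_ord0.
rewrite (_ : (fun p => _) = fun p => \sum_(i < m) f (widen_ord (leqnSn m) i) p + f ord_max p).
  rewrite IWD //; last exact: (Cc_sum (fun i => Cf (widen_ord (leqnSn m) i))).
  by rewrite big_ord_recr /= (IH (fun i => f (widen_ord (leqnSn m) i))).
by apply/funext => p; rewrite big_ord_recr.
Qed.

Lemma le_IW f g : Cc f -> Cc g -> (forall p, f p <= g p) -> IW f <= IW g.
Proof.
by move=> Cf Cg fg; rewrite !IWE le_Rintegral //; exact: Cc_integrable.
Qed.

Lemma IW_ge0 f : (forall p, 0 <= f p) -> 0 <= IW f.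
Proof. by move=> f0; rewrite IWE; exact: Rintegral_ge0. Qed.

(** By continuity [f] exceeds [f p0 / 2] on a ball, which has positive measure. The mass of the bump
    is positive for this reason and can be divided out. *)
Lemma IW_gt0 f p0 : Cc f -> (forall p, 0 <= f p) -> 0 < f p0 -> 0 < IW f.
Proof.
move=> Cf f0 fp0; have [cf _] := Cf.
have : \forall p \near p0, f p0 / 2 < f p.
  apply: (cf p0 [set x | f p0 / 2 < x]); apply: lt_nbhsr.
  by rewrite ltr_pdivrMr // ltr_pMr // ltr1n.
move=> /nbhs_ballP[r /= r0 rf].
pose B := tpt @^-1` ball p0 r.
have mB : measurable B by exact: measurable_tpt_ball.
have muB := lebesgue_tpt_ball p0 r0.
have c0 : 0 < f p0 / 2 by rewrite divr_gt0.
rewrite IWE; apply: (@lt_le_trans _ _ (\int[mu]_t ((cst (f p0 / 2) \_ B) t))).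
  rewrite -Rintegral_mkcond Rintegral_cst // -/B in muB *.
  by rewrite [X in fine X]muB /= mulr_gt0 // mulr_gt0 // exprn_gt0 // mulr_gt0.
apply: le_Rintegral => //.
- rewrite -restrict_EFin; apply: (integrable_mkcond _ mB).1.
  apply: (@measurable_bounded_integrable _ _ _ mu (cst (f p0 / 2)) _ mB).
  + by rewrite [X in (X < _)%E]muB ltry.
  + exact: measurable_cst.
  + exists `|f p0 / 2|; split; first exact: num_real.
    by move=> x Cx t _; exact: ltW.
- exact: Cc_integrable.
- move=> t _; rewrite patchE; case: ifPn => // /set_mem tB.
  by apply/ltW/rf.
Qed.

Lemma tshift_tpt (v : Wc) (t : T) :
  tpt (tshift (fun i => v.1 0 i) t.1, tshift (fun i => v.2 0 i) t.2) = tpt t + v.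
Proof.
by congr pair; apply/rowP => i; rewrite !mxE tnth_mktuple.
Qed.

(** Translations preserve the measure on tuples, and the integral is transported by the
    pushforward. *)
Lemma IW_shift f v : Cc f -> IW (fun p => f (p + v)) = IW f.
Proof.
move=> Cf; rewrite !IWE.
pose S (t : T) : T := (tshift (fun i => v.1 0 i) t.1, tshift (fun i => v.2 0 i) t.2).
have [mS pS] : preserves mu S by apply: preserves_prod; exact: preserves_tshift.
rewrite /Rintegral; congr fine.
have Cs : Cc (fun p => f (p + v)).
  have [cf [r fr]] := Cf; split.
    move=> x; apply: (@continuous_comp _ _ _ (fun p : Wc => p + v) f); last exact: cf.
    exact: (cvgD cvg_id (cvg_cst v)).
  exists (r + `|v|) => p rp; apply: fr; rewrite -ltrBrDr in rp.
  apply: lt_le_trans rp _; rewrite lerBlDr.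
  by rewrite -[X in `|X| <= _](addrK v) (le_trans (ler_normB _ _)).
have e : (EFin \o (f \o tpt)) \o S = (fun t => (f (tpt t + v))%:E).
  by apply/funext => t /=; rewrite -tshift_tpt.
rewrite -[LHS](_ : \int[mu]_t ((EFin \o (f \o tpt)) \o S) t = _)%E; last by rewrite e.
have mf : measurable_fun setT (EFin \o (f \o tpt)).
  by apply/measurable_EFinP; apply: measurable_tpt_continuous; have [] := Cf.
have iS : mu.-integrable (S @^-1` setT) ((EFin \o (f \o tpt)) \o S).
  by rewrite preimage_setT e; exact: (Cc_integrable Cs).
rewrite -[setT in LHS](preimage_setT S) -(integral_pushforward mS mf iS measurableT).
by apply: eq_measure_integral => A mA _; exact: pS.
Qed.

(** A multiple of it serves as integrable majorant for functions bounded and supported in the ball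
    of radius [r]. *)
Definition cutoff (r : R) (p : Wc) : R := Num.max 0 (r + 1 - `|p|).

Lemma Cc_cutoff r : Cc (cutoff r).
Proof.
split; last first.
  by exists (r + 1) => p rp; rewrite /cutoff max_l // subr_le0 ltW.
move=> x; apply: (@continuous_max _ _ (cst 0) (fun p : Wc => r + 1 - `|p|)).
  exact: cvg_cst.
by apply: cvgB; [exact: cvg_cst|exact: norm_continuous].
Qed.

Lemma cutoff_ge0 r p : 0 <= cutoff r p.
Proof. by rewrite /cutoff le_max lexx. Qed.

Lemma cutoff_ge1 r p : `|p| <= r -> 1 <= cutoff r p.
Proof. by move=> pr; rewrite /cutoff le_max; apply/orP; right; lra. Qed.

(** Dominated convergence with majorant [C * cutoff r]: for parameters in the interval, the
    derivatives are bounded by [C] and all supports lie in one ball. *)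
Lemma is_derive_IW (F dF : R -> Wc -> R) (a u v r C : R) :
  u < a < v ->
  (forall s, u < s < v -> continuous (F s)) ->
  (forall s p, u < s < v -> r < `|p| -> F s p = 0) ->
  (forall s p, u < s < v -> is_derive s 1 (F ^~ p) (dF s p)) ->
  (forall s p, u < s < v -> `|dF s p| <= C) ->
  (forall s p, u < s < v -> r < `|p| -> dF s p = 0) ->
  is_derive a 1 (fun s => IW (F s)) (IW (dF a)).
Proof.
move=> uav cF F0 dFd dFC dF0.
pose f s (t : T) := F s (tpt t).
have C0 : 0 <= C by apply: le_trans (dFC a 0 uav).
pose G (t : T) : R := C * cutoff r (tpt t).
have Ia : `]u, v[%classic a by rewrite /= in_itv.
have d1 s t : u < s < v -> partial1of2 f s t = dF s (tpt t).
  by move=> us; rewrite partial1of2E; have [] := dFd s (tpt t) us.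
have i1 s : `]u, v[%classic s -> mu.-integrable setT (EFin \o f s).
  rewrite /= in_itv /= => us; apply: (@Cc_integrable (F s)); split; first exact: cF.
  by exists r => p; exact: F0.
have i2 s t : `]u, v[%classic s -> setT t -> derivable (f ^~ t) s 1.
  by rewrite /= in_itv /= => us _; have [] := dFd s (tpt t) us.
have G0 t : 0 <= G t by rewrite mulr_ge0 // cutoff_ge0.
have iG : mu.-integrable setT (EFin \o G).
  exact: (Cc_integrable (CcZ C (Cc_cutoff r))).
have Gub s t : `]u, v[%classic s -> setT t -> `|partial1of2 f s t| <= G t.
  rewrite /= in_itv /= => us _; rewrite d1 //.
  have [pr|pr] := leP `|tpt t| r.
    by rewrite (le_trans (dFC _ _ us)) // ler_peMr // cutoff_ge1.
  by rewrite dF0 // normr0.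
have E1 s : IW (F s) = \int[mu]_(t in setT) f s t by rewrite IWE.
have E2 : IW (dF a) = \int[mu]_(t in setT) partial1of2 f a t.
  by rewrite IWE; apply: eq_Rintegral => t _; rewrite d1.
have := @cvg_differentiation_under_integral R _ _ mu f _ measurableT a u v Ia
  i1 i2 G G0 iG Gub.
rewrite -E2 => cv.
have cv' : h^-1 *: (IW (F (h *: (1 : R) + a)) - IW (F a)) @[h --> 0^'] --> IW (dF a).
  apply: cvg_trans cv; apply: near_eq_cvg; near=> s.
  by rewrite !E1 /GRing.scale /= mulr1.
by apply: DeriveDef; [apply/cvg_ex; exists (IW (dF a))|exact/cvg_lim].
Unshelve. all: by end_near. Qed.

Lemma derive_out f v r p : (forall q, r < `|q| -> f q = 0) -> r < `|p| ->
  'D_v f p = 0.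
Proof.
move=> f0 rp; rewrite -[RHS](derive_cst (0 : R) p v); apply: near_eq_derive.
near=> q; apply: f0; near: q.
by apply: (@norm_continuous _ _ p [set x | r < x]); exact: lt_nbhsr.
Unshelve. all: by end_near. Qed.

(** The integral of [xi (p + s *: v)] does not depend on [s] by translation invariance; its
    derivative at [s = 0], taken under the integral sign, is the left-hand side. *)
Lemma IW_derive (xi : Wc -> R) (v : Wc) :
  (forall x, differentiable xi x) -> Cc xi -> continuous ('D_v xi) ->
  IW ('D_v xi) = 0.
Proof.
move=> dxi Cx cD; have [cx [r xr]] := Cx.
have Dr p : r < `|p| -> 'D_v xi p = 0 by exact: derive_out.
have [C [C0 DC]] : exists C : R, 0 <= C /\ forall p, `|'D_v xi p| <= C.
  by apply: Cc_bounded; split => //; exists r.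
have big (s : R) (p : Wc) : -1 < s < 1 -> r + `|v| < `|p| -> r < `|p + s *: v|.
  move=> /andP[s1 s2] rp; have : `|p| <= `|p + s *: v| + `|s *: v|.
    by rewrite -{1}[p](addrK (s *: v)) ler_normB.
  rewrite normrZ; have : `|s| * `|v| <= `|v|.
    by rewrite ler_piMl // ler_norml !ltW.
  lra.
have dd (s : R) (p : Wc) : is_derive s 1 (fun s => xi (p + s *: v)) ('D_v xi (p + s *: v)).
  by apply: is_derive_line; exact: diff_derivable.
have := @is_derive_IW (fun s p => xi (p + s *: v)) (fun s p => 'D_v xi (p + s *: v))
  0 (-1) 1 (r + `|v|) C.
have E : (fun s : R => IW (fun p => xi (p + s *: v))) = cst (IW xi).
  by apply/funext => s; rewrite IW_shift.
have E2 : (fun p => 'D_v xi (p + 0 *: v)) = 'D_v xi.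
  by apply/funext => p; rewrite scale0r addr0.
rewrite E E2 => H.
have [] := H.
- by rewrite ltrN10 ltr01.
- move=> s _ x; apply: (@continuous_comp _ _ _ (fun p : Wc => p + s *: v) xi).
    exact: (cvgD cvg_id (cvg_cst _)).
  exact: cx.
- by move=> s p us rp; apply: xr; exact: big.
- by move=> s p _; exact: DC.
- by move=> s p us rp; apply: Dr; exact: big.
- by move=> _; rewrite derive_cst.
Qed.

End Integral.

(** * One-sided bumps *)

Section Bump.
Context {R : realType} {n h : nat}.
Local Notation Wc := ('rV[R]_n * 'rV[R]_h)%type.
Implicit Types (q : Wc) (b : 'rV[R]_h).

Lemma Ck_linearfun (V : normedModType R) k (f : V -> R) :
  linear f -> continuous f -> Ck k f.
Proof.
move=> lf cf.
pose fl : {linear V -> R} := HB.pack f (GRing.isLinear.Build _ _ _ _ f lf).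
exact: (@Ck_linear _ _ _ fl).
Qed.

Lemma continuous_coord1 i : continuous (fun q => q.1 0 i).
Proof.
by move=> q; apply: (@continuous_comp _ _ _ fst (fun x : 'rV[R]_n => x 0 i));
  [exact: cvg_fst|exact: coord_continuous].
Qed.

Lemma continuous_coord2 i : continuous (fun q => q.2 0 i).
Proof.
by move=> q; apply: (@continuous_comp _ _ _ snd (fun x : 'rV[R]_h => x 0 i));
  [exact: cvg_snd|exact: coord_continuous].
Qed.

Lemma Ck_coord1 k i : Ck k (fun q => q.1 0 i).
Proof.
apply: Ck_linearfun; last exact: continuous_coord1.
by move=> c x y /=; rewrite !mxE.
Qed.

Lemma Ck_coord2 k i : Ck k (fun q => q.2 0 i).
Proof.
apply: Ck_linearfun; last exact: continuous_coord2.
by move=> c x y /=; rewrite !mxE.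
Qed.

Lemma norm_le_coord q (r : R) : 0 <= r ->
  (forall i, `|q.1 0 i| <= r) -> (forall i, `|q.2 0 i| <= r) -> `|q| <= r.
Proof.
have H m (x : 'rV[R]_m) : 0 <= r -> (forall i, `|x 0 i| <= r) -> `|x| <= r.
  move=> r0 xr; rewrite /Num.norm /= mx_normrE; apply/bigmax_leP; split => //= -[i j] _.
  by rewrite ord1; exact: xr.
by move=> r0 H1 H2; rewrite prod_normE ge_max !H.
Qed.

Lemma coord_le_norm m (x : 'rV[R]_m) i : `|x 0 i| <= `|x|.
Proof.
rewrite [leRHS]/Num.norm /= mx_normrE.
by apply: (le_bigmax _ (fun ij : 'I_1 * 'I_m => `|x ij.1 ij.2|) (0, i)).
Qed.

(** The squared Euclidean norm of [q - zt q *: (0, b)]. When [zt] grows at unit speed in direction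
    [(0, b)], this is constant along that direction. *)
Definition transv b (zt : Wc -> R) q : R :=
  \sum_(k < n) q.1 0 k ^+ 2 + \sum_(i < h) (q.2 0 i - b 0 i * zt q) ^+ 2.

Lemma Ck_transv b zt k : Ck k zt -> Ck k (transv b zt).
Proof.
move=> Cz.
rewrite (_ : transv b zt = \sum_(k < n) ((fun q => q.1 0 k) * (fun q => q.1 0 k)) +
  \sum_(i < h) (((fun q => q.2 0 i) + cst (- b 0 i) * zt) *
     ((fun q => q.2 0 i) + cst (- b 0 i) * zt))).
  apply: CkD; apply: Ck_sum => i; first by apply: CkM; exact: Ck_coord1.
  have C1 : Ck k ((fun q => q.2 0 i) + cst (- b 0 i) * zt).
    by apply: CkD; [exact: Ck_coord2|apply: CkM => //; exact: Ck_cst].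
  exact: CkM.
apply/funext => q; rewrite /transv [RHS]/GRing.add /= !fct_sumE.
congr (_ + _); apply: eq_bigr => i _; rewrite /GRing.mul /= expr2 //.
by rewrite /GRing.add /= /cst mulNr.
Qed.

Lemma transv_bound b zt q (eta : R) : 0 <= eta -> transv b zt q < eta ^+ 2 ->
  (forall k, `|q.1 0 k| <= eta) /\
  (forall i, `|q.2 0 i - b 0 i * zt q| <= eta).
Proof.
move=> e0 qe.
have S1 : 0 <= \sum_(k < n) q.1 0 k ^+ 2 by apply: sumr_ge0 => k _; exact: sqr_ge0.
have S2 : 0 <= \sum_(i < h) (q.2 0 i - b 0 i * zt q) ^+ 2.
  by apply: sumr_ge0 => k _; exact: sqr_ge0.
have H (x : R) : x ^+ 2 <= transv b zt q -> `|x| <= eta.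
  move=> xq; rewrite -(ler_pXn2r (n := 2)) ?nnegrE // real_normK ?num_real //.
  exact: le_trans xq (ltW qe).
split=> i; apply: H; rewrite /transv.
  rewrite (bigD1 i) //= -addrA lerDl addr_ge0 // sumr_ge0 // => k _; exact: sqr_ge0.
rewrite [leRHS]addrC (bigD1 i) //= -addrA lerDl addr_ge0 // sumr_ge0 // => k _.
exact: sqr_ge0.
Qed.

(** A smooth cap over the tube of radius [eta] around the line spanned by [(0, b)]. It localises
    transversally without contributing to derivatives along [b]. *)
Definition tcap b (zt : Wc -> R) (eta : R) q : R :=
  sstep (1 - transv b zt q / eta ^+ 2).

Lemma Ck_tcap b zt eta k : Ck k zt -> Ck k (tcap b zt eta).
Proof.
move=> Cz.
rewrite (_ : tcap _ _ _ = sstep \o (cst 1 + cst (- eta ^- 2) * transv b zt)).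
  apply: Ck_comp; first exact: Ck_sstep.
  apply: CkD; first exact: Ck_cst.
  by apply: CkM; [exact: Ck_cst|exact: Ck_transv].
by apply/funext => q; rewrite /tcap /= /GRing.add /= /GRing.mul /= /cst mulNr mulrC.
Qed.

Lemma tcap_neq0 b zt eta q : 0 < eta -> tcap b zt eta q != 0 ->
  (forall k, `|q.1 0 k| <= eta) /\
  (forall i, `|q.2 0 i - b 0 i * zt q| <= eta).
Proof.
move=> e0 q0; apply: transv_bound; first exact: ltW.
rewrite ltNge; apply: contra q0 => q0; apply/eqP/sstep_le0.
by rewrite subr_le0 ler_pdivlMr ?mul1r // exprn_gt0.
Qed.

Lemma tcap_gt0 b zt eta : zt 0 = 0 -> 0 < tcap b zt eta 0.
Proof.
move=> z0; apply: sstep_gt0; rewrite subr_gt0 /transv !big1 ?addr0 ?mul0r //.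
  by move=> i _; rewrite z0 mxE mulr0 subr0 expr0n.
by move=> i _; rewrite mxE expr0n.
Qed.

(** On a line of direction [(0, b)] the cap is constant and [zt] is the parameter up to a
    translation, so only [H] gets differentiated. *)
Lemma derive_tcap_mul b zt eta (H : R -> R) (dH : R) q :
  (forall k, Ck k zt) -> (forall k, Ck k H) ->
  (forall q s, zt (q + s *: (0, b)) = zt q + s) ->
  is_derive (zt q) (1 : R) H dH ->
  'D_((0, b) : Wc) (tcap b zt eta * (H \o zt)) q = tcap b zt eta q * dH.
Proof.
move=> Cz CH zb HdH.
have C1 : Ck 1 (tcap b zt eta * (H \o zt)).
  by apply: CkM; [exact: Ck_tcap|exact: Ck_comp].
have D1 : derivable (tcap b zt eta * (H \o zt)) (q + 0 *: (0, b)) (0, b).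
  by apply: diff_derivable; have [+ _] := C1; exact.
have [_] := is_derive_line D1; rewrite scale0r addr0 => <-.
have tb s : tcap b zt eta (q + s *: (0, b)) = tcap b zt eta q.
  suff E : transv b zt (q + s *: (0, b)) = transv b zt q by rewrite /tcap E.
  rewrite /transv zb; congr (_ + _); apply: eq_bigr => i _; rewrite !mxE /= ?mulr0 ?addr0 //.
  by congr (_ ^+ 2); ring.
rewrite (_ : (fun s : R => _) = cst (tcap b zt eta q) * (H \o (fun s => zt q + s))); last first.
  by apply/funext => s; rewrite /GRing.mul /= tb zb.
have d1 : is_derive (0 : R) (1 : R) (fun s : R => zt q + s) (0 + 1).
  rewrite (_ : (fun s : R => _) = cst (zt q) + id); first exact: is_deriveD.
  by apply/funext.
have d2 : is_derive (0 : R) (1 : R) (H \o (fun s : R => zt q + s)) (dH * (0 + 1)).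
  by apply: is_derive1_comp; rewrite addr0.
have [_ ->] := is_deriveM (is_derive_cst (tcap b zt eta q) (0 : R) 1) d2.
by rewrite /GRing.scale /= mulr0 addr0 add0r mulr1.
Qed.

(* [psi] approximates the indicator of a slab of width of order [kappa] on one
   side of the hyperplane through [0] transversal to [b]: the part [nu] of
   [D_b psi] that has the wrong sign is carried by the face through [0]. *)
Lemma slab_bump b (rho : R) : 0 < rho ->
  exists2 kappa : R, 0 < kappa & forall rho' : R, 0 < rho' ->
  exists psi nu theta : Wc -> R,
  [/\ [/\ forall k, Ck k psi, forall q, 0 <= psi q, 0 < psi 0 &
          forall q, rho < `|q| -> psi q = 0],
      [/\ continuous nu, forall q, 0 <= nu q &
          forall q, rho' < `|q| -> nu q = 0],
      (forall k, Ck k theta) /\ (forall q, rho < `|q| -> theta q = 0),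
      forall q, 'D_((0, b) : Wc) psi q <= nu q &
      forall q, kappa * nu q <= psi q - 'D_((0, b) : Wc) theta q].
Proof.
have b1 : 0 < 1 + `|b| by rewrite ltr_wpDr.
have [-> rho0|/eqP b0 rho0] := eqVneq b 0.
  (* For [b = 0] all derivatives along [(0, b)] vanish: [nu] and [theta] can be [0], and any
     positive [kappa] does. *)
  exists 1 => // rho' _; pose psi : Wc -> R := tcap 0 (cst 0) rho.
  have D0 (f : Wc -> R) q : 'D_((0, 0) : Wc) f q = 0 by exact: (derive0 f q).
  exists psi, (cst 0), (cst 0); split.
  - split=> [k|q||q qrho]; [exact/Ck_tcap/Ck_cst|exact: sstep_ge0|exact: tcap_gt0|].
    apply/eqP; apply: contraTT qrho => /(tcap_neq0 rho0)[H1 H2].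
    rewrite -leNgt; apply: norm_le_coord => [|//|i]; first exact: ltW.
    by have := H2 i; rewrite mulr0 subr0.
  - by split=> // q; exact: cvg_cst.
  - by split=> // k; exact: Ck_cst.
  - by move=> q; rewrite D0.
  - by move=> q; rewrite D0 mulr0 subr0; exact: sstep_ge0.
have [i0 bi0] : exists i, b 0 i != 0.
  apply/existsP; apply: contra_notT b0 => /existsPn H.
  by apply/rowP => i; rewrite mxE; apply/eqP; have := H i; rewrite negbK.
(* Chosen so that a tube of height [2 * kappa] along [b] and thickness at most [2 * kappa] lies in
   the ball of radius [rho]. *)
pose kappa := rho / (2 * (1 + `|b|)).
have kappa0 : 0 < kappa by rewrite divr_gt0 // mulr_gt0.
have rhoE : rho = 2 * kappa * (1 + `|b|).
  by rewrite /kappa; field; rewrite gt_eqF.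
exists kappa => // rho' rho'0.
(* The first bound keeps [psi] inside radius [rho], the second keeps the part with
   [- eta < zt q < 0], which carries [nu], inside radius [rho']. *)
pose eta := Num.min (2 * kappa) (rho' / (1 + `|b|)).
have eta0 : 0 < eta by rewrite lt_min mulr_gt0 //= divr_gt0.
have etak : eta <= 2 * kappa by rewrite ge_min lexx.
have etar : eta * (1 + `|b|) <= rho' by rewrite -ler_pdivlMr // ge_min lexx orbT.
(* The height along [b], read off from one nonzero component of [b]. *)
pose zt q := q.2 0 i0 / b 0 i0.
have ztb q s : zt (q + s *: (0, b)) = zt q + s.
  by rewrite /zt /= !mxE mulrDl mulfK.
have Czt k : Ck k zt.
  rewrite (_ : zt = (fun q => q.2 0 i0) * cst (b 0 i0)^-1) //.
  by apply: CkM; [exact: Ck_coord2|exact: Ck_cst].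
pose Th := tcap b zt eta.
have Th0 q : 0 <= Th q by exact: sstep_ge0.
have CTh k : Ck k Th by exact: Ck_tcap.
(* [A1] rises on [[- eta, 0]] and [A2] falls on [[kappa, 2 * kappa]]. The derivative of their
   product [H] is [N - M], with [N >= 0] living on the rising face, next to height [0], and [M >= 0]
   on the far one. *)
pose A1 (z : R) := sstep (z / eta + 1).
pose A2 (z : R) := sstep (2 - z / kappa).
pose H (z : R) := A1 z * A2 z.
have dA1 (z : R) : is_derive z (1 : R) A1 (sstep' (z / eta + 1) / eta).
  have d : is_derive z (1 : R) (fun y : R => y / eta + 1) (eta^-1 *: 1 + 0).
    rewrite (_ : (fun y : R => _) = eta^-1 *: id + cst 1); first exact: is_deriveD.
    by apply/funext => y; rewrite /GRing.add /= /GRing.scale /= mulrC.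
  apply: is_derive_eq (is_derive1_comp (is_derive_sstep _) d) _.
  by rewrite addr0 /GRing.scale /= mulr1.
have dA2 (z : R) : is_derive z (1 : R) A2 (- (sstep' (2 - z / kappa) / kappa)).
  have d : is_derive z (1 : R) (fun y : R => 2 - y / kappa) (0 - kappa^-1 *: 1).
    rewrite (_ : (fun y : R => _) = cst 2 - kappa^-1 *: id); first exact: is_deriveB.
    by apply/funext => y; rewrite /GRing.add /= /GRing.scale /= mulrC.
  apply: is_derive_eq (is_derive1_comp (is_derive_sstep _) d) _.
  by rewrite sub0r /GRing.scale /= mulr1 mulrN.
have CA1 k : Ck k A1.
  rewrite (_ : A1 = sstep \o (id * cst eta^-1 + cst 1)) //.
  apply: Ck_comp; first exact: Ck_sstep.
  apply: CkD; last exact: Ck_cst.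
  apply: CkM; last exact: Ck_cst.
  by apply: Ck_linearfun => // x; exact: cvg_id.
have CA2 k : Ck k A2.
  rewrite (_ : A2 = sstep \o (cst 2 + id * cst (- kappa^-1))); last first.
    by apply/funext => y; rewrite /A2 /= /GRing.add /= /GRing.mul /= mulrN.
  apply: Ck_comp; first exact: Ck_sstep.
  apply: CkD; first exact: Ck_cst.
  apply: CkM; last exact: Ck_cst.
  by apply: Ck_linearfun => // x; exact: cvg_id.
have CH k : Ck k H by apply: CkM.
pose N (z : R) := sstep' (z / eta + 1) / eta * A2 z.
pose M (z : R) := A1 z * (sstep' (2 - z / kappa) / kappa).
have dH (z : R) : is_derive z (1 : R) H (N z - M z).
  apply: is_derive_eq (is_deriveM (dA1 z) (dA2 z)) _.
  by rewrite /N /M /GRing.scale /=; ring.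
(* The derivative of [K] is [H + (z - kappa) * (N - M)], so [psi] minus the derivative of [theta] is
   the cap times [(kappa - z) * (N - M)]. Where [N] lives, [z < 0] and the factor is at least
   [kappa]; where [M] lives, [z > kappa] and the contribution is nonnegative. This is the last
   claim. *)
pose K (z : R) := (z - kappa) * H z.
have CK k : Ck k K.
  rewrite (_ : K = (id + cst (- kappa)) * H) //.
  apply: CkM => //; apply: CkD; last exact: Ck_cst.
  by apply: Ck_linearfun => // x; exact: cvg_id.
have dK (z : R) : is_derive z (1 : R) K (H z + (z - kappa) * (N z - M z)).
  have d : is_derive z (1 : R) (fun y : R => y - kappa) (1 - 0).
    rewrite (_ : (fun y : R => _) = id - cst kappa) //; exact: is_deriveB.
  apply: is_derive_eq (is_deriveM d (dH z)) _.
  by rewrite /GRing.scale /=; ring.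
have A1_0 (z : R) : z <= - eta -> A1 z = 0.
  by move=> ze; apply: sstep_le0; rewrite -lerBrDr sub0r ler_pdivrMr // mulN1r.
have A2_0 (z : R) : 2 * kappa <= z -> A2 z = 0.
  by move=> ze; apply: sstep_le0; rewrite subr_le0 ler_pdivlMr.
have H_0 (z : R) : H z != 0 -> - eta < z < 2 * kappa.
  move=> Hz; apply/andP; split; rewrite ltNge; apply: contra Hz => zz.
    by rewrite /H A1_0 // mul0r.
  by rewrite /H A2_0 // mulr0.
have N_0 (z : R) : N z != 0 -> - eta < z < 0.
  move=> Hz; apply/andP; split; rewrite ltNge; apply: contra Hz => zz.
    rewrite /N sstep'_le0 ?mul0r //.
    by rewrite -lerBrDr sub0r ler_pdivrMr // mulN1r.
  by rewrite /N sstep'_ge1 ?mul0r // lerDr divr_ge0 // ltW.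
have M_0 (z : R) : M z != 0 -> kappa < z.
  move=> Hz; rewrite ltNge; apply: contra Hz => zz.
  rewrite /M sstep'_ge1 ?mul0r ?mulr0 // lerBrDr -lerBrDl.
  by rewrite ler_pdivrMr // (le_trans zz) // (_ : 2 - 1 = 1 :> R) ?mul1r //; ring.
have N0 (z : R) : 0 <= N z.
  by apply: mulr_ge0; rewrite ?sstep_ge0 // divr_ge0 ?sstep'_ge0 // ltW.
have M0 (z : R) : 0 <= M z.
  by apply: mulr_ge0; rewrite ?sstep_ge0 // divr_ge0 ?sstep'_ge0 // ltW.
have small q (B : R) : Th q != 0 -> `|zt q| <= B -> eta <= B -> `|q| <= B * (1 + `|b|).
  move=> /(tcap_neq0 eta0)[H1 H2] zB eB.
  have B0 : 0 <= B by exact: le_trans (ltW eta0) eB.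
  have BB : B <= B * (1 + `|b|) by rewrite ler_peMr // lerDl.
  apply: norm_le_coord => [|i|i]; first by rewrite (le_trans B0).
    exact: le_trans (H1 i) (le_trans eB BB).
  rewrite -[q.2 0 i](subrK (b 0 i * zt q)) (le_trans (ler_normD _ _)) //.
  rewrite mulrDr mulr1 lerD ?(le_trans (H2 i)) // normrM mulrC.
  by rewrite ler_pM // coord_le_norm.
pose psi := Th * (H \o zt); pose nu q := Th q * N (zt q); pose theta := Th * (K \o zt).
have psi_supp q : rho < `|q| -> Th q * H (zt q) = 0.
  move=> qr; apply/eqP; apply: contraTT qr; rewrite mulf_eq0 negb_or -leNgt.
  move=> /andP[T1 /H_0/andP[z1 z2]]; rewrite rhoE; apply: small => //.
  by rewrite ler_norml; apply/andP; split; lra.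
exists psi, nu, theta; split.
- split=> [k|q||q]; first by apply: CkM => //; exact: Ck_comp.
  + by rewrite mulr_ge0 // mulr_ge0 // sstep_ge0.
  + apply: mulr_gt0; first by apply: tcap_gt0; rewrite /zt mxE mul0r.
    by apply: mulr_gt0; apply: sstep_gt0; rewrite /zt /= mxE !mul0r ?add0r ?subr0.
  + exact: psi_supp.
- split=> [|q|q qr].
  + have cN : Ck 0 N.
      rewrite (_ : N = (sstep' \o (id * cst eta^-1 + cst 1)) * cst eta^-1 * A2) //.
      apply: CkM (CA2 0); apply: CkM; last exact: Ck_cst.
      apply: Ck_comp; first exact: continuous_sstep'.
      apply: CkD; last exact: Ck_cst.
      apply: CkM; last exact: Ck_cst.
      by move=> x; exact: cvg_id.
    exact: (@CkM _ _ 0 Th (N \o zt) (CTh 0) (@Ck_comp _ _ 0 _ _ cN (Czt 0))).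
  + by rewrite mulr_ge0.
  + apply/eqP; apply: contraTT qr; rewrite mulf_eq0 negb_or -leNgt.
    move=> /andP[T1 /N_0/andP[z1 z2]]; apply: le_trans etar; apply: small => //.
    by rewrite ler_norml; apply/andP; split; lra.
- split=> [k|q qr]; first by apply: CkM => //; exact: Ck_comp.
  rewrite /theta /GRing.mul /= /K mulrCA -[X in _ * X]/(Th q * H (zt q)).
  by rewrite psi_supp // mulr0.
- move=> q; rewrite (derive_tcap_mul eta Czt CH ztb (dH _)) mulrBr.
  by rewrite gerBl mulr_ge0.
- move=> q; rewrite (derive_tcap_mul eta Czt CK ztb (dK _)).
  rewrite -[psi q]/(Th q * H (zt q)) /nu mulrCA -mulrBr ler_wpM2l //.
  rewrite opprD addrA subrr sub0r.
  have [e1|/N_0/andP[_ z1]] := eqVneq (N (zt q)) 0.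
    rewrite e1 mulr0 sub0r mulrN opprK.
    have [->|/M_0 z2] := eqVneq (M (zt q)) 0; first by rewrite mulr0.
    by rewrite mulr_ge0 // subr_ge0 ltW.
  have -> : M (zt q) = 0.
    apply/eqP; apply: contraTT z1 => /M_0 z2; rewrite -leNgt ltW //.
    exact: lt_trans z2.
  rewrite subr0 -mulNr ler_wpM2r // opprB lerBrDr gerDl; exact: ltW.
Qed.

End Bump.

(** * Shears and the weak formulation *)

Section Directional.
Context {R : realType} {V : normedModType R}.
Implicit Types (f : V -> R) (u v p : V) (k : R).

Lemma deriveDv f p u v : differentiable f p ->
  'D_(u + v) f p = 'D_u f p + 'D_v f p.
Proof. by move=> df; rewrite !deriveE // linearD. Qed.

Lemma deriveZv f p k v : differentiable f p -> 'D_(k *: v) f p = k * 'D_v f p.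
Proof. by move=> df; rewrite !deriveE // linearZ. Qed.

Lemma deriveNv f p v : differentiable f p -> 'D_(- v) f p = - 'D_v f p.
Proof. by move=> df; rewrite !deriveE // linearN. Qed.

Lemma derive_sumv f p m (v : 'I_m -> V) : differentiable f p ->
  'D_(\sum_(i < m) v i) f p = \sum_(i < m) 'D_(v i) f p.
Proof.
move=> df; rewrite deriveE // linear_sum; apply: eq_bigr => i _.
by rewrite deriveE.
Qed.

Lemma is_derive_curve f (c : R -> V) (r : R) v :
  differentiable f (c r) -> is_derive r 1 c v ->
  is_derive r 1 (fun s => f (c s)) ('D_v f (c r)).
Proof.
move=> df [/derivable1_diffP dc <-].
have dfc : differentiable (f \o c) r by exact: differentiable_comp.
apply: DeriveDef; first exact/derivable1_diffP.
by rewrite deriveE // diff_comp //= deriveE // deriveE.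
Qed.

Lemma is_derive_scalel (z : R -> R) (r d : R) (v : V) :
  is_derive r 1 z d -> is_derive r 1 (fun s => z s *: v) (d *: v).
Proof.
move=> [/derivable1_diffP dz <-].
have dzv : differentiable (fun s => z s *: v) r by exact: differentiableZl.
apply: DeriveDef; first exact/derivable1_diffP.
by rewrite deriveE // diffZl //= deriveE.
Qed.

End Directional.

Section Shear.
Context {R : realType} {n h : nat}.
Local Notation Wc := ('rV[R]_n * 'rV[R]_h)%type.
Variable Lm : 'M[R]_(n, h).
Implicit Types (p q : Wc) (r : R).

Definition mxbound : R := \sum_i \sum_k `|Lm k i|.

Lemma mxbound_ge0 : 0 <= mxbound.
Proof. by apply: sumr_ge0 => i _; apply: sumr_ge0. Qed.

Lemma norm_mulmx_le (x : 'rV[R]_n) : `|x *m Lm| <= mxbound * `|x|.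
Proof.
have B0 := mxbound_ge0.
have : forall i, `|(x *m Lm) 0 i| <= mxbound * `|x|.
  move=> i; rewrite mxE (le_trans (ler_norm_sum _ _ _)) //.
  rewrite /mxbound mulr_suml (bigD1 i) //= -[leLHS]addr0 lerD //; last first.
    by apply: sumr_ge0 => j _; rewrite mulr_ge0 // sumr_ge0.
  rewrite mulr_suml; apply: ler_sum => k _.
  by rewrite normrM mulrC ler_wpM2l // coord_le_norm.
move=> H; rewrite [leLHS]/Num.norm /= mx_normrE; apply/bigmax_leP; split.
  by rewrite mulr_ge0.
by move=> -[i j] _ /=; rewrite ord1.
Qed.

(** The flow at time [r] of the linear field [p |-> (0, p.1 *m Lm)]. *)
Definition shear r p : Wc := (p.1, p.2 + r *: (p.1 *m Lm)).

Lemma shear_linear r : linear (shear r).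
Proof.
move=> k p q; congr pair; rewrite /= mulmxDl -scalemxAl.
by rewrite !scalerDr scalerA [r * k]mulrC -scalerA addrACA.
Qed.

HB.instance Definition _ r :=
  GRing.isLinear.Build R Wc Wc _ (shear r) (shear_linear r).

Lemma norm_shear_le r p : `|shear r p| <= (1 + `|r| * mxbound) * `|p|.
Proof.
have [p1 p2] : `|p.1| <= `|p| /\ `|p.2| <= `|p|.
  by rewrite prod_normE !le_max !lexx orbT.
have B0 := mxbound_ge0.
rewrite prod_normE ge_max /=; apply/andP; split.
  by rewrite (le_trans p1) // ler_peMl // lerDl mulr_ge0.
rewrite (le_trans (ler_normD _ _)) // mulrDl mul1r lerD // normrZ -mulrA.
rewrite ler_wpM2l // (le_trans (norm_mulmx_le _)) // ler_wpM2l //.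
Qed.

Lemma shear_continuous r : continuous (shear r).
Proof.
move=> p; apply/cvgrPdist_lt => e e0.
have K0 : 0 < 1 + `|r| * mxbound by rewrite ltr_wpDr // mulr_ge0 // mxbound_ge0.
near=> q; rewrite -linearB (le_lt_trans (norm_shear_le _ _)) // mulrC -ltr_pdivlMr //.
by near: q; apply: cvgr_dist_lt => //; rewrite divr_gt0.
Unshelve. all: by end_near. Qed.

Lemma shearK r : cancel (shear r) (shear (- r)).
Proof.
by move=> [x y]; rewrite /shear /= scaleNr addrK.
Qed.

Lemma shear_vert r (u : 'rV[R]_h) : shear r (0, u) = (0, u).
Proof. by rewrite /shear /= mul0mx scaler0 addr0. Qed.

Lemma shear_horiz r (x : 'rV[R]_n) : x *m Lm = 0 -> shear r (x, 0) = (x, 0).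
Proof. by move=> x0; rewrite /shear /= x0 scaler0 addr0. Qed.

Lemma derive_vert (f : Wc -> R) p (u : 'rV[R]_h) : differentiable f p ->
  'D_((0, u) : Wc) f p = \sum_(i < h) u 0 i * 'D_(diry i) f p.
Proof.
move=> df; rewrite (_ : (0, u) = \sum_(i < h) u 0 i *: diry i :> Wc).
  by rewrite derive_sumv //; apply: eq_bigr => i _; rewrite deriveZv.
have S1 (F : 'I_h -> Wc) : (\sum_i F i).1 = \sum_i (F i).1.
  by elim/big_ind2 : _ => // x y z t <- <-.
have S2 (F : 'I_h -> Wc) : (\sum_i F i).2 = \sum_i (F i).2.
  by elim/big_ind2 : _ => // x y z t <- <-.
rewrite [RHS]surjective_pairing S1 S2 /=; congr pair.
  by rewrite big1 // => i _; rewrite scaler0.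
by rewrite [LHS]row_sum_delta.
Qed.

Lemma Cc_derive (xi : Wc -> R) v : Ck 1 xi -> Cc xi -> Cc ('D_v xi).
Proof.
move=> [_ Dxi] [_ [K HK]]; split; first exact: Dxi v.
by exists K => p; exact: derive_out.
Qed.

Lemma IW_derive_Ck (xi : Wc -> R) v : Ck 1 xi -> Cc xi -> IW ('D_v xi) = 0.
Proof.
by move=> Cxi xiC; have [dxi Dxi] := Cxi; apply: IW_derive => //; exact: Dxi v.
Qed.

Let lin i : Wc -> R := fun p => (p.1 *m Lm) 0 i.

Let Ck_lin k i : Ck k (lin i).
Proof.
rewrite (_ : lin i = \sum_(l < n) ((fun q : Wc => q.1 0 l) * cst (Lm l i))).
  by apply: Ck_sum => l; apply: CkM; [exact: Ck_coord1|exact: Ck_cst].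
by apply/funext => q; rewrite fct_sumE /lin mxE.
Qed.

Let derive_linE (xi : Wc -> R) : Ck 1 xi -> (fun p => 'D_((0, p.1 *m Lm) : Wc) xi p) =
  fun p => \sum_(i < h) lin i p * 'D_(diry i) xi p.
Proof. by move=> [dxi _]; apply/funext => p; rewrite derive_vert. Qed.

Let Cc_lin_derive (xi : Wc -> R) i : Ck 1 xi -> Cc xi ->
  Cc (fun p => lin i p * 'D_(diry i) xi p).
Proof. by move=> C1 C2; apply: CcMl; [exact: (Ck_lin 0)|exact: Cc_derive]. Qed.

Lemma Cc_derive_lin (xi : Wc -> R) : Ck 1 xi -> Cc xi ->
  Cc (fun p => 'D_((0, p.1 *m Lm) : Wc) xi p).
Proof. by move=> C1 C2; rewrite derive_linE //; apply: Cc_sum => i; exact: Cc_lin_derive. Qed.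

(* The field [p |-> (0, p.1 *m Lm)] is divergence free. *)
Lemma IW_derive_lin (xi : Wc -> R) : Ck 1 xi -> Cc xi ->
  IW (fun p => 'D_((0, p.1 *m Lm) : Wc) xi p) = 0.
Proof.
move=> C1 C2; rewrite derive_linE // IW_sum => [|i]; last exact: Cc_lin_derive.
apply: big1 => i _.
have Cl : Ck 1 (lin i * xi) by apply: CkM.
have dl p : differentiable (lin i) p by have [+ _] := Ck_lin 1 i; exact.
have dxi p : differentiable xi p by have [+ _] := C1; exact.
have Dl p : 'D_(diry i) (lin i) p = 0.
  rewrite -[p]addr0 -[X in p + X](scale0r (diry i : Wc)).
  have [_ <-] := is_derive_line
    (@diff_derivable _ _ _ (lin i) _ (diry i : Wc) (dl (p + 0 *: (diry i : Wc)))).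
  rewrite (_ : (fun s : R => _) = cst (lin i p)) ?derive_cst //.
  by apply/funext => s; rewrite /lin /= scaler0 addr0.
rewrite (_ : (fun p => _) = 'D_(diry i) (lin i * xi)).
  by apply: IW_derive_Ck => //; apply: CcMl; first exact: (Ck_lin 0).
apply/funext => p; rewrite deriveM; [|apply: diff_derivable; exact: dl|exact: diff_derivable].
by rewrite Dl scaler0 addr0.
Qed.

(* The integrand of the weak form of [D_(e, 0) phi - D_(0, p.1 *m Lm) phi
   - phi * D_(0, b) phi], with all derivatives moved to [xi]. *)
Definition weak_integrand (b : 'rV[R]_h) (e : Wc) (phi xi : Wc -> R) (p : Wc) : R :=
  phi p * ('D_e xi p - 'D_((0, p.1 *m Lm) : Wc) xi p)
  - 2^-1 * phi p ^+ 2 * 'D_((0, b) : Wc) xi p.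

Lemma Cc_weak_integrand b e (phi xi : Wc -> R) :
  continuous phi -> Ck 1 xi -> Cc xi -> Cc (weak_integrand b e phi xi).
Proof.
move=> cphi C1 C2.
rewrite (_ : weak_integrand b e phi xi = fun p => (phi p * 'D_e xi p
    + (-1) * (phi p * 'D_((0, p.1 *m Lm) : Wc) xi p))
    + (- 2^-1 * phi p * phi p) * 'D_((0, b) : Wc) xi p).
  apply: CcD; first apply: CcD.
  - by apply: CcMl => //; exact: Cc_derive.
  - by apply/CcZ/CcMl => //; exact: Cc_derive_lin.
  - apply: CcMl; last exact: Cc_derive.
    by move=> x; apply: cvgM; [apply: cvgM; [exact: cvg_cst|exact: cphi]|exact: cphi].
apply/funext => p; rewrite /weak_integrand.
by move: (phi p) ('D_e _ _) ('D_(0, p.1 *m Lm) _ _) ('D_(0, b) _ _) => x y u v; ring.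
Qed.

End Shear.

(** * Growth along a characteristic *)

(** Compactness of [[s, t]] makes a local property along the curve uniform. The hypothesis concerns
    pairs of points near [g r] so that the centre may move to a neighbouring [g r']. *)
Lemma tube {R : realType} {V : normedModType R} (g : R -> V) (P : V -> V -> Prop) (s t : R) :
  continuous g ->
  (forall r, s <= r <= t -> exists2 e : R, 0 < e &
    forall x y, `|x - g r| < e -> `|y - g r| < e -> P x y) ->
  exists2 d : R, 0 < d & forall r, s <= r <= t -> forall y, `|y - g r| <= d -> P (g r) y.
Proof.
move=> cg HP.
have /compact_near_coveringP cst_ := @segment_compact R s t.
have H : forall r, `[s, t]%classic r -> \forall r' \near r & d \near (0 : R)^'+,
    forall y, `|y - g r'| <= d -> P (g r') y.
  move=> r; rewrite /= in_itv /= => /HP[e e0 eP].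
  near=> r' d => y yd.
  have gr' : `|g r' - g r| < e / 2.
    rewrite distrC; near: r'; apply: cvgr_dist_lt; first exact: cg.
    by rewrite divr_gt0.
  have de : d < e / 2 by near: d; apply: nbhs_right_lt; rewrite divr_gt0.
  apply: eP; first by rewrite (lt_trans gr') // ltr_pdivrMr // ltr_pMr // ltr1n.
  rewrite -(subrK (g r') y) -addrA (le_lt_trans (ler_normD _ _)) // [e]splitr.
  by rewrite ltrD // (le_lt_trans yd).
have : \forall d \near (0 : R)^'+, forall r, `[s, t]%classic r ->
    forall y, `|y - g r| <= d -> P (g r) y.
  exact: cst_ H.
move=> H2.
have : \forall d \near (0 : R)^'+, 0 < d /\ forall r, `[s, t]%classic r ->
    forall y, `|y - g r| <= d -> P (g r) y.
  by near=> d; split; near: d => //; exact: nbhs_right_gt.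
move=> /filter_ex[d [d0 dP]]; by exists d => // r rst; apply: dP.
Unshelve. all: by end_near. Qed.

Section Characteristic.
Context {R : realType} {n h : nat}.
Local Notation Wc := ('rV[R]_n * 'rV[R]_h)%type.
Variables (Lm : 'M[R]_(n, h)) (b : 'rV[R]_h) (j : 'I_n).
Hypothesis ej0 : delta_mx 0 j *m Lm = 0 :> 'rV_h.
Variables (phi : Wc -> R) (M : R).
Hypotheses (cphi : continuous phi) (phiM : forall p, `|phi p| <= M).
Variables (a : Wc) (z : R -> R).

Definition charcurve (r : R) : Wc :=
  (a.1 + r *: delta_mx 0 j, a.2 - r *: (a.1 *m Lm) - z r *: b).

Hypothesis dz : forall r : R, is_derive r (1 : R) z (phi (charcurve r)).

Local Notation ej := (@dirx R n h j).
Local Notation gam := charcurve.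

Let M_ge0 : 0 <= M.
Proof. exact: le_trans (phiM 0). Qed.

(** This is [- shear Lm r (charcurve r)] written out. By [ej0] the drift of the curve cancels
    against the shear, leaving only the motions along [e_j] and [b]. *)
Definition moffset (r : R) : Wc :=
  (- (a.1 + r *: delta_mx 0 j), z r *: b - a.2).

Lemma shear_moffset r p : shear Lm r p + moffset r = shear Lm r (p - gam r).
Proof.
congr pair; rewrite /= ?opprD //.
rewrite mulmxDl mulmxBl mulNmx -scalemxAl ej0 scaler0 subr0.
move: (p.1 *m Lm) (a.1 *m Lm) => x y.
by apply/rowP => i; rewrite !mxE; ring.
Qed.

(** * The bump carried along the characteristic *)

Section MovingBump.
Variable psi : Wc -> R.
Hypothesis Cpsi : forall k, Ck k psi.
Variable rho : R.
Hypothesis psi0 : forall q, rho < `|q| -> psi q = 0.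

Definition mbump (r : R) (p : Wc) : R := psi (shear Lm r p + moffset r).

Lemma Ck_mbump k r : Ck k (mbump r).
Proof. exact: (Ck_comp_affine (@moffset r) (@shear_continuous _ _ _ Lm r) (Cpsi k)). Qed.

Lemma dpsi p : differentiable psi p.
Proof. by have [+ _] := Cpsi 1; exact. Qed.

Lemma derive_mbump r p v :
  'D_v (mbump r) p = 'D_(shear Lm r v) psi (shear Lm r p + moffset r).
Proof.
by have [_] := derive_comp_affine v (@shear_continuous _ _ _ Lm r) (dpsi (shear Lm r p + moffset r)).
Qed.

Lemma mbump_neq0 r p : mbump r p != 0 ->
  `|p - gam r| <= (1 + `|r| * mxbound Lm) * rho.
Proof.
move=> q0; have K0 : 0 <= 1 + `|r| * mxbound Lm.
  by rewrite addr_ge0 // mulr_ge0 // mxbound_ge0.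
rewrite -[p - gam r](shearK Lm r) (le_trans (norm_shear_le _ _ _)) // normrN.
rewrite ler_wpM2l // leNgt; apply: contra q0 => qr.
by apply/eqP/psi0; rewrite shear_moffset.
Qed.

Definition dmbump (r : R) (p : Wc) : R :=
  - 'D_ej psi (shear Lm r p + moffset r)
  + 'D_((0, p.1 *m Lm) : Wc) psi (shear Lm r p + moffset r)
  + phi (gam r) * 'D_((0, b) : Wc) psi (shear Lm r p + moffset r).

(** The bump is transported by the field in which [phi] is frozen at its value on the curve: the
    shear fixes [e_j] and the vertical directions, so derivatives of [psi] at the moved point are
    derivatives of the bump itself. *)
Lemma dmbumpE r p : dmbump r p =
  - 'D_ej (mbump r) p + 'D_((0, p.1 *m Lm) : Wc) (mbump r) p
  + phi (gam r) * 'D_((0, b) : Wc) (mbump r) p.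
Proof. by rewrite !derive_mbump !shear_vert shear_horiz. Qed.

Lemma is_derive_mbump (r : R) (p : Wc) : is_derive r (1 : R) (mbump ^~ p) (dmbump r p).
Proof.
pose c0 : Wc := (p.1 - a.1, p.2 - a.2).
pose V : Wc := - ej + (0, p.1 *m Lm).
pose B : Wc := (0, b).
have E : (fun s : R => shear Lm s p + moffset s) 
    = cst c0 + (fun s => s *: V) + (fun s => z s *: B).
  apply/funext => s; rewrite -[RHS]/(c0 + s *: V + z s *: B); congr pair; rewrite /= /c0 /V /B /=.
    by rewrite scaler0 !addr0 opprD addrA scalerN.
  move: (p.1 *m Lm) => x.
  by apply/rowP => i; rewrite !mxE; ring.
have dc : is_derive r (1 : R) (fun s : R => shear Lm s p + moffset s) (V + phi (gam r) *: B).
  rewrite E.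
  have d1 : is_derive r (1 : R) (fun s : R => s *: V) V.
    by have := is_derive_scalel V (is_derive_id r (1 : R)); rewrite scale1r.
  have d2 := is_deriveD (is_deriveD (is_derive_cst c0 r (1 : R)) d1)
    (is_derive_scalel B (dz r)).
  by apply: (is_derive_eq d2); rewrite add0r.
have := is_derive_curve (dpsi _) dc.
rewrite deriveDv; last exact: dpsi.
rewrite deriveDv; last exact: dpsi.
rewrite deriveNv; last exact: dpsi.
rewrite deriveZv; last exact: dpsi.
by [].
Qed.

Lemma charcurveE : gam =
  cst a + (fun s : R => s *: (ej - (0, a.1 *m Lm) : Wc)) + (fun s : R => z s *: (0, - b)).
Proof.
apply/funext => s.
rewrite -[RHS]/(a + s *: (ej - (0, a.1 *m Lm) : Wc) + z s *: (0, - b)).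
rewrite /charcurve; move: (a.1 *m Lm) => x; case: a => a1 a2.
by congr pair; apply/rowP => i; rewrite !mxE; ring.
Qed.

Lemma is_derive_charcurve (r : R) :
  is_derive r (1 : R) gam (ej - (0, a.1 *m Lm) - phi (gam r) *: (0, b)).
Proof.
set V : Wc := ej - (0, a.1 *m Lm).
have d1 : is_derive r (1 : R) (fun s : R => s *: V) V.
  by have := is_derive_scalel V (is_derive_id r (1 : R)); rewrite scale1r.
have d2 := is_deriveD (is_deriveD (is_derive_cst a r (1 : R)) d1)
    (is_derive_scalel (0, - b) (dz r)).
rewrite {1}charcurveE; apply: (is_derive_eq d2); rewrite add0r; congr (_ + _).
by congr pair; rewrite /= ?scaler0 ?oppr0 // scalerN.
Qed.

Lemma continuous_charcurve : continuous gam.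
Proof.
move=> r; apply: differentiable_continuous; apply/derivable1_diffP.
by case: (is_derive_charcurve r).
Qed.

Lemma charcurve_bounded (B : R) : exists G : R, forall r, `|r| <= B -> `|gam r| <= G.
Proof.
have /ex_strict_bound_gt0[G G0 HG] : bounded_set (gam @` `[- B, B]%classic).
  apply/compact_bounded/continuous_compact; last exact: segment_compact.
  exact/continuous_subspaceT/continuous_charcurve.
exists G => r rB; apply/ltW/HG; exists r => //=.
by rewrite in_itv /= -ler_norml.
Qed.

Lemma Cc_Dpsi v : Cc ('D_v psi).
Proof.
split; first by have [_ /(_ v)] := Cpsi 1.
by exists rho => p; exact: derive_out.
Qed.

(** For bounded times the curve stays bounded and the shears are uniformly Lipschitz, so one ball
    contains all supports; differentiation under the integral relies on this. *)
Lemma mbump_support (B : R) : exists K : R, forall r p, `|r| <= B -> K < `|p| ->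
  rho < `|shear Lm r p + moffset r|.
Proof.
have [G HG] := charcurve_bounded B.
exists ((1 + B * mxbound Lm) * rho + G) => r p rB Kp.
have K0 : 0 <= 1 + `|r| * mxbound Lm.
  by rewrite addr_ge0 // mulr_ge0 // mxbound_ge0.
rewrite ltNge; apply: contraTN Kp => qr.
rewrite -leNgt -[p](subrK (gam r)) (le_trans (ler_normD _ _)) // lerD ?HG //.
rewrite -[p - gam r](shearK Lm r) (le_trans (norm_shear_le _ _ _)) // normrN.
by rewrite -shear_moffset ler_pM // lerD2l ler_wpM2r // mxbound_ge0.
Qed.

(** The drift coefficient [p.1 *m Lm] is unbounded in [p], so the common support of the bumps has to
    be used. *)
Lemma dmbump_bounded (B : R) : exists C : R, forall r p, `|r| <= B -> `|dmbump r p| <= C.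
Proof.
have [K HK] := mbump_support B.
have [C1 [C10 HC1]] := Cc_bounded (Cc_Dpsi ej).
have [C2 [C20 HC2]] := Cc_bounded (Cc_Dpsi (0, b)).
have /choice[C3 HC3] : forall i : 'I_h, exists C : R, forall p, `|'D_(diry i) psi p| <= C.
  by move=> i; have [C [_ HC]] := Cc_bounded (Cc_Dpsi (@diry R n h i)); exists C.
exists (C1 + \sum_(i < h) mxbound Lm * `|K| * C3 i + M * C2) => r p rB.
have C30 i : 0 <= C3 i by exact: le_trans (HC3 i 0).
have [pK|pK] := leP `|p| K; last first.
  rewrite /dmbump !(derive_out _ psi0 (HK _ _ rB pK)) mulr0 oppr0 !addr0 normr0.
  rewrite !addr_ge0 ?mulr_ge0 ?M_ge0 //; apply: sumr_ge0 => i _.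
  by rewrite !mulr_ge0 // mxbound_ge0.
rewrite /dmbump (le_trans (ler_normD _ _)) // lerD //; last first.
  by rewrite normrM ler_pM.
rewrite (le_trans (ler_normD _ _)) // lerD // ?normrN //.
rewrite derive_vert; last exact: dpsi.
rewrite (le_trans (ler_norm_sum _ _ _)) //; apply: ler_sum => i _.
rewrite normrM ler_pM // (le_trans (coord_le_norm _ _)) //.
rewrite (le_trans (norm_mulmx_le _ _)) // ler_wpM2l ?mxbound_ge0 //.
apply: le_trans (le_trans pK (ler_norm K)).
by rewrite prod_normE le_max lexx.
Qed.

Lemma is_derive_IW_mbump (g : Wc -> R) (r : R) : continuous g ->
  is_derive r (1 : R) (fun s => IW (fun p => g p * mbump s p))
                      (IW (fun p => g p * dmbump r p)).
Proof.
move=> cg; pose B := `|r| + 1.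
have [K HK] := mbump_support B; have [C HC] := dmbump_bounded B.
have [C' [C'0 HC']] := Cc_bounded (CcMl cg (Cc_cutoff K)).
have inB s : - B < s < B -> `|s| <= B by rewrite -ltr_norml => /ltW.
apply: (@is_derive_IW _ _ _ (fun s p => g p * mbump s p) (fun s p => g p * dmbump s p)
  r (- B) B K (C' * C)).
- by rewrite -ltr_norml ltrDl.
- move=> s _ x; apply: cvgM; [exact: cg|].
  exact: (@Ck_mbump 0).
- by move=> s p /inB sB Kp; rewrite /mbump psi0 ?mulr0 //; exact: HK.
- move=> s p _; have d := is_derive_mbump s p.
  apply: is_derive_eq (@is_deriveM _ _ (cst (g p)) (mbump ^~ p) s 1 _ _ (is_derive_cst _ _ _) d) _.
  by rewrite scaler0 addr0.
- move=> s p /inB sB; have [pK|pK] := leP `|p| K.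
    rewrite normrM ler_pM ?HC //.
    apply: le_trans (HC' p); rewrite normrM ler_peMr // ger0_norm ?cutoff_ge0 //.
    exact: cutoff_ge1.
  have C0 : 0 <= C by exact: le_trans (HC s p sB).
  rewrite /dmbump !(derive_out _ psi0 (HK _ _ sB pK)) mulr0 oppr0 !addr0 mulr0 normr0.
  by rewrite mulr_ge0.
- move=> s p /inB sB pK.
  by rewrite /dmbump !(derive_out _ psi0 (HK _ _ sB pK)) mulr0 oppr0 !addr0 mulr0.
Qed.

Lemma Cc_mbump r : Cc (mbump r).
Proof.
split; first exact: (@Ck_mbump 0).
have [K HK] := mbump_support `|r|; exists K => p Kp.
by rewrite /mbump psi0 //; exact: HK.
Qed.

Lemma Cc_Dmbump v r : Cc ('D_v (mbump r)).
Proof. exact: Cc_derive (@Ck_mbump 1 r) (Cc_mbump r). Qed.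

Lemma IW_Dmbump v r : IW ('D_v (mbump r)) = 0.
Proof. exact: IW_derive_Ck (@Ck_mbump 1 r) (Cc_mbump r). Qed.

Lemma IW_mbump_cst r s : IW (mbump r) = IW (mbump s).
Proof.
have E : (fun r : R => IW (mbump r)) = (fun r => IW (fun p => cst 1 p * mbump r p)).
  by apply/funext => t; congr IW; apply/funext => p; rewrite mul1r.
apply: (@is_derive_0_is_cst _ (fun r : R => IW (mbump r))) => t.
have c1 : continuous (cst 1 : Wc -> R) by move=> x; exact: cvg_cst.
rewrite E; apply: is_derive_eq (is_derive_IW_mbump t c1) _.
have C1 := Cc_Dmbump ej t.
have C2 := Cc_derive_lin Lm (@Ck_mbump 1 t) (Cc_mbump t).
have C3 := Cc_Dmbump (0, b) t.
have I2 := IW_derive_lin Lm (@Ck_mbump 1 t) (Cc_mbump t).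
have E' := IW_lin3 (-1) 1 (phi (gam t)) C1 C2 C3 (IW_Dmbump ej t) I2 (IW_Dmbump (0, b) t).
rewrite !mulr0 !addr0 in E'; apply: etrans E'.
apply: (congr1 IW); apply/funext => p; rewrite dmbumpE.
by move: ('D_ej _ _) ('D_(0, p.1 *m Lm) _ _) ('D_(0, b) _ _) => y u v /=; ring.
Qed.

Section WeakSolution.
Variables (w : Wc -> R) (O : set Wc).
Hypothesis cw : continuous w.
Hypothesis weak : forall xi, test_function O xi ->
  IW (weak_integrand Lm b ej phi xi) = - IW (fun p => w p * xi p).

(** Completing the square: the product of [phi p] and [phi (gam r)] is half the sum of their squares
    minus half the square of their difference. The square of [phi p] is absorbed by the weak
    equation, and the square of the constant multiplies a derivative of integral [0]. *)
Lemma IW_phi_dmbump r : test_function O (mbump r) ->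
  IW (fun p => phi p * dmbump r p) = IW (fun p => w p * mbump r p)
  - 2^-1 * IW (fun p => (phi p - phi (gam r)) ^+ 2 * 'D_((0, b) : Wc) (mbump r) p).
Proof.
move=> /weak hw.
pose X1 := weak_integrand Lm b ej phi (mbump r).
pose X2 p := (phi p - phi (gam r)) ^+ 2 * 'D_((0, b) : Wc) (mbump r) p.
pose X3 := 'D_((0, b) : Wc) (mbump r).
have CX1 : Cc X1 by apply: Cc_weak_integrand => //; [exact: (@Ck_mbump 1)|exact: Cc_mbump].
have CX2 : Cc X2.
  apply: CcMl; last exact: Cc_Dmbump.
  move=> x; under eq_fun do rewrite expr2.
  by apply: cvgM; (apply: cvgB; [exact: cphi|exact: cvg_cst]).
have CX3 : Cc X3 by exact: Cc_Dmbump.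
have E := IW_lin3 (-1) (- 2^-1) (2^-1 * phi (gam r) ^+ 2) CX1 CX2 CX3 hw erefl
  (IW_Dmbump (0, b) r).
rewrite mulr0 addr0 mulN1r opprK mulNr in E; apply: etrans E.
apply: (congr1 IW); apply/funext => p; rewrite dmbumpE /X1 /weak_integrand /X2 /X3.
by move: (phi p) ('D_ej _ _) ('D_(0, p.1 *m Lm) _ _) ('D_(0, b) _ _) => x y u v; field.
Qed.

End WeakSolution.

Lemma test_function_mbump (O : set Wc) r (d : R) :
  (forall p, `|p - gam r| <= d -> O p) -> (1 + `|r| * mxbound Lm) * rho <= d ->
  test_function O (mbump r).
Proof.
move=> dO rd; pose D := [set p : Wc | `|p - gam r| <= d].
have cD : closed D.
  apply: (@closed_comp _ _ (fun p : Wc => `|p - gam r|) [set x | x <= d]); last exact: closed_le.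
  move=> p _; apply: (@continuous_comp _ _ _ (fun p : Wc => p - gam r) (fun x => `|x|)).
    by apply: cvgB; [exact: cvg_id|exact: cvg_cst].
  exact: norm_continuous.
have sD : closure [set p | mbump r p != 0] `<=` D.
  rewrite [X in _ `<=` X](closure_id _).1 //; apply: closure_subset => p /= /mbump_neq0 H.
  exact: le_trans H rd.
split; first by move=> k; exact: Ck_mbump.
- apply: (@subclosed_compact _ _ [set p : Wc | `|p| <= d + `|gam r|]).
  + exact: closed_closure.
  + exact: compact_le_norm.
  + move=> p /sD; rewrite /D /= => pd.
    by rewrite -[p](subrK (gam r)) (le_trans (ler_normD _ _)) // lerD2r.
- by move=> p /sD; exact: dO.
Qed.

End MovingBump.

Lemma shear_gam0 (r : R) : shear Lm r (gam r) + moffset r = 0.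
Proof. by rewrite shear_moffset subrr linear0. Qed.

Lemma characteristic_growth (w : Wc -> R) (O : set Wc) (s t c : R) :
  continuous w -> open O ->
  (forall xi, test_function O xi ->
    IW (weak_integrand Lm b ej phi xi) = - IW (fun p => w p * xi p)) ->
  s < t -> (forall r, s <= r <= t -> O (gam r)) ->
  (forall r, s <= r <= t -> c <= w (gam r)) ->
  c * (t - s) <= phi (gam t) - phi (gam s).
Proof.
move=> cw oO weak st Og wc.
(* In the slope, one [e] comes from the oscillation of [w] on the bump and one from the error term;
   the final [2 * e] is the price, at both end points, of replacing the mean of [phi] by its value
   on the curve. *)
suff H (e : R) : 0 < e -> (c - 2 * e) * (t - s) - 2 * e <= phi (gam t) - phi (gam s).
  rewrite leNgt; apply/negP => lt1.
  set x := c * (t - s) - (phi (gam t) - phi (gam s)).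
  have x0 : 0 < x by rewrite subr_gt0.
  have ts : 0 < t - s + 1 by lra.
  pose e := x / (4 * (t - s + 1)).
  have e0 : 0 < e by rewrite divr_gt0 // mulr_gt0.
  have ee : 4 * e * (t - s + 1) = x by rewrite /e; field; rewrite gt_eqF.
  have := H e e0; rewrite /x in ee x0; lra.
move=> e0.
have tubeP (e1 : R) : 0 < e1 -> exists2 d : R, 0 < d & forall r, s <= r <= t ->
    forall y, `|y - gam r| <= d ->
    [/\ O y, `|phi y - phi (gam r)| <= e1 & `|w y - w (gam r)| <= e1].
  move=> e10.
  apply: (@tube R Wc gam (fun x y => [/\ O y, `|phi y - phi x| <= e1 & `|w y - w x| <= e1])).
    exact: continuous_charcurve.
  move=> r rst.
  have n1 : \forall y \near gam r, O y /\
      (`|phi (gam r) - phi y| < e1 / 2 /\ `|w (gam r) - w y| < e1 / 2).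
    have e12 : 0 < e1 / 2 by rewrite divr_gt0.
    apply: filterI; first by apply: open_nbhs_nbhs; split => //; exact: Og.
    apply: filterI.
      by have /cvgrPdist_lt/(_ _ e12) := @cphi (gam r).
    by have /cvgrPdist_lt/(_ _ e12) := cw (gam r).
  have /nbhs_normP[d /= d0 dP] := n1; exists d => // x y xd yd.
  have [_ [x1 x2]] : _ := dP x (etrans (congr1 (fun u => u < d) (distrC _ _)) xd).
  have [Oy [y1 y2]] : _ := dP y (etrans (congr1 (fun u => u < d) (distrC _ _)) yd).
  have tri (u v q : R) : `|q - u| < e1 / 2 -> `|q - v| < e1 / 2 -> `|v - u| <= e1.
    move=> h1 h2; rewrite (_ : v - u = (q - u) - (q - v)); last by ring.
    by rewrite (le_trans (ler_normB _ _)) // [leRHS]splitr ltW // ltrD.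
  by split => //; [exact: tri x1 y1|exact: tri x2 y2].
have [d d0 dP] := tubeP e e0.
pose B := Num.max `|s| `|t|.
have rB r : s <= r <= t -> `|r| <= B.
  move=> /andP[sr rt]; rewrite ler_norml /B; have h1 := ler_norm (- s); have h2 := ler_norm t.
  rewrite normrN in h1; apply/andP; split.
    by rewrite lerNl le_max; apply/orP; left; lra.
  by rewrite le_max; apply/orP; right; lra.
pose La := 1 + B * mxbound Lm.
have Lr r : s <= r <= t -> 1 + `|r| * mxbound Lm <= La.
  by move=> /rB ?; rewrite lerD2l ler_wpM2r // mxbound_ge0.
have La0 : 0 < La by rewrite ltr_wpDr // mulr_ge0 ?mxbound_ge0 // le_max normr_ge0.
(* [La] bounds the expansion of the inverse shears for times in [[s, t]], so that bumps of radius
   [d / La] stay within distance [d] of the curve. *)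
pose rho := d / La; have rho0 : 0 < rho by rewrite divr_gt0.
have [kappa kappa0 HB] := @slab_bump R n h b rho rho0.
(* Chosen once [kappa] is known: [e' <= 1] lets [e'] bound the square of an oscillation at most
   [e'], and [e' <= 2 * kappa * e] is matched with the bound of [nu] by the mass over [kappa]. *)
pose e' := Num.min 1 (2 * kappa * e).
have e'0 : 0 < e' by rewrite lt_min ltr01 /= !mulr_gt0.
have e'1 : e' <= 1 by rewrite ge_min lexx.
have e'2 : e' <= 2 * kappa * e by rewrite ge_min lexx orbT.
have [d' d'0 d'P] := tubeP e' e'0.
pose rho' := d' / La; have rho'0 : 0 < rho' by rewrite divr_gt0.
have [psi [nu [theta [[Cpsi psi_ge0 psi_gt0 psi0] [cnu nu_ge0 nu0] [Cth th0] Dnu kap]]]] :=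
  HB rho' rho'0.
have near1 r p : s <= r <= t -> mbump psi r p != 0 -> `|p - gam r| <= d.
  move=> rst /(mbump_neq0 psi0) H; apply: le_trans H _.
  by rewrite -ler_pdivlMr // (_ : d / rho = La) ?Lr // /rho; field; rewrite !gt_eqF.
have near2 r p : s <= r <= t -> nu (shear Lm r p + moffset r) != 0 -> `|p - gam r| <= d'.
  move=> rst /(@mbump_neq0 nu rho' nu0 r) H; apply: le_trans H _.
  by rewrite -ler_pdivlMr // (_ : d' / rho' = La) ?Lr // /rho'; field; rewrite !gt_eqF.
pose m := IW (mbump psi s).
have mE r : IW (mbump psi r) = m by exact: (IW_mbump_cst Cpsi psi0).
have Cb r : Cc (mbump psi r) by exact: (Cc_mbump Cpsi psi0).
have m0 : 0 < m.
  apply: (@IW_gt0 _ _ _ (mbump psi s) (gam s)) => //.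
    by move=> p; exact: psi_ge0.
  by rewrite /mbump shear_gam0.
pose nur r p := nu (shear Lm r p + moffset r).
have Cnur r : Cc (nur r).
  split.
    move=> p; apply: (@continuous_comp _ _ _ (fun p => shear Lm r p + moffset r) nu);
      last exact: cnu.
    by apply: cvgD; [exact: shear_continuous|exact: cvg_cst].
  have [K HK] := mbump_support rho' `|r|.
  by exists K => p pK; apply: nu0; exact: HK.
(* The last property of [slab_bump] is integrated; the derivative of the moving [theta]
   disappears. *)
have nu_m r : kappa * IW (nur r) <= m.
  have C1 := Cc_Dmbump Cth th0 (0, b) r.
  rewrite -(mE r) -IWZ // -[leRHS]addr0 -[X in _ + X](mulr0 (-1)).
  rewrite -(IW_Dmbump Cth th0 (0, b) r) -IWZ // -IWD //; last exact: CcZ.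
  apply: le_IW; [exact: CcZ|by apply: CcD => //; exact: CcZ|move=> p].
  by rewrite mulN1r (derive_mbump Cth) shear_vert; exact: kap.
have dF (r : R) := is_derive_IW_mbump Cpsi psi0 r cphi.
(* The weak formula, with the term in [w] bounded below by [(c - e) * m] and half of the error
   bounded by [e * m]. *)
have dF_ge r : s <= r <= t -> (c - 2 * e) * m <= IW (fun p => phi p * dmbump psi r p).
  move=> rst.
  have tf : test_function O (mbump psi r).
    apply: (test_function_mbump Cpsi psi0 (d := d)).
      by move=> p pd; have [] := dP r rst p pd.
    by rewrite -ler_pdivlMr // (_ : d / rho = La) ?Lr // /rho; field; rewrite !gt_eqF.
  rewrite (IW_phi_dmbump Cpsi psi0 weak tf).
  have I1 : (c - e) * m <= IW (fun p => w p * mbump psi r p).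
    rewrite -(mE r) -IWZ //; apply: le_IW; [exact: CcZ|exact: CcMl|move=> p].
    have [->|/(near1 r p rst) pd] := eqVneq (mbump psi r p) 0; first by rewrite !mulr0.
    rewrite ler_wpM2r //; first exact: psi_ge0.
    have [_ _] := dP r rst p pd; rewrite ler_norml => /andP[h1 _].
    by have := wc r rst; lra.
  have I2 : IW (fun p => (phi p - phi (gam r)) ^+ 2 * 'D_((0, b) : Wc) (mbump psi r) p)
      <= e' * IW (nur r).
    rewrite -IWZ //; apply: le_IW; [|exact: CcZ|move=> p].
      apply: CcMl; last exact: (Cc_Dmbump Cpsi psi0).
      move=> x; under eq_fun do rewrite expr2.
      by apply: cvgM; (apply: cvgB; [exact: cphi|exact: cvg_cst]).
    rewrite (derive_mbump Cpsi) shear_vert.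
    have Dn := Dnu (shear Lm r p + moffset r).
    apply: le_trans (ler_wpM2l (sqr_ge0 _) Dn) _.
    have [E|/(near2 r p rst) pd] := eqVneq (nu (shear Lm r p + moffset r)) 0.
      by rewrite /nur E !mulr0.
    rewrite ler_wpM2r //; have [_ h1 _] := d'P r rst p pd.
    rewrite -real_normK ?num_real // expr2 -[leRHS]mulr1.
    by rewrite ler_pM // (le_trans h1).
  have I3 : e' * IW (nur r) <= 2 * e * m.
    have N0 : 0 <= IW (nur r) by apply: IW_ge0 => p; exact: nu_ge0.
    have e20 : 0 <= 2 * e by rewrite mulr_ge0 // ltW.
    apply: le_trans (ler_wpM2r N0 e'2) (le_trans _ (ler_wpM2l e20 (nu_m r))).
    by move: (IW (nur r)) => x; rewrite (_ : 2 * kappa * e * x = 2 * e * (kappa * x)) //; ring.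
  have : (c - 2 * e) * m = (c - e) * m - 2^-1 * (2 * e * m) by field.
  lra.
pose F r := IW (fun p => phi p * mbump psi r p).
have FE r : s <= r <= t -> `|F r - phi (gam r) * m| <= e * m.
  move=> rst.
  have bd p : mbump psi r p != 0 -> phi (gam r) - e <= phi p <= phi (gam r) + e.
    move=> /(near1 r p rst) pd; have [_ + _] := dP r rst p pd.
    by rewrite ler_distl.
  rewrite ler_distl -mulrBl -mulrDl -(mE r) -!IWZ //.
  apply/andP; split; apply: le_IW; [exact: CcZ|exact: CcMl| |exact: CcMl|exact: CcZ|];
    move=> p; have [->|/bd/andP[b1 b2]] := eqVneq (mbump psi r p) 0; rewrite ?mulr0 //;
    by rewrite ler_wpM2r //; exact: psi_ge0.
have [x xst Fx] : exists2 x, x \in `]s, t[ &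
    F t - F s = IW (fun p => phi p * dmbump psi x p) * (t - s).
  apply: (MVT st).
  apply: continuous_subspaceT => x; apply: differentiable_continuous.
  by apply/derivable1_diffP; have [] := dF x.
have xst' : s <= x <= t by move: xst; rewrite in_itv /= => /andP[/ltW -> /ltW ->].
have := FE s; rewrite lexx (ltW st) => /(_ erefl); rewrite ler_distl => /andP[a1 a2].
have := FE t; rewrite lexx (ltW st) => /(_ erefl); rewrite ler_distl => /andP[a3 a4].
have ts0 : 0 <= t - s by rewrite subr_ge0 ltW.
have G := ler_wpM2r ts0 (dF_ge x xst').
rewrite -(ler_pM2r m0).
have E1 : ((c - 2 * e) * (t - s) - 2 * e) * m = (c - 2 * e) * m * (t - s) - 2 * (e * m).
  by ring.
rewrite E1 mulrBl; lra.
Qed.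

End Characteristic.

(** * Peano's theorem *)

Section Peano.
Context {R : realType}.

Lemma fmap_ultra (T S : Type) (u : T -> S) (F : set_system T) :
  UltraFilter F -> UltraFilter (u @ F).
Proof.
move=> UF; split; first exact: fmap_proper_filter.
move=> G PG FG; apply/seteqP; split=> // A GA.
have [//|FnA] := in_ultra_setVsetC (u @^-1` A) UF.
have GnA : G (~` A) by exact: FG.
by case: (@filter_not_empty _ G PG); rewrite -(setICr A); exact: filterI.
Qed.

(** Limits along one fixed ultrafilter replace the extraction of a subsequence: the Euler
    approximations converge at all times simultaneously. *)
Lemma ultra_bounded_cvg (F : set_system nat) (u : nat -> R) (C : R) :
  UltraFilter F -> (forall k, `|u k| <= C) -> exists l : R, u @ F --> l.
Proof.
move=> UF uC; have := @segment_compact R (- C) C; rewrite compact_ultra.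
move=> /(_ (u @ F) (fmap_ultra u UF)) [|l [_ ul]]; last by exists l.
suff : F (u @^-1` `[- C, C]) by [].
by apply: filterE => k /=; rewrite in_itv /= -ler_norml; exact: uC.
Qed.

Variables (f : R -> R -> R) (M : R).
Hypothesis fM : forall t x, `|f t x| <= M.
Hypothesis cf : forall t x (e : R), 0 < e -> exists2 d : R, 0 < d &
  forall t' x', `|t' - t| < d -> `|x' - x| < d -> `|f t' x' - f t x| <= e.

Fixpoint euler (s : R) (i : nat) : R :=
  if i is i'.+1 then euler s i' + s * f (s * i'%:R) (euler s i') else 0.

Lemma euler_incr s i d c e : 0 <= s ->
  (forall l, (i <= l < i + d)%N -> `|f (s * l%:R) (euler s l) - c| <= e) ->
  `|euler s (i + d) - euler s i - c * (s * d%:R)| <= e * (s * d%:R).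
Proof.
move=> s0; elim: d => [|d IH] H; first by rewrite addn0 subrr !mulr0 subr0 normr0.
have {}IH := IH _; rewrite addnS /=.
have -> : euler s (i + d) + s * f (s * (i + d)%:R) (euler s (i + d)) - euler s i
    - c * (s * d.+1%:R) = (euler s (i + d) - euler s i - c * (s * d%:R))
    + s * (f (s * (i + d)%:R) (euler s (i + d)) - c).
  by rewrite -natr1; ring.
rewrite (le_trans (ler_normD _ _)) // -natr1 [s * (_ + 1)]mulrDr mulr1 [e * (_ + _)]mulrDr lerD //.
  by apply: IH => l /andP[l1 l2]; apply: H; rewrite l1 addnS ltnS ltnW.
rewrite normrM ger0_norm // mulrC ler_wpM2r //.
by apply: H; rewrite leq_addr addnS ltnSn.
Qed.

Let step (k : nat) : R := k.+1%:R^-1.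
Let idx k (t : R) := Num.truncn (t / step k).
Let ez k (t : R) := euler (step k) (idx k t).

Let step_gt0 k : 0 < step k. Proof. by rewrite invr_gt0. Qed.

Let idxP k t : 0 <= t ->
  step k * (idx k t)%:R <= t /\ t < step k * (idx k t)%:R + step k.
Proof.
move=> t0; have := truncn_itv (divr_ge0 t0 (ltW (step_gt0 k))).
rewrite -/(idx k t) ler_pdivlMr // ltr_pdivrMr // -natr1 mulrDl mul1r.
by rewrite ![_ * step k]mulrC => /andP[].
Qed.

(** [ez] is a step function, both times being rounded down to the grid; this rounding costs the
    additional term in [step k], which vanishes in the limit. *)
Let ez_incr k s t c e : 0 <= s -> s <= t -> 0 <= e ->
  (forall l, (idx k s <= l < idx k t)%N ->
     `|f (step k * l%:R) (euler (step k) l) - c| <= e) ->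
  `|ez k t - ez k s - c * (t - s)| <= e * (t - s) + (e + `|c|) * step k.
Proof.
move=> s0 st e0 H; have t0 := le_trans s0 st.
have ist : (idx k s <= idx k t)%N.
  by apply: le_truncn; rewrite ler_pM2r // invr_gt0.
have [s1 s2] := idxP k s0; have [t1 t2] := idxP k t0.
pose dd := (idx k t - idx k s)%N.
have ddE : (idx k s + dd)%N = idx k t by rewrite subnKC.
have := @euler_incr (step k) (idx k s) dd c e (ltW (step_gt0 k)).
rewrite ddE => /(_ H).
rewrite /ez; set E1 := euler _ (idx k t); set E2 := euler _ (idx k s) => h1.
have : step k * dd%:R = step k * (idx k t)%:R - step k * (idx k s)%:R.
  by rewrite -ddE natrD; ring.
set w := step k * dd%:R in h1 *; move=> wE.
have w1 : `|w - (t - s)| <= step k by rewrite ler_norml; apply/andP; split; lra.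
have : `|c * (w - (t - s))| <= `|c| * step k by rewrite normrM ler_wpM2l.
have : e * w <= e * (t - s + step k).
  by rewrite ler_wpM2l //; move: w1; rewrite ler_norml => /andP[_ ?]; lra.
have -> : E1 - E2 - c * (t - s) = (E1 - E2 - c * w) + c * (w - (t - s)) by ring.
move=> h2 h3; apply: le_trans (ler_normD _ _) _.
by rewrite mulrDl mulrDr in h2 *; lra.
Qed.

Let M0 : 0 <= M. Proof. exact: le_trans (fM 0 0). Qed.

Let ez_lip k s t : 0 <= s -> s <= t -> `|ez k t - ez k s| <= M * (t - s) + M * step k.
Proof.
move=> s0 st; have := @ez_incr k s t 0 M s0 st M0.
rewrite mul0r subr0 normr0 addr0; apply => l _; rewrite subr0; exact: fM.
Qed.

(** The estimate [ez_incr] passes to the limit along the ultrafilter. Differentiability is stated as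
    a first-order expansion restricted to nonnegative times, a form in which two half-line solutions
    can be glued at [0]. *)
Lemma peano_right : exists z : R -> R, [/\ z 0 = 0,
  forall t, 0 <= t -> `|z t| <= M * t &
  forall t e, 0 <= t -> 0 < e -> exists2 d : R, 0 < d &
    forall t', 0 <= t' -> `|t' - t| < d ->
    `|z t' - z t - f t (z t) * (t' - t)| <= e * `|t' - t|].
Proof.
have [U [UU evU]] := ultraFilterLemma (@eventually_filter).
have M_0 := M0.
have ez0 k : ez k 0 = 0 by rewrite /ez /idx mul0r truncn0.
have bd t k : `|ez k t| <= M * `|t| + M.
  have [t0|t0] := leP 0 t.
    have := ez_lip k (lexx 0) t0; rewrite ez0 !subr0 (ger0_norm t0) => /le_trans; apply.
    by rewrite lerD2l ler_piMr // invf_le1 // ler1n.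
  (* At negative times the truncated index is [0], so the approximation is [0] as well. *)
  rewrite /ez /idx; have -> : Num.truncn (t / step k) = 0%N.
    by rewrite truncn_floor leNgt pmulr_llt0 ?invr_gt0 // t0.
  by rewrite normr0 addr_ge0 // mulr_ge0.
have /choice[z zP] : forall t, exists l : R, ez ^~ t @ U --> l.
  by move=> t; exact: ultra_bounded_cvg (bd t).
have stepU (e : R) : 0 < e -> U [set k | step k < e].
  by move=> e0; apply: evU; exact: near_infty_natSinv_lt (PosNum e0).
have nearU t (e : R) : 0 < e -> U [set k | `|z t - ez k t| < e].
  by move=> e0; have /cvgrPdist_lt/(_ _ e0) := zP t.
have exU (t t' e : R) : 0 < e -> exists k, [/\ step k < e, `|z t - ez k t| < e & `|z t' - ez k t'| < e].
  move=> e0; have : U ([set k | step k < e] `&` [set k | `|z t - ez k t| < e] `&`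
    [set k | `|z t' - ez k t'| < e]).
    by apply: filterI; [apply: filterI; [exact: stepU|exact: nearU]|exact: nearU].
  by move=> /filter_ex[k [[k1 k2] k3]]; exists k.
have z0 : z 0 = 0.
  apply/eqP; rewrite -normr_le0; apply/ler_addgt0Pr => e e0.
  have [k [_ + _]] := exU 0 0 e e0; rewrite ez0 subr0 add0r; exact: ltW.
exists z; split=> // [t t0|t e t0 e0].
  apply/ler_addgt0Pr => e e0.
  have e'0 : 0 < e / (M + 1) by rewrite divr_gt0 // ltr_wpDl.
  have [k [k1 k2 _]] := exU t t _ e'0.
  have := ez_lip k (lexx 0) t0; rewrite ez0 !subr0 => h1.
  rewrite -[z t](subrK (ez k t)) (le_trans (ler_normD _ _)) //.
  have : M * step k <= M * (e / (M + 1)) by rewrite ler_wpM2l // ltW.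
  have : e / (M + 1) + M * (e / (M + 1)) = e by field; rewrite gt_eqF // ltr_wpDl.
  lra.
pose c := f t (z t).
have [d d0 dP] := @cf t (z t) e e0.
have M1 : 0 < M + 1 by rewrite ltr_wpDl.
(* For grid times within [2 * eta] of [t], the Euler value is within [d] of [z t]: it moves by at
   most [2 * M * eta], and [M * eta] is allowed for the grid and [eta] for the distance to the
   limit. *)
pose eta := d / (4 * (M + 1)).
have eta0 : 0 < eta by rewrite divr_gt0 // mulr_gt0.
have etaE : 4 * (M * eta) + 4 * eta = d by rewrite /eta; field; rewrite gt_eqF.
have Meta : 0 <= M * eta by rewrite mulr_ge0 // ltW.
exists eta => // t' t'0 tt'.
have key lo hi : 0 <= lo -> lo <= hi -> `|lo - t| < eta -> `|hi - t| < eta ->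
    `|z hi - z lo - c * (hi - lo)| <= e * (hi - lo).
  move=> lo0 lohi lot hit; apply/ler_addgt0Pr => e' e'0.
  pose e1 := Num.min eta (e' / (2 + (e + `|c|))).
  have D0 : 0 < 2 + (e + `|c|) by rewrite addr_gt0 // ltr_wpDr.
  have e10 : 0 < e1 by rewrite lt_min eta0 divr_gt0.
  have : U ([set k | step k < e1] `&` [set k | `|z t - ez k t| < e1] `&`
    ([set k | `|z lo - ez k lo| < e1] `&` [set k | `|z hi - ez k hi| < e1])).
    by apply: filterI; apply: filterI; [exact: stepU|exact: nearU|exact: nearU|exact: nearU].
  move=> /filter_ex[k [[/= k1 k2] [k3 k4]]].
  have e1eta : e1 <= eta by rewrite ge_min lexx.
  have e1e' : e1 * (2 + (e + `|c|)) <= e' by rewrite -ler_pdivlMr // ge_min lexx orbT.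
  have H l : (idx k lo <= l < idx k hi)%N ->
      `|f (step k * l%:R) (euler (step k) l) - c| <= e.
    move=> /andP[l1 l2].
    have [_ lo2] := idxP k lo0; have [hi1 _] := idxP k (le_trans lo0 lohi).
    have sl1 : step k * (idx k lo)%:R <= step k * l%:R.
      by rewrite ler_wpM2l ?ler_nat // ltW.
    have sl2 : step k * l%:R <= step k * (idx k hi)%:R.
      by rewrite ler_wpM2l ?ler_nat ?(ltnW l2) // ltW.
    have slt : `|step k * l%:R - t| < 2 * eta.
      by move: lot hit; rewrite !ltr_norml => /andP[? ?] /andP[? ?]; apply/andP; split; lra.
    have ezl : ez k (step k * l%:R) = euler (step k) l.
      by rewrite /ez /idx mulrAC mulfV ?mul1r ?natrK // gt_eqF.
    have sl0 : 0 <= step k * l%:R by rewrite mulr_ge0 // ltW.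
    apply: dP; first by lra.
    have lip : `|ez k (step k * l%:R) - ez k t| <= M * (2 * eta) + M * step k.
      have [lt|tl] := leP (step k * l%:R) t.
        rewrite distrC (le_trans (ez_lip k sl0 lt)) // lerD2r ler_wpM2l //.
        by move: slt; rewrite ltr_norml => /andP[? ?]; lra.
      rewrite (le_trans (ez_lip k t0 (ltW tl))) // lerD2r ler_wpM2l //.
      by move: slt; rewrite ltr_norml => /andP[? ?]; lra.
    rewrite -ezl -[_ - z t](subrK (ez k t - z t)) (le_lt_trans (ler_normD _ _)) //.
    rewrite opprB addrA subrK.
    have : M * step k <= M * eta by rewrite ler_wpM2l // ltW // (lt_le_trans k1).
    by rewrite [`|ez k t - z t|]distrC; lra.
  have := ez_incr lo0 lohi (ltW e0) H.
  have -> : z hi - z lo - c * (hi - lo) = (ez k hi - ez k lo - c * (hi - lo))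
    + ((z hi - ez k hi) - (z lo - ez k lo)) by ring.
  move=> h; apply: le_trans (ler_normD _ _) _.
  have h2 := ler_normB (z hi - ez k hi) (z lo - ez k lo).
  have : (e + `|c|) * step k <= (e + `|c|) * e1.
    by rewrite ler_wpM2l ?addr_ge0 // ltW.
  lra.
have [tl|tl] := leP t t'.
  by have := key _ _ t0 tl; rewrite subrr normr0 ger0_norm ?subr_ge0 //; apply => //;
    rewrite ger0_norm ?subr_ge0 // in tt'.
have := key _ _ t'0 (ltW tl) tt'; rewrite subrr normr0 => /(_ eta0).
rewrite [`|t' - t|]distrC [`|t - t'|]ger0_norm ?subr_ge0 ?(ltW tl) //.
by rewrite -normrN opprD !opprB -mulrN opprB addrC.
Qed.

End Peano.

Lemma is_derive_le {R : realType} (z : R -> R) (t c : R) :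
  (forall e, 0 < e -> exists2 d : R, 0 < d & forall t', `|t' - t| < d ->
    `|z t' - z t - c * (t' - t)| <= e * `|t' - t|) ->
  is_derive t (1 : R) z c.
Proof.
move=> H.
have cv : h^-1 *: (z (h *: (1 : R) + t) - z t) @[h --> 0^'] --> c.
  apply/cvgrPdist_le => e e0; have [d d0 dP] := H e e0; near=> h.
  have h0 : h != 0 by near: h; exact: nbhs_dnbhs_neq.
  have hd : `|h| < d by near: h; exact: dnbhs0_lt.
  have := dP (h + t); rewrite addrK => /(_ hd) le1.
  rewrite /GRing.scale /= mulr1 -(ler_pM2r (_ : 0 < `|h|)) ?normr_gt0 // -normrM.
  rewrite mulrBl mulrAC mulVf // mul1r -normrN opprB [_ - z t]addrC.
  by move: le1; rewrite [c * h]mulrC ![_ + z (h + t)]addrC.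
by apply: DeriveDef; [apply/cvg_ex; exists c|exact/cvg_lim].
Unshelve. all: by end_near. Qed.

(** The solution on negative times is obtained by time reversal from the field [- f (- t) x]; at [0]
    both expansions have the same slope. *)
Lemma peano {R : realType} (f : R -> R -> R) (M : R) :
  (forall t x, `|f t x| <= M) ->
  (forall t x (e : R), 0 < e -> exists2 d : R, 0 < d &
    forall t' x', `|t' - t| < d -> `|x' - x| < d -> `|f t' x' - f t x| <= e) ->
  exists z : R -> R, [/\ z 0 = 0, forall t, `|z t| <= M * `|t| &
    forall t, is_derive t (1 : R) z (f t (z t))].
Proof.
move=> fM cf.
have [zr [zr0 zrM zrd]] := peano_right fM cf.
pose g t x := - f (- t) x.
have gM t x : `|g t x| <= M by rewrite normrN.
have cg t x e : 0 < e -> exists2 d : R, 0 < d &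
    forall t' x', `|t' - t| < d -> `|x' - x| < d -> `|g t' x' - g t x| <= e.
  move=> e0; have [d d0 dP] := cf (- t) x e e0; exists d => // t' x' t'd x'd.
  rewrite /g -opprD normrN; apply: dP => //.
  by rewrite -opprD normrN.
have [zl [zl0 zlM zld]] := peano_right gM cg.
pose z t := if 0 <= t then zr t else zl (- t).
have zE t : t <= 0 -> z t = zl (- t).
  rewrite /z le_eqVlt => /predU1P[->|t0]; first by rewrite lexx oppr0 zl0 zr0.
  by rewrite leNgt t0.
have zE' t : 0 <= t -> z t = zr t by rewrite /z => ->.
exists z; split; first by rewrite zE' ?zr0.
  move=> t; have [t0|t0] := leP 0 t; first by rewrite zE' // (ger0_norm t0) zrM.
  by rewrite zE ?(ltW t0) // (ltr0_norm t0) zlM // oppr_ge0 ltW.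
have right t e : 0 <= t -> 0 < e -> exists2 d : R, 0 < d & forall t', 0 <= t' ->
    `|t' - t| < d -> `|z t' - z t - f t (z t) * (t' - t)| <= e * `|t' - t|.
  move=> t0 e0; have [d d0 dP] := zrd t e t0 e0; exists d => // t' t'0.
  by rewrite !zE' //; exact: dP.
have left t e : t <= 0 -> 0 < e -> exists2 d : R, 0 < d & forall t', t' <= 0 ->
    `|t' - t| < d -> `|z t' - z t - f t (z t) * (t' - t)| <= e * `|t' - t|.
  move=> t0 e0; have nt0 : 0 <= - t by rewrite oppr_ge0.
  have [d d0 dP] := zld (- t) e nt0 e0; exists d => // t' t'0 td.
  have := dP (- t'); rewrite oppr_ge0 => /(_ t'0).
  rewrite -opprD normrN => /(_ td).
  by rewrite !zE // /g opprK mulrNN.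
move=> t; apply: is_derive_le => e e0.
have [t0|t0|t0] := ltgtP 0 t.
- have [d d0 dP] := right t e (ltW t0) e0.
  exists (Num.min d t) => [|t']; first by rewrite lt_min d0.
  rewrite lt_min => /andP[td tt]; apply: dP => //.
  by move: tt; rewrite ltr_norml => /andP[? _]; lra.
- have [d d0 dP] := left t e (ltW t0) e0.
  exists (Num.min d (- t)) => [|t']; first by rewrite lt_min d0 oppr_gt0.
  rewrite lt_min => /andP[td tt]; apply: dP => //.
  by move: tt; rewrite ltr_norml => /andP[_ ?]; lra.
- rewrite -t0; have [d1 d10 d1P] := right 0 e (lexx _) e0.
  have [d2 d20 d2P] := left 0 e (lexx _) e0.
  exists (Num.min d1 d2) => [|t']; first by rewrite lt_min d10.
  rewrite lt_min => /andP[td1 td2].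
  by have [t'0|t'0] := leP 0 t'; [exact: d1P|apply: d2P => //; exact: ltW].
Qed.

(** * Homogeneous balls *)

Section CarnotNorm.
Context {R : realType} {g : vectType R} {br : g -> g -> g} {V1 V2 : {vspace g}}.
Context {G : groupType} {Exp : g -> G}.
Hypothesis hG : is_carnot2 br V1 V2 Exp.
Variables (N : G -> R).
Hypothesis hN : homogeneous_norm V1 V2 Exp N.
Variables (n h : nat) (X : n.+1.-tuple g) (Y : h.-tuple g).
Hypotheses (bX : basis_of V1 X) (bY : basis_of V2 Y).
Local Notation P := ('rV[R]_n.+1 * 'rV[R]_h)%type.
Local Notation gp := (gpoint Exp X Y).

Let brDr u v w : br u (v + w) = br u v + br u w.
Proof. by have [H _ _ _] := carnot2_lie hG; have := H u 1 v w; rewrite !scale1r. Qed.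

Let brDl u v w : br (v + w) u = br v u + br w u.
Proof. by have [_ H _ _] := carnot2_lie hG; have := H u 1 v w; rewrite !scale1r. Qed.

Let br0r u : br u 0 = 0.
Proof. by apply: (addrI (br u 0)); rewrite -brDr !addr0. Qed.

Let br0l u : br 0 u = 0.
Proof. by apply: (addrI (br 0 u)); rewrite -brDl !addr0. Qed.

Let brZr u k v : br u (k *: v) = k *: br u v.
Proof. by have [H _ _ _] := carnot2_lie hG; have := H u k v 0; rewrite br0r !addr0. Qed.

Let brZl u k v : br (k *: v) u = k *: br v u.
Proof. by have [_ H _ _] := carnot2_lie hG; have := H u k v 0; rewrite br0l !addr0. Qed.

Let brvv u : br u u = 0. Proof. by have [_ _ H _] := carnot2_lie hG. Qed.

Let brC u v : br u v = - br v u.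
Proof.
apply/eqP; rewrite -subr_eq0 opprK; apply/eqP.
by have := brvv (u + v); rewrite brDr !brDl !brvv add0r addr0 addrC.
Qed.

Let br_sumr I (s : seq I) u (F : I -> g) :
  br u (\sum_(i <- s) F i) = \sum_(i <- s) br u (F i).
Proof. exact: (big_morph _ (brDr u) (br0r u)). Qed.

Let br_suml I (s : seq I) u (F : I -> g) :
  br (\sum_(i <- s) F i) u = \sum_(i <- s) br (F i) u.
Proof. exact: (big_morph (br^~ u) (brDl u) (br0l u)). Qed.

Let mem_brv (A B : {vspace g}) u v : u \in A -> v \in B -> br u v \in brv br A B.
Proof.
move=> /coord_vbasis -> /coord_vbasis ->.
rewrite br_suml; apply: memv_suml => i _; rewrite br_sumr; apply: memv_suml => j _.
rewrite brZl brZr; do 2 apply: memvZ.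
apply: memv_span; apply/allpairsP; exists ((vbasis A)`_i, (vbasis B)`_j) => /=.
by split => //; apply: mem_nth; rewrite size_tuple.
Qed.

Let br11 u v : u \in V1 -> v \in V1 -> br u v \in V2.
Proof.
by move=> uV vV; have [_ _ <- _] := carnot2_strat hG; exact: mem_brv.
Qed.

Let br12 u v : u \in V1 -> v \in V2 -> br u v = 0.
Proof.
move=> uV vV; apply/eqP; rewrite -memv0; have [_ _ _ <-] := carnot2_strat hG.
exact: mem_brv.
Qed.

(** Centrality of [V2]. The stratification gives only that [V1] and [V2] commute; that [V2] commutes
    with itself follows from the Jacobi identity, as [V2] is spanned by brackets of elements of
    [V1]. *)
Let br2 u v : v \in V2 -> br u v = 0.
Proof.
move=> vV; have [[V12 _] _ br112 _] := carnot2_strat hG.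
have : u \in (V1 + V2)%VS by rewrite V12 memvf.
move=> /memv_addP[u1 u1V [u2 u2V ->]]; rewrite brDl br12 // add0r.
have : v \in brv br V1 V1 by rewrite br112.
rewrite /brv; set S := [seq _ | _ <- _, _ <- _] => vS.
rewrite (@coord_span _ _ _ (in_tuple S) v vS) br_sumr big1 // => i _; rewrite brZr.
have : (in_tuple S)`_i \in S by rewrite mem_nth //= size_tuple.
move=> /allpairsP[[a b] /= [aV bV ->]].
have {}aV := vbasis_mem aV; have {}bV := vbasis_mem bV.
have [_ _ _ J] := carnot2_lie hG.
have := J u2 a b; rewrite [br u2 a]brC [br b u2]br12 // [br a u2]br12 // oppr0 !br0r !addr0 => ->.
by rewrite scaler0.
Qed.

Let gX (x : 'rV[R]_n.+1) : g := \sum_(j < n.+1) x 0 j *: tnth X j.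
Let gY (y : 'rV[R]_h) : g := \sum_(i < h) y 0 i *: tnth Y i.

Let gX_V1 x : gX x \in V1.
Proof.
apply: memv_suml => j _; apply/memvZ/(basis_mem bX); exact: mem_tnth.
Qed.

Let gY_V2 y : gY y \in V2.
Proof.
apply: memv_suml => j _; apply/memvZ/(basis_mem bY); exact: mem_tnth.
Qed.

Let gXD x y : gX (x + y) = gX x + gX y.
Proof. by rewrite -big_split; apply: eq_bigr => i _; rewrite mxE scalerDl. Qed.

Let gYD x y : gY (x + y) = gY x + gY y.
Proof. by rewrite -big_split; apply: eq_bigr => i _; rewrite mxE scalerDl. Qed.

Let gXZ k x : gX (k *: x) = k *: gX x.
Proof. by rewrite scaler_sumr; apply: eq_bigr => i _; rewrite mxE scalerA. Qed.

Let gYZ k x : gY (k *: x) = k *: gY x.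
Proof. by rewrite scaler_sumr; apply: eq_bigr => i _; rewrite mxE scalerA. Qed.

(** Coordinates in [Y] of half the bracket of two horizontal vectors, the vertical correction in the
    group product. *)
Definition gbeta (x x' : 'rV[R]_n.+1) : 'rV[R]_h :=
  \row_i (2^-1 * \sum_j \sum_l x 0 j * x' 0 l * structc br X Y i j l).

Let gbetaE x x' : gY (gbeta x x') = 2^-1 *: br (gX x) (gX x').
Proof.
rewrite (coord_basis bY (br11 (gX_V1 x) (gX_V1 x'))) scaler_sumr.
apply: eq_bigr => i _; rewrite mxE -tnth_nth scalerA; congr (_ * _ *: _).
rewrite br_suml linear_sum; apply: eq_bigr => j _.
rewrite br_sumr linear_sum; apply: eq_bigr => l _.
by rewrite brZl brZr !linearZ /= mulrA.
Qed.

Lemma gpointM p q : (gp p * gp q)%g = gp (p.1 + q.1, p.2 + q.2 + gbeta p.1 q.1).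
Proof.
rewrite /gpoint (carnot2_BCH hG); congr Exp.
rewrite -![\sum_(j < n.+1) _]/(gX _) -![\sum_(i < h) _]/(gY _) /=.
rewrite gXD !gYD gbetaE brDr (br2 _ (gY_V2 _)) addr0 brDl.
rewrite (brC (gY _)) (br2 _ (gY_V2 _)) oppr0 addr0 -!addrA.
by congr (_ + _); rewrite addrCA.
Qed.

(** * The homogeneous norm in coordinates *)

Definition gnorm (p : P) : R := N (gp p).

Let gsum_inj0 p : gX p.1 + gY p.2 = 0 -> p = 0.
Proof.
move=> E; have [[_ V120] _ _ _] := carnot2_strat hG.
have X0 : gX p.1 = 0.
  apply/eqP; rewrite -memv0 -V120 memv_cap gX_V1 /=.
  by rewrite -[gX _](addrK (gY p.2)) E sub0r memvN gY_V2.
have Y0 : gY p.2 = 0 by move: E; rewrite X0 add0r.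
have /freeP fX := basis_free bX; have /freeP fY := basis_free bY.
rewrite [p]surjective_pairing; congr pair; apply/rowP => i; rewrite mxE.
  apply: (fX (fun i => p.1 0 i)).
  by rewrite -[RHS]X0; apply: eq_bigr => k _; rewrite -tnth_nth.
apply: (fY (fun i => p.2 0 i)).
by rewrite -[RHS]Y0; apply: eq_bigr => k _; rewrite -tnth_nth.
Qed.

Let Exp0 : Exp 0 = 1%g.
Proof.
have E : (Exp 0 * Exp 0 = Exp 0)%g.
  by rewrite (carnot2_BCH hG) br0r scaler0 !addr0.
by apply: (@mulgI _ (Exp 0)); rewrite E mulg1.
Qed.

Let gp0 : gp 0 = 1%g.
Proof.
by rewrite /gpoint !big1 ?addr0 ?Exp0 // => i _; rewrite mxE scale0r.
Qed.

Let gY_inj : injective gY.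
Proof.
move=> y y' E; apply/eqP; rewrite -subr_eq0; apply/eqP.
have gX0 : gX 0 = 0 by rewrite /gX big1 // => i _; rewrite mxE scale0r.
have /(congr1 snd) /= -> // : ((0, y - y') : P) = 0.
apply: gsum_inj0; rewrite /= gX0 add0r gYD -scaleN1r gYZ scaleN1r E.
exact: subrr.
Qed.

Let gXN x : gX (- x) = - gX x. Proof. by rewrite -scaleN1r gXZ scaleN1r. Qed.

Lemma gbetaxx x : gbeta x x = 0.
Proof. by apply: gY_inj; rewrite gbetaE brvv scaler0 /gY big1 // => i _; rewrite mxE scale0r. Qed.

Lemma gbetaN x x' : gbeta (- x) x' = - gbeta x x'.
Proof.
apply: gY_inj; rewrite gbetaE -[- gbeta _ _]scaleN1r gYZ gbetaE gXN.
by rewrite -[- gX x]scaleN1r brZl !scalerA mulrC.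
Qed.

Lemma gbetaNr x x' : gbeta x (- x') = - gbeta x x'.
Proof.
apply: gY_inj; rewrite gbetaE -[- gbeta _ _]scaleN1r gYZ gbetaE gXN.
by rewrite -[- gX x']scaleN1r brZr !scalerA mulrC.
Qed.

Lemma gbetaD x y z : gbeta x (y + z) = gbeta x y + gbeta x z.
Proof. by apply: gY_inj; rewrite gYD !gbetaE gXD brDr scalerDr. Qed.

Lemma gbeta0 x : gbeta x 0 = 0.
Proof. by have := gbetaD x 0 0; rewrite addr0 => E; apply: (addrI (gbeta x 0)); rewrite addr0. Qed.

Definition gbound : R := \sum_(i < h) \sum_(j < n.+1) \sum_(l < n.+1) `|structc br X Y i j l|.

Lemma gbound_ge0 : 0 <= gbound.
Proof. by do 3 (apply: sumr_ge0 => ? _). Qed.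

Lemma norm_gbeta x x' : `|gbeta x x'| <= gbound * (`|x| * `|x'|).
Proof.
have B0 := gbound_ge0.
rewrite [leLHS]/Num.norm /= mx_normrE; apply/bigmax_leP; split; first by rewrite !mulr_ge0.
move=> -[i0 i] _ /=; rewrite ord1 mxE normrM.
have xx0 : 0 <= `|x| * `|x'| by rewrite mulr_ge0.
apply: (@le_trans _ _ (\sum_(j < n.+1) \sum_(l < n.+1)
    `|structc br X Y i j l| * (`|x| * `|x'|))).
  rewrite ger0_norm ?invr_ge0 //; apply: (@le_trans _ _
     `|\sum_j \sum_l x 0 j * x' 0 l * structc br X Y i j l|).
    by rewrite ler_piMl // invf_le1 // ler1n.
  rewrite (le_trans (ler_norm_sum _ _ _)) //; apply: ler_sum => j _.
  rewrite (le_trans (ler_norm_sum _ _ _)) //; apply: ler_sum => l _.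
  by rewrite !normrM mulrC ler_wpM2l // ler_pM // coord_le_norm.
rewrite /gbound (bigD1 i) //= mulrDl -[leLHS]addr0 lerD //.
  by rewrite mulr_suml; apply: ler_sum => j _; rewrite mulr_suml.
by rewrite mulr_ge0 //; do 3 (apply: sumr_ge0 => ? _).
Qed.

Lemma gpointV p : ((gp p)^-1)%g = gp (- p).
Proof.
have E : (gp p * gp (- p) = 1)%g.
  rewrite gpointM -gp0; congr gp; congr pair; first exact: subrr.
  by rewrite /= subrr gbetaNr gbetaxx oppr0 addr0.
by apply: (@mulgI _ (gp p)); rewrite mulgV E.
Qed.

Lemma gnorm0 : gnorm 0 = 0.
Proof. by rewrite /gnorm gp0; apply/(hnorm_eq0 hN). Qed.

Lemma gnorm_ge0 p : 0 <= gnorm p.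
Proof.
have : N (gp p * (gp p)^-1)%g <= N (gp p) + N (gp p)^-1%g by exact: hnormM hN _ _.
by rewrite mulgV -gp0 -/(gnorm 0) gnorm0 (hnormV hN) -/(gnorm p); lra.
Qed.

Lemma gnorm_gt0 p : p != 0 -> 0 < gnorm p.
Proof.
move=> p0; rewrite lt_neqAle gnorm_ge0 andbT; apply: contraNneq p0 => /esym/(hnorm_eq0 hN) E.
apply/eqP/gsum_inj0; have [f fK _] := carnot2_exp_bij hG.
by apply: (can_inj fK); rewrite Exp0 -E.
Qed.

Lemma gnormN p : gnorm (- p) = gnorm p.
Proof. by rewrite /gnorm -gpointV (hnormV hN). Qed.

Lemma gnorm_dil (k : R) p : 0 < k -> gnorm (k *: p.1, k ^+ 2 *: p.2) = k * gnorm p.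
Proof.
move=> k0; rewrite -(hnorm_dil hN _ k0); congr N; rewrite /gpoint; congr Exp.
rewrite -![\sum_(j < n.+1) _]/(gX _) -![\sum_(i < h) _]/(gY _) /= gXZ gYZ.
have [[_ V120] _ _ _] := carnot2_strat hG.
have V210 : (V2 :&: V1 = 0)%VS by rewrite capvC.
have pi0 (U V : {vspace g}) v : (U :&: V = 0)%VS -> v \in V -> daddv_pi U V v = 0.
  move=> UV vV; have VU : (V :&: U = 0)%VS by rewrite capvC.
  have vUV : v \in (U + V)%VS by rewrite (subvP (addvSr U V)).
  have := daddv_pi_add UV vUV; rewrite (daddv_pi_id VU vV).
  by move=> /(canRL (addrK _)); rewrite subrr.
rewrite /dil !linearD /= (daddv_pi_id V120 (gX_V1 _)) (daddv_pi_id V210 (gY_V2 _)).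
by rewrite (pi0 _ _ _ V120 (gY_V2 _)) (pi0 _ _ _ V210 (gX_V1 _)) !scaler0 addr0 add0r.
Qed.

Lemma gnormD p q : gnorm (p.1 + q.1, p.2 + q.2 + gbeta p.1 q.1) <= gnorm p + gnorm q.
Proof. by rewrite /gnorm -gpointM; exact: hnormM hN _ _. Qed.

Lemma gnorm_vertD y y' : gnorm (0, y + y') <= gnorm (0, y) + gnorm (0, y').
Proof. by have := gnormD (0, y) (0, y'); rewrite /= gbeta0 !addr0. Qed.

Lemma gnorm_split (x : 'rV[R]_n.+1) y : gnorm (x, y) <= gnorm (x, 0) + gnorm (0, y).
Proof. by have := gnormD (x, 0) (0, y); rewrite /= gbeta0 !addr0 add0r. Qed.

(** The product of two horizontal points is not horizontal; its vertical part [gbeta x x'] has to be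
    removed by a further vertical factor. *)
Lemma gnorm_horizD (x x' : 'rV[R]_n.+1) :
  gnorm (x + x', 0) <= gnorm (x, 0) + gnorm (x', 0) + gnorm (0, - gbeta x x').
Proof.
have := gnormD (x + x', gbeta x x') (0, - gbeta x x').
rewrite /= gbeta0 !addr0 subrr => /le_trans; apply; rewrite lerD2r.
by have := gnormD (x, 0) (x', 0); rewrite /= addr0 add0r.
Qed.

Lemma gnorm_scale_vert (k : R) y : gnorm (0, k *: y) = Num.sqrt `|k| * gnorm (0, y).
Proof.
wlog k0 : k / 0 <= k.
  move=> H; have [|k0] := leP 0 k; first exact: H.
  rewrite -gnormN (_ : - _ = (0, - k *: y)) ?H ?normrN // ?oppr_ge0 ?ltW //.
  by congr pair; [exact: oppr0|rewrite /= scaleNr].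
have [->|kn0] := eqVneq k 0; first by rewrite scale0r gnorm0 normr0 sqrtr0 mul0r.
have kp : 0 < k by rewrite lt_neqAle eq_sym kn0.
have := @gnorm_dil (Num.sqrt k) (0, y); rewrite sqrtr_gt0 => /(_ kp).
by rewrite /= scaler0 sqr_sqrtr // ger0_norm.
Qed.

Lemma gnorm_scale_horiz (k : R) (x : 'rV[R]_n.+1) : gnorm (k *: x, 0) = `|k| * gnorm (x, 0).
Proof.
wlog k0 : k / 0 <= k.
  move=> H; have [|k0] := leP 0 k; first exact: H.
  rewrite -gnormN (_ : - _ = (- k *: x, 0)) ?H ?normrN // ?oppr_ge0 ?ltW //.
  by congr pair; [rewrite /= scaleNr|exact: oppr0].
have [->|kn0] := eqVneq k 0; first by rewrite scale0r gnorm0 normr0 mul0r.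
have kp : 0 < k by rewrite lt_neqAle eq_sym kn0.
by have := @gnorm_dil k (x, 0) kp; rewrite /= scaler0 ger0_norm.
Qed.

Let norm1 (p : P) : `|p.1| <= `|p|. Proof. by rewrite prod_normE le_max lexx. Qed.
Let norm2 (p : P) : `|p.2| <= `|p|. Proof. by rewrite prod_normE le_max lexx orbT. Qed.

(** Vertical points add up coordinatewise, and scaling by [k] multiplies their norm only by the
    square root of [|k|]; hence the square in the radius. *)
Lemma gnorm_vert_small (e : R) : 0 < e -> exists2 d : R, 0 < d &
  forall y : 'rV[R]_h, `|y| < d -> gnorm (0, y) < e.
Proof.
move=> e0; pose C := 1 + \sum_(i < h) gnorm (0, delta_mx 0 i).
have S0 : 0 <= \sum_(i < h) gnorm (0, delta_mx 0 i).
  by apply: sumr_ge0 => i _; exact: gnorm_ge0.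
have C0 : 0 < C by rewrite ltr_pwDl.
exists ((e / C) ^+ 2) => [|y yd]; first by rewrite exprn_gt0 // divr_gt0.
have H (s : seq 'I_h) : gnorm (0, \sum_(i <- s) y 0 i *: delta_mx 0 i)
    <= \sum_(i <- s) gnorm (0, y 0 i *: delta_mx 0 i).
  elim: s => [|i s IH]; first by rewrite !big_nil gnorm0.
  by rewrite !big_cons (le_trans (gnorm_vertD _ _)) // lerD2l.
rewrite [y]row_sum_delta (le_lt_trans (H _)) //.
apply: (@le_lt_trans _ _ (\sum_(i < h) (e / C) * gnorm (0, delta_mx 0 i))).
  apply: ler_sum => i _; rewrite gnorm_scale_vert ler_wpM2r ?gnorm_ge0 //.
  rewrite -[leRHS]gtr0_norm ?divr_gt0 // -[leRHS]sqrtr_sqr ler_wsqrtr //.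
  by rewrite (le_trans (coord_le_norm _ _)) // ltW.
rewrite -mulr_sumr mulrAC ltr_pdivrMr // ltr_pM2l //.
by rewrite /C ltrDr.
Qed.

(** Coordinate directions are added one at a time. Each addition produces a vertical correction,
    bilinear in the summands, hence small by [norm_gbeta] and [gnorm_vert_small]. *)
Lemma gnorm_horiz_small (e : R) : 0 < e -> exists2 d : R, 0 < d &
  forall x : 'rV[R]_n.+1, `|x| < d -> gnorm (x, 0) < e.
Proof.
have norm_delta (x : 'rV[R]_n.+1) j : `|x 0 j *: (delta_mx 0 j : 'rV[R]_n.+1)| <= `|x|.
  rewrite [leLHS]/Num.norm /= mx_normrE; apply/bigmax_leP; split => // -[i0 i] _ /=.
  rewrite !mxE; case: (_ && _); rewrite ?mulr1 ?mulr0 ?normr0 //.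
  exact: coord_le_norm.
suff H (s : seq 'I_n.+1) : forall e, 0 < e -> exists2 d : R, 0 < d &
    forall x : 'rV[R]_n.+1, `|x| < d ->
    gnorm (\sum_(j <- s) x 0 j *: delta_mx 0 j, 0) < e.
  move=> e0; have [d d0 dP] := H (index_enum _) e e0; exists d => // x xd.
  by rewrite [x]row_sum_delta; exact: dP.
elim: s => [|j s IH] {}e e0.
  by exists 1 => // x _; rewrite big_nil gnorm0.
have e3 : 0 < e / 3 by rewrite divr_gt0.
have [d1 d10 d1P] := IH _ e3.
have [d2 d20 d2P] := gnorm_vert_small e3.
pose C := gnorm (delta_mx 0 j, 0); have C0 : 0 <= C by exact: gnorm_ge0.
have C1 : 0 < C + 1 by rewrite ltr_wpDl.
pose K := gbound * (size s)%:R; have K0 : 0 <= K by rewrite mulr_ge0 // gbound_ge0.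
have K1 : 0 < K + 1 by rewrite ltr_wpDl.
(* One third of [e] each for the partial sum, the new coordinate and the vertical correction;
   [d <= 1] turns the quadratic bound of the correction into a linear one. *)
pose d := Num.min (Num.min d1 1) (Num.min (e / 3 / (C + 1)) (d2 / (K + 1))).
have dP1 : d <= d1 by rewrite !ge_min lexx.
have dP2 : d <= 1 by rewrite !ge_min lexx orbT.
have dP3 : d * (C + 1) <= e / 3 by rewrite -ler_pdivlMr // !ge_min lexx !orbT.
have dP4 : d * (K + 1) <= d2 by rewrite -ler_pdivlMr // !ge_min lexx !orbT.
exists d => [|x xd]; first by rewrite !lt_min d10 ltr01 !divr_gt0.
have x1 : `|x| < 1 by exact: lt_le_trans xd dP2.
rewrite big_cons; apply: le_lt_trans (gnorm_horizD _ _) _.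
set u := x 0 j *: _; set v := \sum_(_ <- s) _.
have vs : `|v| <= (size s)%:R * `|x|.
  rewrite /v; elim: s {IH d1P v K K0 K1 d dP1 dP2 dP3 dP4 xd} => [|i s IHs].
    by rewrite big_nil normr0 mul0r.
  rewrite big_cons (le_trans (ler_normD _ _)) // -natr1 mulrDl mul1r [leRHS]addrC.
  by rewrite lerD.
have h1 : gnorm (u, 0) < e / 3.
  rewrite gnorm_scale_horiz -/C; apply: lt_le_trans dP3.
  apply: (@le_lt_trans _ _ (`|x| * (C + 1))).
    by rewrite ler_pM ?coord_le_norm // lerDl.
  by rewrite ltr_pM2r.
have h2 : gnorm (v, 0) < e / 3 by apply: d1P; exact: lt_le_trans xd dP1.
have h3 : gnorm (0, - gbeta u v) < e / 3.
  apply: d2P; rewrite normrN; apply: lt_le_trans dP4.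
  apply: le_lt_trans (norm_gbeta _ _) _.
  apply: (@le_lt_trans _ _ (`|x| * (K + 1))); last by rewrite ltr_pM2r.
  have : `|u| * `|v| <= 1 * ((size s)%:R * `|x|).
    by rewrite ler_pM // (le_trans (norm_delta _ _)) // ltW.
  rewrite mul1r => /(ler_wpM2l gbound_ge0) /le_trans; apply.
  by rewrite mulrA -/K mulrC ler_wpM2l // lerDl.
rewrite [e](_ : _ = e / 3 + e / 3 + e / 3); last by field.
by rewrite !ltrD.
Qed.

Lemma gnorm_small (e : R) : 0 < e -> exists2 d : R, 0 < d &
  forall p : P, `|p| < d -> gnorm p < e.
Proof.
move=> e0; have e2 : 0 < e / 2 by rewrite divr_gt0.
have [d1 d10 d1P] := gnorm_horiz_small e2; have [d2 d20 d2P] := gnorm_vert_small e2.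
exists (Num.min d1 d2) => [|[x y]]; first by rewrite lt_min d10.
rewrite lt_min => /andP[pd1 pd2]; apply: le_lt_trans (gnorm_split x y) _.
by rewrite [e]splitr ltrD //; [apply/d1P/(le_lt_trans (norm1 (x, y)))|apply/d2P/(le_lt_trans (norm2 (x, y)))].
Qed.

(* Coordinates of [A^-1 * p]. *)
Definition gdiff (A p : P) : P := (p.1 - A.1, p.2 - A.2 - gbeta A.1 (p.1 - A.1)).

Lemma gdiffE A p : ((gp A)^-1 * gp p)%g = gp (gdiff A p).
Proof.
rewrite gpointV gpointM; congr gp; congr pair; first by rewrite addrC.
rewrite /= gbetaN gbetaD gbetaNr gbetaxx subr0.
by rewrite [- A.2 + _]addrC.
Qed.

Lemma norm_gdiff A p : `|gdiff A p| <= (1 + gbound * `|A|) * `|p - A|.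
Proof.
have B0 := gbound_ge0.
have h1 : `|p.1 - A.1| <= `|p - A| := norm1 (p - A).
have h2 : `|p.2 - A.2| <= `|p - A| := norm2 (p - A).
have hA := norm1 A.
have K1 : 0 <= gbound * `|A| * `|p - A| by rewrite !mulr_ge0.
rewrite prod_normE ge_max /= mulrDl mul1r; apply/andP; split.
  by rewrite (le_trans h1) // lerDl.
rewrite (le_trans (ler_normB _ _)) // lerD // (le_trans (norm_gbeta _ _)) // -mulrA.
by rewrite ler_wpM2l // ler_pM.
Qed.

Lemma norm_le_gdiff A p : `|p - A| <= (1 + gbound * `|A|) * `|gdiff A p|.
Proof.
have B0 := gbound_ge0.
have h1 : `|p.1 - A.1| <= `|gdiff A p| := norm1 (gdiff A p).
have h2 : `|p.2 - A.2 - gbeta A.1 (p.1 - A.1)| <= `|gdiff A p| := norm2 (gdiff A p).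
have hA := norm1 A.
have K1 : 0 <= gbound * `|A| * `|gdiff A p| by rewrite !mulr_ge0.
move: h1 h2 K1; move: `|gdiff A p| => D h1 h2 K1.
rewrite prod_normE ge_max /= mulrDl mul1r; apply/andP; split.
  by rewrite (le_trans h1) // lerDl.
rewrite -[p.2 - A.2](subrK (gbeta A.1 (p.1 - A.1))).
rewrite (le_trans (ler_normD _ _)) // lerD // (le_trans (norm_gbeta _ _)) // -mulrA.
by rewrite ler_wpM2l // ler_pM.
Qed.

(** A homogeneous norm is not assumed continuous: subadditivity reduces the claim to smallness near
    the identity, since [gdiff A p] tends to [0] as [p] tends to [A]. *)
Lemma gnorm_continuous : continuous gnorm.
Proof.
move=> A; apply/cvgrPdist_lt => e e0; have [d d0 dP] := gnorm_small e0.
have K0 : 0 < 1 + gbound * `|A| by rewrite ltr_wpDr // mulr_ge0 // gbound_ge0.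
near=> p.
have pA : `|gdiff A p| < d.
  apply: le_lt_trans (norm_gdiff A p) _; rewrite mulrC -ltr_pdivlMr // distrC.
  by near: p; apply: cvgr_dist_lt => //; rewrite divr_gt0.
have tri1 : gnorm p <= gnorm A + gnorm (gdiff A p).
  rewrite /gnorm -gdiffE -{1}[gp p](mulVKg (gp A)).
  exact: hnormM hN _ _.
have tri2 : gnorm A <= gnorm p + gnorm (gdiff A p).
  rewrite -[gnorm (gdiff A p)](hnormV hN) -gdiffE invgM invgK.
  rewrite /gnorm -{1}[gp A](mulVKg (gp p)).
  exact: hnormM hN _ _.
have := dP _ pA; rewrite ltr_norml; move: tri1 tri2; lra.
Unshelve. all: by end_near. Qed.

(** On the compact Euclidean unit sphere the norm has a positive minimum, and every nonzero point is
    brought to the sphere by a dilation, under which the norm is homogeneous. *)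
Lemma gnorm_small_inv (e : R) : 0 < e -> exists2 r : R, 0 < r &
  forall p : P, gnorm p < r -> `|p| < e.
Proof.
move=> e0; pose S := [set p : P | `|p| = 1].
have cS : compact S.
  apply: (@subclosed_compact _ _ [set p : P | `|p| <= 1]); last by move=> p /= ->.
    apply: (@closed_comp _ _ (fun p : P => `|p|) [set x | x = 1]); last exact: closed_eq.
    by move=> p _; exact: norm_continuous.
  exact: compact_le_norm.
have S0 : S !=set0.
  pose v : P := (const_mx 1, 0).
  have v0 : v != 0.
    apply/eqP => /(congr1 (fun p : P => p.1 0 0)); rewrite /= !mxE => /eqP.
    by rewrite oner_eq0.
  exists (`|v|^-1 *: v); rewrite /S /= normrZ normfV normr_id mulVf //.
  by rewrite normr_eq0.
have cg : {within S, continuous gnorm} by exact/continuous_subspaceT/gnorm_continuous.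
have [p0 /set_mem p0S p0min] := compact_EVT_min S0 cS cg.
have c0 : 0 < gnorm p0.
  by apply: gnorm_gt0; apply/eqP => p00; move: p0S; rewrite /S /= p00 normr0 => /eqP; rewrite eq_sym oner_eq0.
pose eta := Num.min e 1; have eta0 : 0 < eta by rewrite lt_min e0 ltr01.
have etae : eta <= e by rewrite ge_min lexx.
have eta1 : eta <= 1 by rewrite ge_min lexx orbT.
exists (gnorm p0 * eta) => [|p]; first by rewrite mulr_gt0.
have [-> _|pn0 pr] := eqVneq p 0; first by rewrite normr0.
(* The inverse of the dilation factor bringing [p] to the unit sphere for the maximum norm; the
   square root reflects the weight 2 of the vertical coordinates. *)
pose q := Num.max `|p.1| (Num.sqrt `|p.2|).
have q1 : `|p.1| <= q by rewrite le_max lexx.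
have q2 : `|p.2| <= q ^+ 2.
  rewrite -[`|p.2|]sqr_sqrtr // ler_pXn2r ?nnegrE ?sqrtr_ge0 //.
    by rewrite le_max lexx orbT.
  by rewrite le_max normr_ge0.
have q0 : 0 < q.
  rewrite lt_neqAle le_max normr_ge0 /= andbT; apply: contra pn0 => /eqP q0.
  rewrite -q0 in q1 q2; rewrite expr0n normr_le0 in q2; rewrite normr_le0 in q1.
  by rewrite [p]surjective_pairing (eqP q1) (eqP q2).
have S1 : S (q^-1 *: p.1, q^-1 ^+ 2 *: p.2).
  have n1 : `|q^-1 *: p.1| = q^-1 * `|p.1| by rewrite normrZ gtr0_norm // invr_gt0.
  have n2 : `|q^-1 ^+ 2 *: p.2| = q^-1 ^+ 2 * `|p.2|.
    by rewrite normrZ gtr0_norm // exprn_gt0 // invr_gt0.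
  rewrite /S /mkset prod_normE n1 n2.
  have [le1|le1] := leP (Num.sqrt `|p.2|) `|p.1|.
    have qE : q = `|p.1| by rewrite /q max_l.
    rewrite max_l; first by rewrite -qE mulVf // gt_eqF.
    by rewrite -qE mulVf ?gt_eqF // exprVn ler_pdivrMl ?exprn_gt0 // mulr1.
  have qE : q = Num.sqrt `|p.2| by rewrite /q max_r // ltW.
  have qE2 : `|p.2| = q ^+ 2 by rewrite qE sqr_sqrtr.
  rewrite max_r; first by rewrite qE2 exprVn mulVf // gt_eqF // exprn_gt0.
  rewrite qE2 exprVn mulVf ?gt_eqF ?exprn_gt0 // ler_pdivrMl // mulr1 //.
have := p0min _ (mem_set S1); rewrite gnorm_dil ?invr_gt0 // ler_pdivlMl // => h1.
have qe : q < eta.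
  by have := le_lt_trans h1 pr; rewrite mulrC ltr_pM2l.
apply: lt_le_trans etae; rewrite prod_normE gt_max (le_lt_trans q1) //=.
rewrite (le_lt_trans q2) // expr2 (le_lt_trans _ qe) // ler_piMr ?(ltW q0) //.
exact: le_trans (ltW qe) eta1.
Qed.

Lemma gball_sub (A : P) (e : R) : 0 < e -> exists2 r : R, 0 < r &
  gball Exp X Y N A r `<=` [set p | `|p - A| < e].
Proof.
move=> e0; have K0 : 0 < 1 + gbound * `|A| by rewrite ltr_wpDr // mulr_ge0 // gbound_ge0.
have [r r0 rP] := gnorm_small_inv (divr_gt0 e0 K0).
exists r => // p; rewrite /gball /= gdiffE => /rP.
by rewrite ltr_pdivlMr // mulrC; exact: le_lt_trans (norm_le_gdiff _ _).
Qed.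

Lemma gball_nbhs (A : P) (r : R) : 0 < r -> exists2 e : R, 0 < e &
  [set p | `|p - A| < e] `<=` gball Exp X Y N A r.
Proof.
move=> r0; have K0 : 0 < 1 + gbound * `|A| by rewrite ltr_wpDr // mulr_ge0 // gbound_ge0.
have [d d0 dP] := gnorm_small r0.
exists (d / (1 + gbound * `|A|)) => [|p]; first exact: divr_gt0.
rewrite /gball /= gdiffE ltr_pdivlMr // => pd; apply: dP.
by apply: le_lt_trans (norm_gdiff _ _) _; rewrite mulrC.
Qed.

Lemma norm_Winj (p q : 'rV[R]_n * 'rV[R]_h) : `|Winj p - Winj q| = `|p - q|.
Proof.
rewrite !prod_normE; congr Num.max.
rewrite -[(Winj p - Winj q).1]/((row_mx 0 p.1 : 'rV[R]_(1 + n)%N) - row_mx 0 q.1).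
rewrite opp_row_mx add_row_mx subr0 -[(p - q).1]/(p.1 - q.1).
have H (k : 'I_(1 + n)) : `|row_mx (0 : 'rV[R]_1) (p.1 - q.1) 0 k| <= `|p.1 - q.1|.
  case: (split_ordP k) => l ->; first by rewrite row_mxEl mxE normr0.
  by rewrite row_mxEr coord_le_norm.
apply/eqP; rewrite eq_le; apply/andP; split.
  rewrite [leLHS]/Num.norm /= mx_normrE; apply/bigmax_leP; split => // -[i0 i] _ /=.
  rewrite ord1; exact: H.
rewrite [leLHS]/Num.norm /= mx_normrE; apply/bigmax_leP; split => // -[i0 i] _ /=.
rewrite ord1 -(row_mxEr (0 : 'rV[R]_1) (p.1 - q.1)).
exact: coord_le_norm.
Qed.

(** The closure in the group topology is harmless, as a closed Euclidean ball containing the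
    homogeneous ball contains its closure. *)
Lemma Wcball_sub (a : 'rV[R]_n * 'rV[R]_h) (e : R) : 0 < e ->
  exists2 r : R, 0 < r & forall r', r' <= r ->
    Wcball Exp X Y N a r' `<=` [set p | `|p - a| <= e].
Proof.
move=> e0; have [r r0 rP] := gball_sub (Winj a) e0; exists r => // r' r'r p.
rewrite /Wcball /= -norm_Winj => cl.
pose D := [set q : P | `|q - Winj a| <= e].
have cD : closed D.
  apply: (@closed_comp _ _ (fun p : P => `|p - Winj a|) [set x | x <= e]); last exact: closed_le.
  move=> q _; apply: (@continuous_comp _ _ _ (fun p : P => p - Winj a) (fun x => `|x|)).
    by apply: cvgB; [exact: cvg_id|exact: cvg_cst].
  exact: norm_continuous.
suff : D (Winj p) by [].
rewrite ((closure_id D).1 cD); apply: closure_subset cl => q qr.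
by apply/ltW/rP; exact: lt_le_trans qr r'r.
Qed.

Lemma Wcball_nbhs (a : 'rV[R]_n * 'rV[R]_h) (r : R) : 0 < r ->
  exists2 e : R, 0 < e & [set p | `|p - a| < e] `<=` Wcball Exp X Y N a r.
Proof.
move=> r0; have [e e0 eP] := gball_nbhs (Winj a) r0; exists e => // p pe.
by apply/subset_closure/eP; rewrite /= norm_Winj.
Qed.

End CarnotNorm.

(** * From distributional to broad* solutions *)

Section AlongCharacteristic.
Context {R : realType} {n h : nat}.
Local Notation Wc := ('rV[R]_n * 'rV[R]_h)%type.

Lemma test_function_Cc (O : set Wc) (xi : Wc -> R) : test_function O xi -> Cc xi.
Proof.
move=> [Cxi cs _]; split; first exact: (Cxi 0).
have /ex_strict_bound_gt0[r r0 /= Hr] := compact_bounded cs.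
exists r => p rp; apply/eqP; apply: contraTT rp => xp.
by rewrite -leNgt; apply/ltW/Hr/subset_closure.
Qed.

Lemma IWN (f : Wc -> R) : Cc f -> IW (fun p => - f p) = - IW f.
Proof.
move=> Cf; rewrite -mulN1r -IWZ //; apply: (congr1 IW).
by apply/funext => p; rewrite mulN1r.
Qed.

Variables (Lm : 'M[R]_(n, h)) (b : 'rV[R]_h) (j : 'I_n).
Hypothesis ej0 : delta_mx 0 j *m Lm = 0 :> 'rV_h.
Variables (phi w : Wc -> R) (M : R) (O : set Wc).
Hypotheses (cphi : continuous phi) (phiM : forall p, `|phi p| <= M).
Hypotheses (cw : continuous w) (oO : open O).
Hypothesis weak : forall xi, test_function O xi ->
  IW (weak_integrand Lm b (dirx j) phi xi) = - IW (fun p => w p * xi p).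
Variables (a : Wc) (z : R -> R).
Local Notation gam := (charcurve Lm b j a z).
Hypothesis dz : forall r : R, is_derive r (1 : R) z (phi (gam r)).

(** [z] and [b] change sign together, so [z r *: b] and the curve are unchanged, while every term of
    the weak equation changes sign. *)
Lemma characteristic_growth_le (s t c : R) : s < t ->
  (forall r, s <= r <= t -> O (gam r)) ->
  (forall r, s <= r <= t -> w (gam r) <= c) ->
  phi (gam t) - phi (gam s) <= c * (t - s).
Proof.
move=> st Og wc.
pose phi' p := - phi p; pose w' p := - w p; pose z' r := - z r.
have gE r : charcurve Lm (- b) j a z' r = gam r.
  by rewrite /charcurve /z' scalerN scaleNr opprK.
have cphi' : continuous phi' by move=> p; apply: cvgN; exact: cphi.
have cw' : continuous w' by move=> p; apply: cvgN; exact: cw.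
have phiM' p : `|phi' p| <= M by rewrite normrN.
have dz' (r : R) : is_derive r (1 : R) z' (phi' (charcurve Lm (- b) j a z' r)).
  by rewrite gE; exact: is_deriveN.
have weak' xi : test_function O xi ->
    IW (weak_integrand Lm (- b) (dirx j) phi' xi) = - IW (fun p => w' p * xi p).
  move=> txi; have Cxi := test_function_Cc txi; have [Sxi _ _] := txi.
  have dxi p : differentiable xi p by have [+ _] := Sxi 1; exact.
  have -> : IW (fun p => w' p * xi p) = - IW (fun p => w p * xi p).
    rewrite -IWN; last exact: CcMl.
    by apply: (congr1 IW); apply/funext => p; rewrite mulNr.
  rewrite -weak // -IWN; last exact: Cc_weak_integrand.
  apply: (congr1 IW); apply/funext => p; rewrite /weak_integrand.
  rewrite (_ : (0, - b) = - (0, b) :> Wc); last by congr pair; rewrite /= oppr0.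
  rewrite (deriveNv _ (dxi p)) /phi'.
  by move: (phi p) ('D_(dirx j) _ _) ('D_(0, p.1 *m Lm) _ _) ('D_(0, b) _ _) => x y u v; ring.
have := @characteristic_growth R n h Lm (- b) j ej0 phi' M cphi' phiM' a z' dz' w' O s t (- c)
  cw' oO weak' st.
rewrite !gE /phi' => H.
suff : - c * (t - s) <= - phi (gam t) - - phi (gam s) by lra.
by apply: H => r rst; rewrite gE; [exact: Og|rewrite lerN2; exact: wc].
Qed.

(** Near [t] the values of [w] on the curve differ from [w (gam t)] by less than [e]; the two growth
    inequalities with these bounds give the first-order expansion. *)
Lemma is_derive_phi_charcurve (B : R) : (forall r, `|r| < B -> O (gam r)) ->
  forall t : R, `|t| < B -> is_derive t (1 : R) (fun s => phi (gam s)) (w (gam t)).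
Proof.
move=> Og t tB; apply: is_derive_le => e e0.
have : \forall s \near t, `|s| < B /\ `|w (gam t) - w (gam s)| < e.
  apply: filterI.
    by apply: (@norm_continuous _ _ t [set x | x < B]); exact: lt_nbhsl.
  have cwg : {for t, continuous (w \o gam)}.
    by apply: continuous_comp; [exact: (continuous_charcurve dz)|exact: cw].
  by have /cvgrPdist_lt/(_ _ e0) := cwg.
move=> /nbhs_ballP[d /= d0 dP]; exists d => // t' td.
have near_t r : `|r - t| < d -> `|r| < B /\ `|w (gam t) - w (gam r)| < e.
  by move=> rt; apply: dP; rewrite -ball_normE /= distrC.
have gr (s s' : R) : s < s' -> (forall r, s <= r <= s' -> `|r - t| < d) ->
    `|phi (gam s') - phi (gam s) - w (gam t) * (s' - s)| <= e * (s' - s).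
  move=> ss' H.
  have Og' r : s <= r <= s' -> O (gam r) by move=> /H /near_t[? _]; exact: Og.
  have lo : (w (gam t) - e) * (s' - s) <= phi (gam s') - phi (gam s).
    apply: (characteristic_growth ej0 cphi phiM dz cw oO weak ss' Og') => r /H /near_t[_].
    by rewrite ltr_norml => /andP[? ?]; lra.
  have up : phi (gam s') - phi (gam s) <= (w (gam t) + e) * (s' - s).
    apply: (characteristic_growth_le ss' Og') => r /H /near_t[_].
    by rewrite ltr_norml => /andP[? ?]; lra.
  rewrite mulrBl in lo; rewrite mulrDl in up.
  by rewrite ler_norml; apply/andP; split; lra.
move: td; rewrite ltr_norml => /andP[td1 td2].
have [tt|tt|->] := ltgtP t t'; last by rewrite !subrr mulr0 subr0 normr0 mulr0.
  rewrite (gtr0_norm (_ : 0 < t' - t)) ?subr_gt0 //; apply: gr => // r /andP[r1 r2].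
  by rewrite ltr_norml; apply/andP; split; lra.
rewrite (ltr0_norm (_ : t' - t < 0)) ?subr_lt0 // opprB.
have := gr t' t tt; rewrite -[X in `|X| <= _]opprK normrN.
have -> : - (phi (gam t) - phi (gam t') - w (gam t) * (t - t')) =
  phi (gam t') - phi (gam t) - w (gam t) * (t' - t) by ring.
apply=> r /andP[r1 r2].
by rewrite ltr_norml; apply/andP; split; lra.
Qed.

Lemma ointegral_phi_charcurve (B : R) : (forall r, `|r| < B -> O (gam r)) ->
  forall t : R, `|t| < B ->
  phi (gam t) - phi (gam 0) = ointegral (fun s => w (gam s)) 0 t.
Proof.
move=> Og t tB; have D := is_derive_phi_charcurve Og.
have cwg : continuous (fun s => w (gam s)).
  move=> s; apply: (@continuous_comp _ _ _ gam w); last exact: cw.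
  exact: (continuous_charcurve dz).
have cpg : continuous (fun s => phi (gam s)).
  move=> s; apply: (@continuous_comp _ _ _ gam phi); last exact: cphi.
  exact: (continuous_charcurve dz).
have ftc (s s' : R) : s < s' -> `|s| < B -> `|s'| < B ->
    \int[lebesgue_measure]_(x in `[s, s']) w (gam x) = phi (gam s') - phi (gam s).
  move=> ss' sB s'B.
  have inB x : x \in `]s, s'[ -> `|x| < B.
    move: sB s'B; rewrite in_itv /= !ltr_norml => /andP[? ?] /andP[? ?] /andP[? ?].
    by apply/andP; split; lra.
  rewrite /Rintegral (@continuous_FTC2 _ _ (fun s => phi (gam s)) _ _ ss') //.
  - exact: continuous_subspaceT.
  - split; first by move=> x /inB /D[].
      by apply: cvg_at_right_filter; exact: cpg.
    by apply: cvg_at_left_filter; exact: cpg.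
  - by move=> x /inB /D[_]; rewrite derive1E.
have B0 : `|0 : R| < B by rewrite normr0 (le_lt_trans _ tB).
rewrite /ointegral; have [t0|t0|<-] := ltgtP 0 t.
- by rewrite ftc.
- by rewrite ftc // opprB.
- by rewrite set_itv1 Rintegral_set1 subrr.
Qed.

End AlongCharacteristic.

(** * Extension of the data beyond a ball *)

Section Retraction.
Context {R : realType} {V : normedModType R}.
Variables (a : V) (rho : R).
Hypothesis rho0 : 0 < rho.

(** Radial projection onto the closed ball. The maximum with [rho] in the denominator covers both
    regimes and makes continuity evident. *)
Definition retr (p : V) : V := a + (rho / Num.max rho `|p - a|) *: (p - a).

Let max_gt0 p : 0 < Num.max rho `|p - a|.
Proof. by rewrite lt_max rho0. Qed.

Lemma retr_le p : `|retr p - a| <= rho.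
Proof.
rewrite /retr addrC addKr normrZ ger0_norm ?divr_ge0 ?(ltW rho0) ?(ltW (max_gt0 p)) //.
by rewrite mulrAC ler_pdivrMr // ler_pM2l // le_max lexx orbT.
Qed.

Lemma retr_id p : `|p - a| <= rho -> retr p = p.
Proof.
by move=> pa; rewrite /retr max_l // divff ?gt_eqF // scale1r addrC subrK.
Qed.

Lemma retr_continuous : continuous retr.
Proof.
move=> p; apply: cvgD; first exact: cvg_cst.
have cs : {for p, continuous (fun q => q - a)} by apply: cvgB; [exact: cvg_id|exact: cvg_cst].
apply: cvgZ; last exact: cs.
apply: cvgM; first exact: cvg_cst.
apply: cvgV; first by rewrite gt_eqF // max_gt0.
apply: (@continuous_max _ _ (cst rho) (fun q => `|q - a|)); first exact: cvg_cst.
by apply: (@continuous_comp _ _ _ (fun q => q - a) (fun x => `|x|)) => //; exact: norm_continuous.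
Qed.

End Retraction.

Lemma is_derive_within {R : realType} {V : normedModType R} (A : set R)
    (gamma : R -> V) (t : R) (v : V) :
  is_derive t (1 : R) gamma v -> derive_within A gamma t v.
Proof.
move=> [dg <-]; rewrite /derive_within.
have cv : h^-1 *: (gamma (h *: (1 : R) + t) - gamma t) @[h --> (0 : R)^'] --> 'D_1 gamma t.
  exact: dg.
apply/cvgrPdist_lt => e e0.
have /cvgrPdist_lt/(_ _ e0) := cv.
rewrite near_withinE => /nbhs_ballP[d /= d0 dP].
rewrite near_withinE; apply/nbhs_ballP; exists d => //= s; rewrite -ball_normE /= => st [_ /eqP sn].
have : `|'D_1 gamma t - (s - t)^-1 *: (gamma ((s - t) *: (1 : R) + t) - gamma t)| < e.
  apply: dP; first by rewrite -ball_normE /= sub0r normrN distrC.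
  by rewrite subr_eq0.
by rewrite (_ : (s - t) *: (1 : R) + t = s) // /GRing.scale /= mulr1 subrK.
Qed.

Section FromDistributions.
Context {R : realType} {n h : nat}.
Local Notation Wc := ('rV[R]_n * 'rV[R]_h)%type.
Variable bb : 'I_h -> 'I_n.+1 -> 'I_n.+1 -> R.
Hypothesis bb0 : forall i j, bb i j j = 0.
Variables (U : set Wc) (phi : Wc -> R) (omega : Wc -> 'rV[R]_n).
Hypothesis oU : open U.
Hypothesis cphi : {within U, continuous phi}.
Hypothesis comega : {within U, continuous omega}.
Hypothesis dist : distributional_solution bb U phi omega.

Definition drift (j : 'I_n) : 'M[R]_(n, h) :=
  \matrix_(k, i) (2^-1 * bb i (lift ord0 j) (lift ord0 k)).

Definition transport (j : 'I_n) : 'rV[R]_h := \row_i bb i (lift ord0 j) ord0.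

(** The [j]-th row consists of the coefficients of [[X_j, X_j] = 0]; this provides the hypothesis
    [ej0] on characteristics. *)
Lemma drift0 j : delta_mx 0 j *m drift j = 0 :> 'rV_h.
Proof. by rewrite -rowE; apply/rowP => i; rewrite !mxE bb0 mulr0. Qed.

Lemma DphiE f j p :
  Dphi bb f j p = dirx j - (0, p.1 *m drift j) - f p *: (0, transport j).
Proof.
have S1 (F : 'I_h -> Wc) : (\sum_i F i).1 = \sum_i (F i).1.
  by elim/big_ind2 : _ => // x y z t <- <-.
have S2 (F : 'I_h -> Wc) : (\sum_i F i).2 = \sum_i (F i).2.
  by elim/big_ind2 : _ => // x y z t <- <-.
rewrite /Dphi -addrA -opprD; congr (_ - _).
have -> : (0, p.1 *m drift j) + f p *: (0, transport j) =
    (0, p.1 *m drift j + f p *: transport j) :> Wc.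
  by congr pair; rewrite /= scaler0 addr0.
rewrite [LHS]surjective_pairing S1 S2 /=; congr pair.
  by rewrite big1 // => i _; exact: scaler0.
rewrite (eq_bigr (fun i => (bb i (lift ord0 j) ord0 * f p + 2^-1 * \sum_(k < n)
    p.1 0 k * bb i (lift ord0 j) (lift ord0 k)) *: (delta_mx 0 i : 'rV[R]_h))) //.
apply/rowP => i; rewrite summxE (bigD1 i) //= [X in _ + X = _]big1 ?addr0; last first.
  by move=> k ki; rewrite !mxE eqxx /= eq_sym (negbTE ki) mulr0.
rewrite !mxE !eqxx mulr1 addrC [f p * _]mulrC; congr (_ + _).
by rewrite mulr_sumr; apply: eq_bigr => k _; rewrite !mxE mulrCA.
Qed.

Section Local.
Variables (a0 : Wc) (rho : R).
Hypothesis rho0 : 0 < rho.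
Hypothesis ballU : forall p, `|p - a0| <= rho -> U p.

Let phi' p := phi (retr a0 rho p).
Let w' j p := omega (retr a0 rho p) 0 j.
Let O := [set p : Wc | `|p - a0| < rho].

Lemma continuous_phi_retr : continuous phi'.
Proof.
move=> p; apply: (@continuous_comp _ _ _ (retr a0 rho) phi).
  exact: retr_continuous.
have cU : {in U, continuous phi} by rewrite -continuous_open_subspace.
by apply: cU; rewrite inE; apply/ballU/retr_le.
Qed.

Lemma continuous_omega_retr j : continuous (w' j).
Proof.
move=> p; apply: (@continuous_comp _ _ _ (fun p => omega (retr a0 rho p)) (fun x : 'rV[R]_n => x 0 j)).
  apply: (@continuous_comp _ _ _ (retr a0 rho) omega); first exact: retr_continuous.
  have cU : {in U, continuous omega} by rewrite -continuous_open_subspace.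
  by apply: cU; rewrite inE; apply/ballU/retr_le.
exact: coord_continuous.
Qed.

Lemma open_O : open O.
Proof.
rewrite (_ : O = ball a0 rho); first exact: ball_open.
by apply/seteqP; split => p; rewrite /O -ball_normE /= distrC.
Qed.

Lemma integralW_IW (F : Wc -> R) : (forall p, ~ U p -> F p = 0) ->
  integralW U F = IW F.
Proof.
move=> F0; rewrite IWE /integralW Rintegral_mkcond; apply: eq_Rintegral => t _.
rewrite patchE; case: ifPn => // /negP tU; apply/esym/F0 => Ut; apply: tU.
by rewrite inE.
Qed.

(** The retraction is the identity on [O], while off [O] a test function supported in [O] vanishes
    together with its derivatives. What remains is to regroup the coefficients of the field into
    [drift] and [transport]. *)
Lemma weak_retr j (xi : Wc -> R) : test_function O xi ->
  IW (weak_integrand (drift j) (transport j) (dirx j) phi' xi)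
  = - IW (fun p => w' j p * xi p).
Proof.
move=> txi; have Cxi := test_function_Cc txi; have [Sxi csupp suppO] := txi.
have OU : O `<=` U by move=> p pO; apply: ballU; exact: ltW.
have txiU : test_function U xi by split => //; exact: subset_trans OU.
have dxi p : differentiable xi p by have [+ _] := Sxi 1; exact.
have out p : ~ O p -> \forall q \near p, xi q = 0.
  move=> pO; have : (~` closure [set x | xi x != 0]) p by move=> /suppO.
  have : open (~` closure [set x | xi x != 0]) by apply: closed_openC; exact: closed_closure.
  rewrite openE => /[apply]; apply: filterS => q qc; apply/eqP; apply: contra_notT qc => xq.
  exact: subset_closure.
have xi0 p : ~ O p -> xi p = 0 by move=> /out /nbhs_singleton.
have D0 p v : ~ O p -> 'D_v xi p = 0.
  move=> pO; rewrite -[RHS](derive_cst (0 : R) p v); apply: near_eq_derive.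
  by apply: filterS (out p pO).
have phiE p : O p -> phi' p = phi p by move=> pO; rewrite /phi' retr_id // ltW.
have omE p : O p -> w' j p = omega p 0 j by move=> pO; rewrite /w' retr_id // ltW.
have := dist j txiU.
rewrite integralW_IW; last first.
  move=> p pU; have pO : ~ O p by move=> /OU.
  rewrite D0 // mulr0 !big1 ?mulr0 ?addr0 // => i _; first by rewrite big1 // => k _; rewrite D0 // mulr0.
  by rewrite D0 // mulr0.
rewrite integralW_IW; last by move=> p pU; rewrite xi0 ?mulr0 // => /OU.
have -> : (fun p => omega p 0 j * xi p) = (fun p => w' j p * xi p).
  by apply/funext => p; have [/omE ->//|/xi0 ->] := pselect (O p); rewrite !mulr0.
move=> <-; rewrite -[LHS]opprK; congr (- _).
rewrite -IWN; last exact: (Cc_weak_integrand _ _ _ continuous_phi_retr (Sxi 1) Cxi).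
apply: (congr1 IW); apply/funext => p.
have [pO|pO] := pselect (O p); last first.
  rewrite /weak_integrand !D0 // subrr !mulr0 subr0 oppr0 !big1 ?mulr0 ?addr0 // => i _.
    by rewrite big1 // => k _; rewrite D0 // mulr0.
  by rewrite D0 // mulr0.
rewrite /weak_integrand phiE // !derive_vert //.
set D := 'D_(dirx j) xi p; set x := phi p.
have E1 : x * (\sum_(i < h) (p.1 *m drift j) 0 i * 'D_(diry i) xi p) =
    2^-1 * \sum_(i < h) \sum_(k < n)
      p.1 0 k * bb i (lift ord0 j) (lift ord0 k) * x * 'D_(diry i) xi p.
  rewrite !mulr_sumr; apply: eq_bigr => i _; rewrite mxE mulr_suml !mulr_sumr.
  apply: eq_bigr => k _; rewrite !mxE.
  by move: ('D_(diry i) xi p) => d; ring.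
have E2 : 2^-1 * x ^+ 2 * (\sum_(i < h) transport j 0 i * 'D_(diry i) xi p) =
    2^-1 * \sum_(i < h) bb i (lift ord0 j) ord0 * x ^+ 2 * 'D_(diry i) xi p.
  rewrite !mulr_sumr; apply: eq_bigr => i _; rewrite mxE.
  by move: ('D_(diry i) xi p) => d; ring.
rewrite mulrBr E1 E2.
by move: D (2^-1 * _) (2^-1 * _) => d u v; ring.
Qed.

Lemma bounded_phi_retr : exists M : R, forall p, `|phi' p| <= M.
Proof.
have cK : compact [set p : Wc | `|p| <= `|a0| + rho] by exact: compact_le_norm.
have /ex_strict_bound_gt0[M M0 /= HM] : bounded_set (phi' @` [set p : Wc | `|p| <= `|a0| + rho]).
  apply/compact_bounded/continuous_compact => //.
  exact/continuous_subspaceT/continuous_phi_retr.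
exists M => p; apply/ltW/HM; exists (retr a0 rho p).
  rewrite /= -[retr a0 rho p](subrK a0) (le_trans (ler_normD _ _)) // addrC lerD2l.
  exact: retr_le.
by rewrite /phi' [in LHS]retr_id // retr_le.
Qed.

Variable M : R.
Hypothesis phiM : forall p, `|phi' p| <= M.

(** Bounds the displacement per unit of time of a characteristic issued from the closed ball: 1 for
    [e_j], then the drift, then the part along [transport j]. *)
Definition speed_bound (j : 'I_n) : R :=
  1 + mxbound (drift j) * (`|a0| + rho) + M * `|transport j|.

Lemma speed_bound_ge1 j : 1 <= speed_bound j.
Proof.
have M0 : 0 <= M by exact: le_trans (phiM 0).
by rewrite /speed_bound -addrA lerDl addr_ge0 // mulr_ge0 // ?mxbound_ge0 // addr_ge0 // ltW.
Qed.

(** The factor 2 in front of [d] leaves room at the end points: the derivative of [phi] along the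
    curve is obtained for times of absolute value less than [2 * d]. *)
Lemma characteristic_exists (j : 'I_n) (a : Wc) (d e : R) :
  `|a - a0| <= rho -> 0 < d -> 2 * d * speed_bound j <= e ->
  (forall p, `|p - a| <= e -> `|p - a0| < rho) ->
  exists gamma : R -> Wc,
  [/\ forall t, t \in `[- d, d] -> `|gamma t - a| <= e,
      C1_integral_curve (Dphi bb phi j) a d gamma &
      forall t, t \in `[- d, d] ->
        phi (gamma t) - phi a = ointegral (fun s => omega (gamma s) 0 j) 0 t].
Proof.
move=> aa0 d0 de aO; have M0 : 0 <= M by exact: le_trans (phiM 0).
set Lm := drift j; set b := transport j.
pose V : Wc := (delta_mx 0 j, - (a.1 *m Lm)); pose B : Wc := (0, b).
pose m (t x : R) : Wc := (a.1 + t *: delta_mx 0 j, a.2 - t *: (a.1 *m Lm) - x *: b).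
have cf t x (eps : R) : 0 < eps -> exists2 dd : R, 0 < dd & forall t' x',
    `|t' - t| < dd -> `|x' - x| < dd -> `|phi' (m t' x') - phi' (m t x)| <= eps.
  move=> eps0; have := @continuous_phi_retr (m t x) => /cvgrPdist_lt/(_ _ eps0).
  move=> /nbhs_normP[r /= r0 rP].
  have C0 : 0 < `|V| + `|B| + 1 by rewrite ltr_wpDl // addr_ge0.
  exists (r / (`|V| + `|B| + 1)) => [|t' x' tt xx]; first exact: divr_gt0.
  rewrite distrC ltW //; apply: rP; rewrite /= distrC.
  have -> : m t' x' - m t x = (t' - t) *: V - (x' - x) *: B.
    rewrite /m /V /B; move: (a.1 *m Lm) => y.
    by congr pair; apply/rowP => i; rewrite !mxE; ring.
  rewrite (le_lt_trans (ler_normB _ _)) // !normrZ.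
  rewrite ltr_pdivlMr // in tt; rewrite ltr_pdivlMr // in xx.
  pose mx := Num.max `|t' - t| `|x' - x|.
  have mr : mx * (`|V| + `|B| + 1) < r by rewrite /mx; have [_|_] := leP `|t' - t| `|x' - x|.
  apply: le_lt_trans mr; rewrite !mulrDr mulr1.
  rewrite -[leLHS]addr0 lerD //; last by rewrite le_max normr_ge0.
  by rewrite lerD // ler_wpM2r // le_max lexx ?orbT.
have fM t x : `|phi' (m t x)| <= M by exact: phiM.
(* The rest of the curve being explicit, the only unknown is the scalar height along [b], which
   solves a scalar equation. *)
have [z [z0 zM dz]] := peano fM cf.
pose gam := charcurve Lm b j a z.
have gam0 : gam 0 = a.
  by rewrite /gam /charcurve z0 !scale0r addr0 !subr0; case: (a).
have sp0 : 0 <= speed_bound j by exact: le_trans (speed_bound_ge1 j).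
have gamE t : `|gam t - a| <= `|t| * speed_bound j.
  have a1 : `|a.1| <= `|a0| + rho.
    apply: (@le_trans _ _ `|a|); first by rewrite prod_normE le_max lexx.
    by rewrite -[a](subrK a0) (le_trans (ler_normD _ _)) // addrC lerD2l.
  have mb := mxbound_ge0 Lm.
  have n1 : `|(gam t - a).1| <= `|t|.
    rewrite (_ : (gam t - a).1 = t *: delta_mx 0 j); last by rewrite /= addrC addKr.
    rewrite normrZ ler_piMr // [leLHS]/Num.norm /= mx_normrE.
    apply/bigmax_leP; split => // -[i0 i] _ /=.
    by rewrite mxE; case: (_ && _); rewrite ?normr1 ?normr0.
  have n2 : `|(gam t - a).2| <= `|t| * (mxbound Lm * (`|a0| + rho) + M * `|b|).
    rewrite (_ : (gam t - a).2 = - (t *: (a.1 *m Lm)) - z t *: b); last first.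
      by rewrite /=; move: (a.1 *m Lm) => y; apply/rowP => i; rewrite !mxE; ring.
    rewrite (le_trans (ler_normB _ _)) // normrN !normrZ mulrDr lerD //.
      rewrite ler_wpM2l // (le_trans (norm_mulmx_le _ _)) //.
      by rewrite ler_wpM2l.
    by rewrite mulrA [_ * M]mulrC ler_wpM2r.
  rewrite prod_normE ge_max; apply/andP; split.
    by rewrite (le_trans n1) // ler_peMr // speed_bound_ge1.
  rewrite (le_trans n2) // ler_wpM2l // /speed_bound -/Lm -/b -addrA lerDr //.
have gamO t : `|t| < 2 * d -> O (gam t).
  move=> td; apply: aO; apply: le_trans (gamE t) (le_trans _ de).
  by rewrite ler_wpM2r // ltW.
have inB t : t \in `[- d, d] -> `|t| < 2 * d.
  rewrite in_itv /= -ler_norml => td; lra.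
have phiE t : `|t| < 2 * d -> phi (gam t) = phi' (gam t).
  by move=> td; rewrite /phi' retr_id // ltW // gamO.
have omE t : `|t| < 2 * d -> omega (gam t) 0 j = w' j (gam t).
  by move=> td; rewrite /w' retr_id // ltW // gamO.
have Dg t := is_derive_charcurve dz t.
have DE t : `|t| < 2 * d -> Dphi bb phi j (gam t) =
    dirx j - (0, a.1 *m Lm) - phi' (gam t) *: (0, b).
  move=> td; rewrite DphiE phiE // -/Lm; congr (_ - (0, _) - _).
  by rewrite /gam /charcurve /= mulmxDl -scalemxAl drift0 scaler0 addr0.
have cg : continuous gam by exact: (continuous_charcurve dz).
exists gam; split.
- move=> t /inB td; apply: le_trans (gamE t) (le_trans _ de).
  by rewrite ler_wpM2r // ltW.
- split => //.
  + by move=> t /inB td; rewrite DE //; apply: is_derive_within; exact: Dg.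
  + apply: (@subspace_eq_continuous _ `[- d, d] _
      (fun t => dirx j - (0, a.1 *m Lm) - phi' (gam t) *: (0, b)) (Dphi bb phi j \o gam)).
      by move=> t; rewrite inE /= => tt; rewrite DE // inB.
    apply: continuous_subspaceT => t.
    apply: cvgB; first exact: cvg_cst.
    apply: cvgZr_tmp.
    apply: (@continuous_comp _ _ _ gam phi'); [exact: cg|exact: continuous_phi_retr].
- move=> t tt; have td := inB t tt.
  have d2 : `|0 : R| < 2 * d by rewrite normr0 mulr_gt0.
  have -> : phi a = phi' (gam 0) by rewrite -phiE // gam0.
  rewrite phiE //.
  rewrite (ointegral_phi_charcurve (drift0 j) continuous_phi_retr phiM
    (@continuous_omega_retr j) open_O (@weak_retr j) dz gamO td).
  have seg s : 0 <= s <= t \/ t <= s <= 0 -> `|s| < 2 * d.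
    by move: td; rewrite !ltr_norml => /andP[? ?] [/andP[? ?]|/andP[? ?]]; apply/andP; split; lra.
  rewrite /ointegral; case: ifP => t0; [|congr (- _)];
    apply: eq_Rintegral => s; rewrite inE /= in_itv /= => st; rewrite omE //; apply: seg.
    by left.
  by right.
Qed.

End Local.

End FromDistributions.

Theorem theorem4p1 (R : realType)
    (g : vectType R) (br : g -> g -> g) (V1 V2 : {vspace g})
    (G : groupType) (Exp : g -> G)
    (hG : is_carnot2 br V1 V2 Exp)
    (N : G -> R) (hN : homogeneous_norm V1 V2 Exp N)
    (W L : set G)
    (hWL : complementary V1 V2 Exp W L) (hL : horizontal_one_dim V1 Exp L)
    (n h : nat) (X : n.+1.-tuple g) (Y : h.-tuple g)
    (hXY : adapted_basis br V1 V2 Exp W L X Y)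
    (U : set ('rV[R]_n * 'rV[R]_h)) (hU : open U)
    (phi : 'rV[R]_n * 'rV[R]_h -> R) (hphi : {within U, continuous phi})
    (omega : 'rV[R]_n * 'rV[R]_h -> 'rV[R]_n)
    (homega : {within U, continuous omega})
    (hdist : distributional_solution (structc br X Y) U phi omega) :
  broad_star_solution (structc br X Y) U phi omega (Wcball Exp X Y N).
Proof.
have bb0 i j : structc br X Y i j j = 0.
  by rewrite /structc; have [_ _ -> _] := carnot2_lie hG; rewrite linear0.
have bX := adapted_X hXY; have bY := adapted_Y hXY.
move=> a0 Ua0.
have [rho rho0 ballU] : exists2 rho : R, 0 < rho & forall p, `|p - a0| <= rho -> U p.
  have /nbhs_normP[r /= r0 rU] : nbhs a0 U by exact: open_nbhs_nbhs.
  exists (r / 2) => [|p pr]; first by rewrite divr_gt0.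
  by apply: rU; rewrite /= distrC (le_lt_trans pr) // ltr_pdivrMr // ltr_pMr // ltr1n.
have [M phiM] := bounded_phi_retr hU hphi rho0 ballU.
pose sp j := speed_bound (structc br X Y) a0 rho M j.
have sp1 j : 1 <= sp j by exact: (speed_bound_ge1 _ rho0 phiM).
(* A common bound of all speeds, giving an existence time independent of [j]. *)
pose S := 1 + \sum_(j < n) sp j.
have spS j : sp j <= S.
  rewrite /S (bigD1 j) //= addrCA lerDl addr_ge0 // sumr_ge0 // => k _.
  exact: le_trans (sp1 k).
have S0 : 0 < S.
  by rewrite /S ltr_pwDl // sumr_ge0 // => k _; exact: le_trans (sp1 k).
have rho2 : 0 < rho / 2 by rewrite divr_gt0.
have [d1 d10 d1P] := Wcball_sub hG hN bX bY a0 rho2.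
have [e1 e10 e1P] := Wcball_nbhs hG hN bX bY a0 d10.
have e12 : 0 < e1 / 2 by rewrite divr_gt0.
have [r2 r20 r2P] := Wcball_sub hG hN bX bY a0 e12.
(* [d1 / 2] gives [d2 < d1]; [r2] puts the starting points within [e1 / 2] of [a0]; the last bound
   keeps the curves within [e1 / 4] of their starting points, hence in the trace of the closed ball
   of radius [d1]. *)
pose d2 := Num.min (Num.min (d1 / 2) r2) (e1 / (8 * S)).
have d20 : 0 < d2 by rewrite !lt_min r20 (divr_gt0 d10) // divr_gt0 // mulr_gt0.
have d2d1 : d2 <= d1 / 2 by rewrite !ge_min lexx.
have d2r2 : d2 <= r2 by rewrite !ge_min lexx orbT.
have d2e1 : d2 * (8 * S) <= e1 by rewrite -ler_pdivlMr ?mulr_gt0 // ge_min lexx orbT.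
have near_a0 a p : `|a - a0| <= e1 / 2 -> `|p - a| <= e1 / 4 ->
    Wcball Exp X Y N a0 d1 p.
  move=> aa pa; apply: e1P; rewrite /= -(subrK a p) -addrA.
  by rewrite (le_lt_trans (ler_normD _ _)) //; lra.
have in_rho p : Wcball Exp X Y N a0 d1 p -> `|p - a0| < rho.
  by move=> /(d1P _ (lexx _)) /= pr; lra.
(* The curves for all indices and starting points are selected by one application of choice;
   starting points off the ball receive a dummy constant curve. *)
have ex (ja : 'I_n * ('rV[R]_n * 'rV[R]_h)) : exists gamma : R -> 'rV[R]_n * 'rV[R]_h,
    Wcball Exp X Y N a0 d2 ja.2 ->
    [/\ forall t, t \in `[- d2, d2] -> Wcball Exp X Y N a0 d1 (gamma t),
      C1_integral_curve (Dphi (structc br X Y) phi ja.1) ja.2 d2 gamma &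
      forall t, t \in `[- d2, d2] ->
        phi (gamma t) - phi ja.2 = ointegral (fun s => omega (gamma s) 0 ja.1) 0 t].
  case: ja => j a /=.
  have [ain|?] := pselect (Wcball Exp X Y N a0 d2 a); last by exists (fun=> 0).
  have aa : `|a - a0| <= e1 / 2 by exact: (r2P _ d2r2).
  have aO p : `|p - a| <= e1 / 4 -> `|p - a0| < rho by move=> /(near_a0 _ _ aa)/in_rho.
  have arho : `|a - a0| <= rho by apply/ltW/aO; rewrite subrr normr0 divr_ge0 // ltW.
  have de : 2 * d2 * sp j <= e1 / 4.
    have : d2 * sp j <= d2 * S by rewrite ler_pM2l.
    lra.
  have [gamma [g1 g2 g3]] := characteristic_exists bb0 hU hphi homega hdist rho0 ballU
    phiM arho d20 de aO.
  exists gamma => _; split; [|exact: g2|exact: g3].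
  by move=> t tt; apply: (near_a0 a) => //; exact: g1.
have [E EP] := choice ex.
exists d1, d2; split => //; first by lra.
  by move=> p /in_rho /ltW; exact: ballU.
by exists (fun j a => E (j, a)) => a j; exact: (EP (j, a)).
Qed.
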